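(* Let $(X,\phi)$ be a non-compact, connected calibrated manifold with $\phi$ parallel. Suppose $X$ is strictly $\phi$-convex, $K$ is a compact subset of $X$, and $x\in X-K$. Then there exists a Green's current $T_x$ for $(K,x)$ if and only if $x\in\widehat K$.
   Context: A calibrated manifold $(X,\phi)$ of degree $p\ge 1$ is a smooth riemannian manifold $X$ together with a closed smooth $p$-form $\phi$ such that $\phi(\xi)\le 1$ for every unit simple tangent $p$-vector $\xi$ on $X$; $\phi$ is parallel if $\nabla\phi=0$. $G_x(\phi)$ denotes the set of unit simple $p$-vectors $\xi$ at $x$ with $\phi(\xi)=1$ ($\phi$-planes). For $f\in C^\infty(X)$, set $d^\phi f=\nabla f\,\lrcorner\,\phi$ and $dd^\phi f=d(d^\phi f)$. $f$ is $\phi$-plurisubharmonic if $(dd^\phi f)(\xi)\ge 0$ for all $\phi$-planes $\xi$, and strictly $\phi$-plurisubharmonic if $(dd^\phi f)(\xi)>0$ for all $\phi$-planes $\xi$. $\mathcal{PSH}(X,\phi)$ is the set of smooth $\phi$-plurisubharmonic functions on $X$. $X$ is strictly $\phi$-convex if it admits a strictly $\phi$-plurisubharmonic function $f$ with $\{f\le c\}$ compact for all $c\in\mathbb R$. For compact $K\subset X$, $\widehat K=\{x\in X:f(x)\le\sup_Kf\ \text{for all }f\in\mathcal{PSH}(X,\phi)\}$. A $\phi$-positive (also called $\Lambda_+(\phi)$-positive) current is a $p$-dimensional current $T$ which is representable by integration, $T(\alpha)=\int\alpha(\vec T)\,d\|T\|$ for compactly supported smooth $p$-forms $\alpha$, where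 $\|T\|$ is a Radon measure and $\vec T_y$ lies in the convex hull of $G_y(\phi)\subset\Lambda_pT_yX$ for $\|T\|$-almost every $y$. Equivalently, $T(\alpha)\ge 0$ for every smooth compactly supported $p$-form $\alpha$ with $\alpha(\xi)\ge 0$ for all $\phi$-planes $\xi$. For a $p$-dimensional current $T$, $\partial_\phi\partial T$ is the $0$-dimensional current defined by $(\partial_\phi\partial T)(f)=T(dd^\phi f)$ for $f\in C^\infty_{\mathrm{cpt}}(X)$. A Green's current for $(K,x)$ is a $\phi$-positive current $T_x$ with compact support in $X$ satisfying $\partial_\phi\partial T_x=\mu_x-[x]$ for some probability measure $\mu_x$ with support in $K$, where $[x]$ is the Dirac measure at $x$. *)

(* Defs.v *)
From HB Require Import structures.
From mathcomp Require Import all_boot all_order all_algebra.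
From mathcomp Require Import all_classical all_reals all_analysis.

Set Implicit Arguments.
Unset Strict Implicit.
Unset Printing Implicit Defensive.

Import Order.TTheory GRing.Theory Num.Theory.
Import numFieldNormedType.Exports.

Local Open Scope classical_set_scope.
Local Open Scope ring_scope.

(* [f] is of class C^k (C^oo) on the open subset [U] of R^n: all iterated
   partial derivatives of order at most k (of every order) exist and are
   continuous on [U]. *)
Section smooth_euclidean.
Context {R : realType} {n : nat}.
Implicit Types (U : set 'rV[R]_n) (f g : 'rV[R]_n -> R).

Fixpoint Ck (k : nat) U f : Prop :=
  (forall u, U u -> {for u, continuous f}) /\
  (if k is k'.+1 then
     forall i : 'I_n, (forall u, U u -> derivable f u (delta_mx 0 i)) /\
       Ck k' U (fun u => 'D_(delta_mx 0 i) f u)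
   else True).

Definition smooth_on U f := forall k, Ck k U f.

Lemma Ck_cont k U f : Ck k U f -> forall u, U u -> {for u, continuous f}.
Proof. by case: k => [|k] []. Qed.

Lemma Ck_ext k U f g : open U -> (forall u, U u -> f u = g u) ->
  Ck k U f -> Ck k U g.
Proof.
move=> oU.
have near_fg (h h' : 'rV[R]_n -> R) : (forall u, U u -> h u = h' u) ->
    forall u, U u -> \forall v \near u, h v = h' v.
  move=> hh' u Uu; apply: filterS (open_nbhs_nbhs (conj oU Uu)) => v.
  exact: hh'.
have contE (h h' : 'rV[R]_n -> R) : (forall u, U u -> h u = h' u) ->
    (forall u, U u -> {for u, continuous h}) ->
    forall u, U u -> {for u, continuous h'}.
  move=> hh' ch u Uu; rewrite /prop_for /continuous_at -(hh' u Uu).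
  apply: cvg_trans (ch u Uu); apply: (@near_eq_cvg _ _ (nbhs u)).
  exact: (near_fg _ _ hh' u Uu).
elim: k f g => [|k IHk] f g fg [cf df]; first by split=> //; exact: contE cf.
split=> [|i]; first exact: contE cf.
have [dif cdf] := df i; split=> [u Uu|].
  exact: near_eq_derivable (near_fg _ _ fg u Uu) (dif u Uu).
by apply: IHk cdf => u Uu /=; apply: near_eq_derive; 
  exact: (near_fg _ _ fg u Uu).
Qed.

Lemma Ck_cst k U (c : R) : Ck k U (fun=> c).
Proof.
elim: k c => [|k IHk] c; first by split=> // u _; exact: cst_continuous.
split=> [u _|i]; first exact: cst_continuous.
split=> [u _|]; first exact: derivable_cst.
have -> : (fun u => 'D_(delta_mx 0 i) (fun=> c) u) = (fun=> 0) :> ('rV[R]_n -> R).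
  by apply/funext => u; exact: derive_cst.
exact: IHk.
Qed.

Lemma Ck_lin k U (a : R) f g : open U -> Ck k U f -> Ck k U g ->
  Ck k U (a \*: f + g).
Proof.
move=> oU Cf Cg.
have cD h h' : Ck 0 U h -> Ck 0 U h' -> Ck 0 U (a \*: h + h').
  move=> [ch _] [ch' _]; split=> // u Uu.
  by apply: continuousD; [apply: continuousZl_tmp; exact: ch|exact: ch'].
elim: k f g Cf Cg => [|k IHk] f g [cf df] [cg dg]; first exact: cD.
split=> [|i]; first by case: (cD f g).
have [dif cdf] := df i; have [dig cdg] := dg i.
split=> [u Uu|].
  by apply: derivableD; [apply: derivableZ; exact: dif|exact: dig].
apply: Ck_ext (IHk _ _ cdf cdg) => // u Uu /=.
rewrite deriveD; [|by apply: derivableZ; exact: dif|exact: dig].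
by rewrite deriveZ//; exact: dif.
Qed.

Lemma CkW k U f : Ck k.+1 U f -> Ck k U f.
Proof.
elim: k f => [|k IHk] f [cf df]; first by split.
by split=> // i; have [dif cdf] := df i; split=> //; apply: IHk.
Qed.

Lemma Ck_mul k U f g : open U -> Ck k U f -> Ck k U g -> Ck k U (f * g).
Proof.
move=> oU Cf Cg.
have cM h h' : Ck 0 U h -> Ck 0 U h' -> Ck 0 U (h * h').
  move=> [ch _] [ch' _]; split=> // u Uu.
  by apply: continuousM; [exact: ch|exact: ch'].
elim: k f g Cf Cg => [|k IHk] f g Cf Cg; first exact: cM.
split=> [|i]; first by case: (cM f g) => //; case: Cf; case: Cg.
have [dif cdf] := Cf.2 i; have [dig cdg] := Cg.2 i.
split=> [u Uu|]; first by apply: derivableM; [exact: dif|exact: dig].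
apply: (Ck_ext (f := 1 \*: (f * (fun u => 'D_(delta_mx 0 i) g u)) +
                     g * (fun u => 'D_(delta_mx 0 i) f u))) => //.
  move=> u Uu; rewrite deriveM; [|exact: dif|exact: dig].
  by rewrite -[in RHS](scale1r (f u *: _)).
by apply: Ck_lin => //; apply: IHk => //; exact: CkW.
Qed.

End smooth_euclidean.

Record chart (R : realType) (X : topologicalType) (n : nat) := Chart {
  dom : set X;
  coord : X -> 'rV[R]_n;
  param : 'rV[R]_n -> X }.

Definition codom_chart R X n (c : chart R X n) : set 'rV[R]_n :=
  coord c @` dom c.

Record smooth_manifold (R : realType) (X : topologicalType) (n : nat) :=
  SmoothManifold {
  atlas : set (chart R X n);
  manifold_hausdorff : hausdorff_space X;
  manifold_second_countable : @second_countable X;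
  open_dom : forall c, atlas c -> open (dom c);
  open_codom : forall c, atlas c -> open (codom_chart c);
  coordK : forall c, atlas c -> forall x, dom c x -> param c (coord c x) = x;
  coord_continuous : forall c, atlas c ->
    forall x, dom c x -> {for x, continuous (coord c)};
  param_continuous : forall c, atlas c ->
    forall u, codom_chart c u -> {for u, continuous (param c)};
  atlas_cover : forall x, exists2 c, atlas c & dom c x;
  atlas_compatible : forall c c', atlas c -> atlas c' -> forall i : 'I_n,
    smooth_on (coord c @` (dom c `&` dom c'))
              (fun u => coord c' (param c u) 0 i) }.

Section smooth_functions.
Context {R : realType} {X : topologicalType} {n : nat}.
Variable M : smooth_manifold R X n.

Definition smooth : {pred X -> R} :=
  [pred f | `[< forall c, atlas M c -> smooth_on (codom_chart c) (f \o param c) >]].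

Lemma smoothP f : reflect
  (forall c, atlas M c -> smooth_on (codom_chart c) (f \o param c))
  (f \in smooth).
Proof. by rewrite inE; exact: asboolP. Qed.

Record smoothfun := SmoothFun { smoothfun_fun :> X -> R; _ : smoothfun_fun \in smooth }.

Lemma smooth_subring_closed : subring_closed smooth.
Proof.
split.
- by apply/smoothP => c _ k; exact: Ck_cst.
- move=> f g /smoothP sf /smoothP sg; apply/smoothP => c Mc k.
  have := Ck_lin (-1) (open_codom Mc) (sg c Mc k) (sf c Mc k).
  have E (a b : R) : -1 * a + b = b - a by rewrite mulN1r addrC.
  by congr Ck; apply/funext => u; exact: E.
- move=> f g /smoothP sf /smoothP sg; apply/smoothP => c Mc k.
  exact: Ck_mul (open_codom Mc) (sf c Mc k) (sg c Mc k).
Qed.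

Lemma smooth_scaler_closed : scaler_closed smooth.
Proof.
move=> a f /smoothP sf; apply/smoothP => c Mc k.
have := Ck_lin a (open_codom Mc) (sf c Mc k) (Ck_cst k (codom_chart c) 0).
by congr Ck; apply/funext => u; exact: addr0.
Qed.

HB.instance Definition _ :=
  GRing.isSubringClosed.Build (X -> R) smooth smooth_subring_closed.
HB.instance Definition _ :=
  GRing.isScaleClosed.Build R (X -> R) smooth smooth_scaler_closed.
HB.instance Definition _ := [isSub of smoothfun for smoothfun_fun].
HB.instance Definition _ := [Choice of smoothfun by <:].
HB.instance Definition _ :=
  GRing.SubChoice_isSubComPzRing.Build _ _ smoothfun (subringClosedP _).
HB.instance Definition _ := [SubZmodule_isSubLmodule of smoothfun by <:].

End smooth_functions.

(* Smooth vector fields are the derivations of C^oo(X). *)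
Section vector_fields.
Context {R : realType} {X : topologicalType} {n : nat}.
Variable M : smooth_manifold R X n.
Notation C := (smoothfun M).

Definition derivation : {pred C -> C} := [pred D : C -> C |
  `[< (forall (a : R) (f h : C), D (a *: f + h) = a *: D f + D h) /\
      (forall f h : C, D (f * h) = f * D h + h * D f) >]].

Lemma derivationP (D : C -> C) : reflect
  ((forall (a : R) (f h : C), D (a *: f + h) = a *: D f + D h) /\
   (forall f h : C, D (f * h) = f * D h + h * D f))
  (D \in derivation).
Proof. by rewrite inE; exact: asboolP. Qed.

Record vfield := VField { vfield_fun :> C -> C; _ : vfield_fun \in derivation }.

HB.instance Definition _ := [isSub of vfield for vfield_fun].
HB.instance Definition _ := [Choice of vfield by <:].

Lemma vfield_linear (V : vfield) (a : R) f h : V (a *: f + h) = a *: V f + V h.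
Proof. by have /derivationP[] := valP V. Qed.

Lemma vfieldM (V : vfield) f h : V (f * h) = f * V h + h * V f.
Proof. by have /derivationP[] := valP V. Qed.

Lemma derivation_zmod_closed : zmod_closed derivation.
Proof.
split=> [|U V /derivationP[lU mU] /derivationP[lV mV]].
  apply/derivationP; split=> [a f h|f h]; rewrite -[LHS]/(0 : C).
    by rewrite -[X in _ = a *: X + _]/(0 : C) -[X in _ = _ + X]/(0 : C) scaler0 addr0.
  by rewrite -[X in _ = f * X + _]/(0 : C) -[X in _ = _ + h * X]/(0 : C) !mulr0 addr0.
apply/derivationP; split=> [a f h|f h].
  rewrite -[LHS]/(U _ - V _) -[(U - V) f]/(U f - V f) -[(U - V) h]/(U h - V h).
  by rewrite lU lV scalerBr opprD addrACA.
rewrite -[LHS]/(U _ - V _) -[(U - V) f]/(U f - V f) -[(U - V) h]/(U h - V h).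
by rewrite mU mV !mulrBr opprD addrACA.
Qed.

HB.instance Definition _ :=
  GRing.isZmodClosed.Build (C -> C) derivation derivation_zmod_closed.
HB.instance Definition _ := [SubChoice_isSubZmodule of vfield by <:].

Lemma scale_derivation (f : C) (V : vfield) : (fun h => f * V h) \in derivation.
Proof.
apply/derivationP; split=> [a h k|h k].
  rewrite vfield_linear mulrDr; congr (_ + _).
  by apply/val_inj/funext => x; exact: mulrCA.
by rewrite vfieldM mulrDr !(mulrCA f).
Qed.

Definition vfield_scale (f : C) (V : vfield) : vfield :=
  VField (scale_derivation f V).

Lemma vfieldP (U V : vfield) : (forall h, U h = V h) -> U = V.
Proof. by move=> UV; apply/val_inj/funext. Qed.

Fact vfield_scalerA f h V :
  vfield_scale f (vfield_scale h V) = vfield_scale (f * h) V.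
Proof. by apply: vfieldP => k; exact: mulrA. Qed.
Fact vfield_scale1r : left_id 1 vfield_scale.
Proof. by move=> V; apply: vfieldP => k; exact: mul1r. Qed.
Fact vfield_scalerDr : right_distributive vfield_scale +%R.
Proof. by move=> f U V; apply: vfieldP => k; exact: mulrDr. Qed.
Fact vfield_scalerDl V : {morph vfield_scale^~ V : f h / f + h}.
Proof. by move=> f h; apply: vfieldP => k; exact: mulrDl. Qed.

HB.instance Definition _ := GRing.Zmodule_isLmodule.Build C vfield
  vfield_scalerA vfield_scale1r vfield_scalerDr vfield_scalerDl.

Lemma lie_derivation (U V : vfield) :
  (fun h => U (V h) - V (U h)) \in derivation.
Proof.
have addV (W : vfield) f h : W (f + h) = W f + W h.
  by have := vfield_linear W 1 f h; rewrite !scale1r.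
apply/derivationP; split=> [a f h|f h].
  by rewrite !vfield_linear scalerBr opprD addrACA.
rewrite !vfieldM !addV !vfieldM.
rewrite !mulrBr !opprD !addrA (mulrC (U h)) (mulrC (U f)).
by rewrite [LHS](ACl (1*5*3*7*2*8*4*6)) /= !addrK.
Qed.

Definition lie (U V : vfield) : vfield := VField (lie_derivation U V).

End vector_fields.

Section forms.
Context {R : realType} {X : topologicalType} {n : nat}.
Variable M : smooth_manifold R X n.
Local Notation C := (smoothfun M).
Local Notation VF := (vfield M).

(* Smooth p-forms are the alternating C^oo(X)-multilinear maps on vector
   fields; such a map is tensorial: its value at x depends only on the values
   at x of its arguments, and every tangent p-tuple at x is the value at x of a
   p-tuple of vector fields. *)
Definition cochain (p : nat) := ('I_p -> VF) -> C.

Definition is_form p (w : cochain p) : Prop :=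
  (forall (V : 'I_p -> VF) (i : 'I_p) (f : C) (U W : VF),
     w [eta V with i |-> f *: U + W] =
     f * w [eta V with i |-> U] + w [eta V with i |-> W]) /\
  (forall (V : 'I_p -> VF) (i j : 'I_p), i != j -> V i = V j -> w V = 0).

(* Koszul's formula
     dw(V_0, ..., V_p) = \sum_i (-1)^i V_i (w(V_0, ^V_i, V_p))
       + \sum_(i < j) (-1)^(i + j) w([V_i, V_j], V_0, ^V_i, ^V_j, V_p),
   where in the second sum the bracket is moved to position i, which absorbs
   the sign (-1)^i. *)
Definition extd p (w : cochain p) : cochain p.+1 := fun V =>
  \sum_(i < p.+1) (-1) ^+ i * V i (w (V \o lift i)) +
  \sum_(j < p.+1) \sum_(i < p | (i < j)%N)
     (-1) ^+ j * w [eta (V \o lift j) with i |-> lie (V (lift j i)) (V j)].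

Definition contract p (U : VF) (w : cochain p.+1) : cochain p := fun V =>
  w (fun i => if unlift ord0 i is Some j then V j else U).

Definition fun_support (f : C) : set X := closure [set x | f x != 0].

Definition form_support p (w : cochain p) : set X :=
  closure [set x | exists V, w V x != 0].

Definition test_form p (w : cochain p) : Prop :=
  is_form w /\ compact (form_support w).

Definition iter_vfields (s : seq VF) (f : C) : C :=
  foldr (fun (V : VF) h => V h) f s.

(* A p-dimensional current is a linear functional on the compactly supported
   smooth p-forms whose restriction to the forms supported in any given compact
   set A is continuous for the C^oo topology; the latter is defined by the
   seminorms sup_A |V_1 ... V_k (w(W_1, ..., W_p))|.  The values of [T] outside
   the compactly supported forms are irrelevant. *)
Definition is_current p (T : cochain p -> R) : Prop :=
  (forall (a : R) v w, test_form v -> test_form w ->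
     T (a *: v + w) = a * T v + T w) /\
  (forall A : set X, compact A ->
     exists (N : nat) (D : 'I_N -> seq VF) (W : 'I_N -> 'I_p -> VF) (m : R),
     forall w, is_form w -> form_support w `<=` A ->
     forall b : R, 0 <= b ->
       (forall k x, A x -> `|iter_vfields (D k) (w (W k)) x| <= b) ->
       `|T w| <= m * b).

Definition current_support p (T : cochain p -> R) : set X :=
  [set x | forall U, open U -> U x ->
     exists w, [/\ test_form w, form_support w `<=` U & T w != 0]].

End forms.

Section riemannian.
Context {R : realType} {X : topologicalType} {n : nat}.
Variable M : smooth_manifold R X n.
Local Notation C := (smoothfun M).
Local Notation VF := (vfield M).

Record riemannian_metric := RiemannianMetric {
  metric :> VF -> VF -> C;
  metric_sym : forall U V, metric U V = metric V U;
  metric_linear : forall (f : C) (U V W : VF),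
    metric (f *: U + V) W = f * metric U W + metric V W;
  metric_ge0 : forall U x, 0 <= metric U U x;
  metric_eq0 : forall (U : VF) x, metric U U x = 0 -> forall f : C, U f x = 0 }.

Variable g : riemannian_metric.

Definition grad (f : C) : VF := xget 0 [set G : VF | forall V, g G V = V f].

Definition levi_civita (nabla : VF -> VF -> VF) : Prop :=
  [/\ forall (f : C) (U V W : VF), nabla (f *: U + V) W = f *: nabla U W + nabla V W,
      forall U V W : VF, nabla U (V + W) = nabla U V + nabla U W,
      forall (f : C) (U V : VF), nabla U (f *: V) = U f *: V + f *: nabla U V,
      forall U V : VF, nabla U V - nabla V U = lie U V &
      forall U V W : VF, U (g V W) = g (nabla U V) W + g V (nabla U W)].

Definition parallel p (w : cochain M p) : Prop :=
  exists2 nabla, levi_civita nabla &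
    forall (U : VF) (V : 'I_p -> VF),
      U (w V) = \sum_(i < p) w [eta V with i |-> nabla U (V i)].

(* V_1 /\ ... /\ V_p is a simple p-vector of norm 1 at x; its norm is the square
   root of the Gram determinant. *)
Definition unit_simple p (x : X) (V : 'I_p -> VF) : Prop :=
  \det (\matrix_(i < p, j < p) g (V i) (V j) x) = 1.

Definition calibration p (phi : cochain M p) : Prop :=
  [/\ is_form phi, extd phi = 0 &
      forall x V, unit_simple x V -> phi V x <= 1].

Definition phi_plane p (phi : cochain M p) (x : X) (V : 'I_p -> VF) : Prop :=
  unit_simple x V /\ phi V x = 1.

Definition dphi p (phi : cochain M p.+1) (f : C) : cochain M p :=
  contract (grad f) phi.

Definition ddphi p (phi : cochain M p.+1) (f : C) : cochain M p.+1 :=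
  extd (dphi phi f).

Definition psh p (phi : cochain M p.+1) (f : C) : Prop :=
  forall x V, phi_plane phi x V -> 0 <= ddphi phi f V x.

Definition strictly_psh p (phi : cochain M p.+1) (f : C) : Prop :=
  forall x V, phi_plane phi x V -> 0 < ddphi phi f V x.

Definition strictly_convex p (phi : cochain M p.+1) : Prop :=
  exists2 f : C, strictly_psh phi f & forall c : R, compact [set x | f x <= c].

Definition psh_hull p (phi : cochain M p.+1) (K : set X) : set X :=
  [set x | forall f : C, psh phi f ->
     ((f x)%:E <= ereal_sup [set (f y)%:E | y in K])%E].

(* The p-vector [tau] at [y], given as a functional on p-forms, lies in the
   convex hull of the phi-planes at [y]. *)
Definition plane_hull p (phi : cochain M p) (y : X) (tau : cochain M p -> R) :
    Prop :=
  exists (m : nat) (c : 'I_m -> R) (V : 'I_m -> 'I_p -> VF),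
    [/\ forall k, 0 <= c k, \sum_k c k = 1, forall k, phi_plane phi y (V k) &
        forall w, is_form w -> tau w = \sum_k c k * w (V k) y].

End riemannian.

Notation Borel X := (g_sigma_algebraType (@open X)).

Section green_currents.
Context {R : realType} {X : ptopologicalType} {n : nat}.
Variable M : smooth_manifold R X n.
Variable g : riemannian_metric M.
Local Notation C := (smoothfun M).

(* On a manifold (locally compact, second countable, Hausdorff) a Borel measure
   that is finite on compact sets is automatically regular. *)
Definition radon (mu : {measure set (Borel X) -> \bar R}) : Prop :=
  forall A : set X, compact A -> (mu A < +oo)%E.

Definition phi_positive p (phi : cochain M p) (T : cochain M p -> R) : Prop :=
  is_current T /\
  exists (mu : {measure set (Borel X) -> \bar R})
         (tau : Borel X -> cochain M p -> R),
    [/\ radon mu,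
        forall w, is_form w -> measurable_fun setT (tau^~ w),
        {ae mu, forall y, plane_hull g phi y (tau y)} &
        forall w, test_form w -> (T w)%:E = (\int[mu]_y (tau y w)%:E)%E].

Definition measure_support (mu : {measure set (Borel X) -> \bar R}) : set X :=
  [set x | forall U, open U -> U x -> (0 < mu U)%E].

Definition boundary_phi p (phi : cochain M p.+1) (T : cochain M p.+1 -> R)
    (f : C) : R :=
  T (ddphi g phi f).

Definition green_current p (phi : cochain M p.+1) (K : set X) (x : X)
    (T : cochain M p.+1 -> R) : Prop :=
  [/\ phi_positive phi T, compact (current_support T) &
      exists2 mu : probability (Borel X) R, measure_support mu `<=` K &
        forall f : C, compact (fun_support f) ->
          (boundary_phi phi T f)%:E =
            (\int[mu]_y (f y)%:E - \int[\d_(x : Borel X)]_y (f y)%:E)%E].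

End green_currents.

(* Main.v *)
Require Import Defs.
From HB Require Import structures.
From mathcomp Require Import all_boot all_order all_fingroup all_algebra.
From mathcomp Require Import all_classical all_reals all_analysis.
From mathcomp Require Import measurable_realfun.
From mathcomp Require Import ring lra.

(** Suppose first that [T] is a Green current for [(K, x)] with measure [mu], and
    let [f] be plurisubharmonic. Since [T] averages phi-planes, [T (dd^phi f) >= 0],
    and this number is [\int f dmu - f x]; as [mu] is a probability measure on [K],
    [f x] is at most the supremum of [f] on [K]. The function [f] does not have
    compact support, so it is multiplied by a plateau of the exhaustion function
    equal to 1 near the support of [T]; this is harmless because the mass of [T] is
    carried by its support ([positive_mass_support], [green_current_hull]).

    Conversely let [x] be in the hull of [K]. To a smooth [f] attach the function
    [dd^phi f] on the phi-planes over a large sublevel set of an exhaustion function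
    [h], together with [- f] on [K]. The functional [- f x] is nonnegative whenever
    these two functions are ([hull_functional]): otherwise cut [f] off and add a
    high power of a multiple of [h], small on [K] and very plurisubharmonic where
    the cutoff acts, to obtain a plurisubharmonic function larger at [x] than on
    [K]. By the Hahn-Banach argument of [positive_extension] the functional extends
    to a positive functional on all bounded functions on the disjoint union of the
    planes and [K]. Its two halves are the Green current and its measure, and the
    fact that it extends [- f x] is exactly the equation of a Green current
    ([green_current_exists]).

    A positive functional on bounded functions must still be realized by measures.
    The planes over a compact set are encoded by a compact subset of a Euclidean
    space, hence are a continuous image of the Cantor space. There the functional
    gives a finitely additive measure on clopen sets, which compactness makes
    countably additive ([clopen_representation]). Pushing it down to the manifold
    and conditioning on the base point yields a measure and a field of p-vectors;
    almost every value of this field lies in the convex hull of the planes, since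
    countably many rational half-spaces detect the hull ([conditional_hull],
    [hull_of_support], [plane_representation]).

    The geometry enters through the operator [dd^phi]. For parallel [phi] it is the
    Hessian of [f] acting as a derivation on tangent p-vectors ([ddphiE]), hence it
    is a local operator with values in forms. The first cousin principle,
    [phi (V with W in slot i) = <W, V_i>] at a phi-plane, makes the additional term
    of [dd^phi (f ^ k)] a sum of squares ([first_cousin], [ddphi_expn]). Vector
    fields being derivations, the local frames needed for all of this rest on
    Hadamard's lemma ([hadamard], [local_frame_inj]). *)

Set Implicit Arguments.
Unset Strict Implicit.
Unset Printing Implicit Defensive.

Import Order.TTheory GRing.Theory Num.Theory.
Import numFieldNormedType.Exports.

Local Open Scope classical_set_scope.
Local Open Scope ring_scope.

Local Notation coord := Defs.coord.
Local Notation dom := Defs.dom.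

(** * Calculus in Euclidean space *)

Section euclidean_calculus.
Context {R : realType}.

Lemma scaleRE (a b : R) : a *: b = a * b. Proof. by []. Qed.

Lemma smooth_derive n (U : set 'rV[R]_n) f i : smooth_on U f ->
  smooth_on U (fun u => 'D_(delta_mx 0 i) f u).
Proof. by move=> sf k; have [_ /(_ i)[]] := sf k.+1. Qed.

Lemma smooth_derivable n (U : set 'rV[R]_n) f i u : smooth_on U f -> U u ->
  derivable f u (delta_mx 0 i).
Proof. by move=> sf Uu; have [_ /(_ i)[+ _]] := sf 1%N; exact. Qed.

Lemma smooth_cont n (U : set 'rV[R]_n) f u : smooth_on U f -> U u ->
  {for u, continuous f}.
Proof. by move=> sf Uu; have [+ _] := sf 0%N; exact. Qed.

Lemma derivable_line n (f : 'rV[R]_n -> R) (u e : 'rV[R]_n) (s : R) :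
  derivable f (u + s *: e) e ->
  derivable (fun t : R => f (u + t *: e)) s 1 /\
  'D_1 (fun t : R => f (u + t *: e)) s = 'D_e f (u + s *: e).
Proof.
have E : (fun h : R => h^-1 *: (f (u + (h *: 1 + s) *: e) - f (u + s *: e))) =
    (fun h : R => h^-1 *: (f (h *: e + (u + s *: e)) - f (u + s *: e))).
  apply/funext => h; congr (_ *: (f _ - _)).
  by rewrite [h *: 1]mulr1 scalerDl addrCA.
move=> df; split.
  by rewrite /derivable /=; move: df; rewrite /derivable /= -E.
by rewrite /derive /= /shift /= E.
Qed.

Lemma mvt_line n (f : 'rV[R]_n -> R) (u e : 'rV[R]_n) (h : R) :
  (forall s : R, `|s| <= `|h| -> derivable f (u + s *: e) e) ->
  exists2 s : R, `|s| <= `|h| & f (u + h *: e) - f u = h * 'D_e f (u + s *: e).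
Proof.
move=> df.
set q := fun t : R => f (u + t *: e).
have dq (s : R) : `|s| <= `|h| -> is_derive s 1 q ('D_e f (u + s *: e)).
  by move=> /df /derivable_line [d <-]; exact: derivableP.
have cq (s : R) : `|s| <= `|h| -> {for s, continuous q}.
  move=> /dq [d _]; apply: differentiable_continuous.
  exact/derivable1_diffP.
have q0 : q 0 = f u by rewrite /q scale0r addr0.
have [h0|h0|h0] := ltgtP h 0.
- have [||s s0] := @MVT R q (fun s => 'D_e f (u + s *: e)) h 0 h0.
  + move=> s; rewrite in_itv /= => /andP[hs s0]; apply: dq.
    by rewrite (ler0_norm (ltW s0)) (ler0_norm (ltW h0)) lerN2 ltW.
  + apply: continuous_in_subspaceT => s; rewrite inE /= in_itv /= => /andP[hs s0].
    by apply: cq; rewrite (ler0_norm s0) (ler0_norm (ltW h0)) lerN2.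
  move=> E; exists s; first by move: s0; rewrite in_itv /= => /andP[hs s0];
    rewrite (ler0_norm (ltW s0)) (ler0_norm (ltW h0)) lerN2 ltW.
  move: E; rewrite q0 sub0r mulrN => E.
  by rewrite -/(q h) -opprB E opprK mulrC.
- have [||s s0] := @MVT R q (fun s => 'D_e f (u + s *: e)) 0 h h0.
  + move=> s; rewrite in_itv /= => /andP[s0 hs]; apply: dq.
    by rewrite (ger0_norm (ltW s0)) (ger0_norm (ltW h0)) ltW.
  + apply: continuous_in_subspaceT => s; rewrite inE /= in_itv /= => /andP[s0 hs].
    by apply: cq; rewrite (ger0_norm s0) (ger0_norm (ltW h0)).
  rewrite q0 subr0 => E; exists s; last by rewrite -/(q h) E mulrC.
  by move: s0; rewrite in_itv /= => /andP[s0 hs];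
    rewrite (ger0_norm (ltW s0)) (ger0_norm (ltW h0)) ltW.
- by exists 0; rewrite ?normr0// h0 scale0r addr0 subrr mul0r.
Qed.

Lemma coord_le_norm n (v : 'rV[R]_n) i : `|v 0 i| <= `|v|.
Proof.
rewrite -[`|v|]/(mx_norm v) mx_normrE.
exact: (le_bigmax _ (fun ij : 'I_1 * 'I_n => `|v ij.1 ij.2|) (0, i)).
Qed.

Lemma rV_norm_le n (v : 'rV[R]_n) (e : R) : 0 <= e ->
  (forall i, `|v 0 i| <= e) -> `|v| <= e.
Proof.
move=> e0 ve; rewrite -[`|v|]/(mx_norm v).
have [->//|/mx_norm_neq0 [[i j] /= ->]] := eqVneq (mx_norm v) 0.
by rewrite ord1.
Qed.

Lemma cvg_sumr (T J : Type) (F : set_system T) {FF : Filter F} (r : seq J)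
    (f : J -> T -> R) (l : J -> R) :
  (forall j, f j x @[x --> F] --> l j) ->
  \sum_(j <- r) f j x @[x --> F] --> \sum_(j <- r) l j.
Proof.
move=> fl; elim: r => [|j r IHr].
  by rewrite big_nil; under eq_fun do rewrite big_nil; exact: cvg_cst.
by rewrite big_cons; under eq_fun do rewrite big_cons; exact: cvgD.
Qed.

Definition lin_form n (c : 'I_n -> R) (h : 'rV[R]_n) : R := \sum_i h 0 i * c i.

Lemma lin_form_linear n (c : 'I_n -> R) : linear (lin_form c).
Proof.
move=> a u v; rewrite /lin_form scaler_sumr -big_split /=.
by apply: eq_bigr => i _; rewrite !mxE mulrDl -mulrA.
Qed.
HB.instance Definition _ n (c : 'I_n -> R) :=
  GRing.isLinear.Build R 'rV[R]_n R _ (lin_form c) (lin_form_linear c).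

Lemma lin_form_continuous n (c : 'I_n -> R) : continuous (lin_form c).
Proof.
move=> u; rewrite /lin_form; apply: (cvg_sumr (FF := nbhs_filter u)) => i.
have h1 : {for u, continuous (fun h : 'rV[R]_n => h 0 i)}.
  exact: coord_continuous.
have h2 : {for u, continuous (fun _ : 'rV[R]_n => c i)} by exact: cst_continuous.
exact: (continuousM h1 h2).
Qed.

(** The corners of the path from [0] to [h] that moves one coordinate at a time. *)
Definition trunc_rV n (k : nat) (h : 'rV[R]_n) : 'rV[R]_n :=
  \row_i (if (i < k)%N then h 0 i else 0).

Lemma truncS n (i : 'I_n) (h : 'rV[R]_n) :
  trunc_rV i.+1 h = trunc_rV i h + h 0 i *: delta_mx 0 i.
Proof.
apply/rowP => j; rewrite !mxE ltnS leq_eqVlt eqxx /=.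
case: (eqVneq j i) => [->|ji]; first by rewrite eqxx ltnn /= mulr1 add0r.
have /negbTE -> : (j != i :> nat) by [].
by rewrite mulr0 addr0.
Qed.

(** Frechet differentiability with the error term spelled out, which also
    identifies the differential. *)
Lemma diff_eps (V W : normedModType R) (f : V -> W) (df : {linear V -> W}) u :
  continuous df ->
  (forall eps : R, 0 < eps ->
     \forall h \near (0 : V), `|f (h + u) - f u - df h| <= eps * `|h|) ->
  differentiable f u /\ 'd f u = df :> (V -> W).
Proof.
move=> cdf Hf.
have H : f \o shift u = cst (f u) + df +o_ 0 id.
  apply/eqaddoP => eps eps0 /=; apply: filterS (Hf _ eps0) => h.
  by rewrite !fctE /= opprD addrA.
have E := diff_unique cdf H.
by split=> //; apply/diff_locallyP; rewrite E.
Qed.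

(** Going from [u] to [u + h] one coordinate at a time, the mean value theorem
    compares the increment of [f] with its partial derivatives near [u]. *)
Lemma C1_differentiable n (f : 'rV[R]_n -> R) (u : 'rV[R]_n) :
  (\forall v \near u, forall i, derivable f v (delta_mx 0 i)) ->
  (forall i, {for u, continuous (fun v => 'D_(delta_mx 0 i) f v)}) ->
  differentiable f u /\
  forall h, 'd f u h = \sum_i h 0 i * 'D_(delta_mx 0 i) f u.
Proof.
move=> df cf.
set c := fun i => 'D_(delta_mx 0 i) f u.
suff H (eps : R) : 0 < eps ->
    \forall h \near (0 : 'rV[R]_n), `|f (h + u) - f u - lin_form c h| <= eps * `|h|.
  have [dfu E] := diff_eps (@lin_form_continuous _ c) H.
  by split=> // h; rewrite E.
move=> eps0.
have n0 : 0 < n.+1%:R :> R by rewrite ltr0n.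
have e0 : 0 < eps / n.+1%:R by rewrite divr_gt0.
have : \forall v \near u, (forall i, derivable f v (delta_mx 0 i)) /\
    forall i, `|c i - 'D_(delta_mx 0 i) f v| <= eps / n.+1%:R.
  apply: filterI => //.
  apply: (filter_forall (nbhs_filter u)) => i.
  by move/cvgrPdist_le : (cf i) => /(_ _ e0).
move=> /nbhs_ballP [d /= d0 Hd].
near=> h.
have hd : `|h| < d.
  near: h; apply/nbhs_ballP; exists d => // z; rewrite -ball_normE /=.
  by rewrite sub0r normrN.
have tele : f (h + u) - f u =
    \sum_(i < n) (f (u + trunc_rV i.+1 h) - f (u + trunc_rV i h)).
  rewrite -(big_mkord xpredT (fun i => f (u + trunc_rV i.+1 h) - f (u + trunc_rV i h))).
  have t0 : trunc_rV 0 h = 0 by apply/rowP => i; rewrite !mxE.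
  have tn : trunc_rV n h = h by apply/rowP => i; rewrite !mxE ltn_ord.
  by rewrite telescope_sumr// t0 tn addr0 (addrC h).
rewrite tele /lin_form -sumrB.
rewrite (le_trans (ler_norm_sum _ _ _))//.
have -> : eps * `|h| = \sum_(i < n.+1) (eps / n.+1%:R * `|h|).
  rewrite sumr_const card_ord -[RHS]mulr_natr mulrAC divfK ?gt_eqF//.
rewrite big_ord_recr /=; apply: ler_wpDr; first by rewrite mulr_ge0 // ltW.
apply: ler_sum => i _.
have inb (s : R) : `|s| <= `|h 0 i| ->
    ball u d (u + trunc_rV i h + s *: delta_mx 0 i).
  move=> sh; rewrite -ball_normE /= -addrA opprD addrA subrr sub0r normrN.
  apply: le_lt_trans hd; apply: rV_norm_le => // j.
  rewrite !mxE eqxx /=; case: (eqVneq j i) => [->|ji].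
    by rewrite ltnn add0r mulr1 (le_trans sh)// coord_le_norm.
  rewrite mulr0 addr0; case: ifP => _; last by rewrite normr0.
  exact: coord_le_norm.
rewrite truncS addrA.
have [|s sh ->] := @mvt_line n f (u + trunc_rV i h) (delta_mx 0 i) (h 0 i).
  by move=> s /inb /Hd [].
rewrite -mulrBr normrM mulrC ler_pM//; last exact: coord_le_norm.
by rewrite distrC; have [_] := Hd _ (inb _ sh); exact.
Unshelve. all: by end_near. Qed.

Lemma smooth_differentiable n (U : set 'rV[R]_n) f u : open U -> Ck 1 U f ->
  U u -> differentiable f u /\
  forall h, 'd f u h = \sum_i h 0 i * 'D_(delta_mx 0 i) f u.
Proof.
move=> oU [_ sf] Uu; apply: C1_differentiable.
  by apply: filterS (open_nbhs_nbhs (conj oU Uu)) => v Uv i; have [+ _] := sf i; exact.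
by move=> i; have [_ [+ _]] := sf i; exact.
Qed.

Lemma Ck_sum n k (U : set 'rV[R]_n) (I : finType) (f : I -> 'rV[R]_n -> R) :
  open U -> (forall i, Ck k U (f i)) -> Ck k U (fun u => \sum_i f i u).
Proof.
move=> oU cf; elim: (index_enum I) => [|i s IHs].
  by apply: Ck_ext (Ck_cst k U 0) => // u _; rewrite big_nil.
apply: Ck_ext (Ck_lin 1 oU (cf i) IHs) => // u _.
by rewrite big_cons -[LHS]/(1 * f i u + _) mul1r.
Qed.

(** The chain rule expresses the partial derivatives of [b \o F] by those of [F]
    and of [b] composed with [F], so that the order of smoothness goes up by
    induction. *)
Lemma Ck_comp n m k (U : set 'rV[R]_n) (W : set 'rV[R]_m)
    (F : 'rV[R]_n -> 'rV[R]_m) (b : 'rV[R]_m -> R) :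
  open U -> open W -> (forall u, U u -> W (F u)) ->
  (forall i, smooth_on U (fun u => F u 0 i)) -> smooth_on W b ->
  Ck k U (b \o F).
Proof.
move=> oU oW FW sF; have cF u : U u -> differentiable F u.
  move=> Uu; rewrite (_ : F = \sum_i (fun z => F z 0 i *: delta_mx 0 i)); last first.
    apply/funext => z; rewrite fct_sumE [LHS]row_sum_delta.
    by apply: eq_bigr => i _; rewrite /=.
  apply: differentiable_sum => i; apply: differentiableZl.
  by have [] := smooth_differentiable oU (sF i 1%N) Uu.
elim: k b => [|k IHk] b sb.
  split=> // u Uu; apply: continuous_comp.
    exact: differentiable_continuous (cF _ Uu).
  by apply: smooth_cont sb _; exact: FW.
have db u : U u -> differentiable b (F u).
  by move=> /FW Wu; have [] := smooth_differentiable oW (sb 1%N) Wu.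
split=> [u Uu|i].
  apply: continuous_comp; first exact: differentiable_continuous (cF _ Uu).
  by apply: smooth_cont sb _; exact: FW.
split=> [u Uu|].
  by apply: diff_derivable; apply: differentiable_comp; [exact: cF|exact: db].
apply: Ck_ext (_ : Ck k U (fun u => \sum_j
  ((fun u => 'D_(delta_mx 0 i) (fun z => F z 0 j) u) *
   ((fun v => 'D_(delta_mx 0 j) b v) \o F)) u)) => //.
  move=> u Uu; rewrite deriveE; last first.
    by apply: differentiable_comp; [exact: cF|exact: db].
  rewrite diff_comp; [|exact: cF|exact: db].
  have [_ /= ->] := smooth_differentiable oW (sb 1%N) (FW _ Uu).
  apply: eq_bigr => j _; rewrite !fctE /=; congr (_ * _).
  rewrite -deriveE; last exact: cF.
  rewrite (derive_mx (M := F)); last exact/diff_derivable/cF.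
  by rewrite mxE.
apply: Ck_sum => // j; apply: Ck_mul => //; last first.
  by apply: IHk => l; exact: smooth_derive.
by have [_ /(_ i)[_]] := sF j k.+1.
Qed.

Lemma Ck_sub n k (U V : set 'rV[R]_n) f : V `<=` U -> Ck k U f -> Ck k V f.
Proof.
move=> VU; elim: k f => [|k IHk] f [cf df]; first by split=> // u /VU; exact: cf.
split=> [u /VU|i]; first exact: cf.
have [dif cdf] := df i; split=> [u /VU|]; first exact: dif.
exact: IHk.
Qed.

(** Being of class C^k is a local condition, since partial derivatives are. *)
Lemma Ck_local n k (U : set 'rV[R]_n) f :
  (forall u, U u -> exists2 V, V u & Ck k V f) -> Ck k U f.
Proof.
elim: k f => [|k IHk] f Hf.
  by split=> // u /Hf [V Vu [cf _]]; exact: cf.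
split=> [u /Hf [V Vu [cf _]]|i]; first exact: cf.
split=> [u /Hf [V Vu [_ /(_ i)[df _]]]|]; first exact: df.
by apply: IHk => u /Hf [V Vu [_ /(_ i)[_ df]]]; exists V.
Qed.

(** The derivative of [1 / f] is [- f' / f ^ 2], again built from inverses. *)
Lemma Ck_inv n k (U : set 'rV[R]_n) (f : 'rV[R]_n -> R) : open U ->
  (forall u, U u -> f u != 0) -> Ck k U f -> Ck k U (fun u => (f u)^-1).
Proof.
move=> oU f0; elim: k => [|k IHk] sf.
  split=> // u Uu; have [cf _] := sf.
  exact: (continuousV (f0 _ Uu) (cf _ Uu)).
have cV : Ck k U (fun u => (f u)^-1) by apply: IHk; exact: CkW.
split=> [u Uu|i].
  exact: (continuousV (f0 _ Uu) (Ck_cont sf Uu)).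
have [dif cdf] := sf.2 i; split=> [u Uu|].
  by apply: derivableV; [exact: f0|exact: dif].
apply: (Ck_ext (f := fun u => (((fun u => (f u)^-1) * (fun u => (f u)^-1)) *
    ((- 1) \*: (fun u => 'D_(delta_mx 0 i) f u) + cst 0)) u)) => //.
  move=> u Uu; rewrite deriveV; [|exact: f0|exact: dif].
  have E (a b : R) : a^-1 * a^-1 * (-1 * b + 0) = - a ^- 2 * b.
    by rewrite addr0 mulN1r mulrN mulNr -invfM expr2.
  exact: E.
by apply: Ck_mul => //; [exact: Ck_mul|apply: Ck_lin => //; exact: Ck_cst].
Qed.

(** The functions [t ^- m * exp (- 1 / t)], extended by 0 to [t <= 0]: a family
    stable under differentiation up to linear combinations, whose member [m = 0]
    is the standard flat function. *)
Definition flat (m : nat) (t : R) : R :=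
  if 0 < t then t ^- m * expR (- t^-1) else 0.

Lemma flat_le0 m t : t <= 0 -> flat m t = 0.
Proof. by move=> t0; rewrite /flat ltNge t0. Qed.

Lemma flat0_gt0 t : 0 < t -> 0 < flat 0 t.
Proof. by move=> t0; rewrite /flat t0 expr0 invr1 mul1r expR_gt0. Qed.

Lemma flat_ge0 m t : 0 <= flat m t.
Proof.
rewrite /flat; case: ifP => // t0.
by rewrite mulr_ge0 ?expR_ge0// invr_ge0 exprn_ge0// ltW.
Qed.

(** The exponential series dominates each of its terms; the quadratic bound is what
    makes the derivative at 0 vanish. *)
Lemma flat_sqr m t : `|flat m t| <= m.+2`!%:R * t ^+ 2.
Proof.
rewrite ger0_norm ?flat_ge0// /flat; case: ifP => [t0|_]; last first.
  by rewrite mulr_ge0// sqr_ge0.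
have tV : 0 <= t^-1 by rewrite invr_ge0 ltW.
have H : t^-1 ^+ m.+2 / m.+2`!%:R <= expR t^-1.
  by apply: le_trans (expR_ge1Dxn m.+1 tV); rewrite lerDr.
have f0 : 0 < m.+2`!%:R :> R by rewrite ltr0n fact_gt0.
rewrite expRN ler_pdivrMr ?expR_gt0//.
have -> : t ^- m = m.+2`!%:R * t ^+ 2 * (t^-1 ^+ m.+2 / m.+2`!%:R).
  rewrite exprVn !exprS expr0; field.
  by rewrite (gt_eqF t0) (gt_eqF f0) expf_neq0 ?gt_eqF.
by rewrite ler_wpM2l// mulr_ge0 ?sqr_ge0.
Qed.

Lemma is_derive_flat m (t : R) :
  is_derive t 1 (flat m) (flat m.+2 t - m%:R * flat m.+1 t).
Proof.
have [t0|t0|->] := ltgtP t 0.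
- rewrite !flat_le0 ?(ltW t0)// mulr0 subr0.
  apply: (near_eq_is_derive (f := cst 0)).
  have : open_nbhs t [set s : R | s < 0] by split=> //; exact: open_lt.
  by move=> /open_nbhs_nbhs; apply: filterS => s /= s0; rewrite flat_le0 ?ltW.
- suff D : is_derive t 1 (fun s : R => s ^- m * expR (- s^-1))
      (flat m.+2 t - m%:R * flat m.+1 t).
    apply: near_eq_is_derive D; have : open_nbhs t [set s : R | 0 < s] by split=> //; exact: open_gt.
    by move=> /open_nbhs_nbhs; apply: filterS => s /= s0; rewrite /flat s0.
  have tn0 : t != 0 by rewrite gt_eqF.
  have tmn0 : t ^+ m != 0 by rewrite expf_neq0.
  have dV : is_derive t 1 (fun s : R => s^-1) (- t ^- 2).
    apply: DeriveDef; first exact: derivableV.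
    by rewrite deriveV// derive_id scaleRE mulr1.
  have dX : is_derive t 1 (fun s : R => s ^- m) (- m%:R * t ^- m.+1).
    have dXm1 : derivable (fun s : R => s ^+ m) t 1 by exact: exprn_derivable.
    have dXm3 : 'D_1 (fun s : R => s ^+ m) t = m%:R * t ^+ m.-1.
      by rewrite exp_derive; exact: mulr1.
    apply: DeriveDef; first exact: (derivableV (f := fun s : R => s ^+ m) tmn0 dXm1).
    rewrite (deriveV (f := fun s : R => s ^+ m) tmn0 dXm1) dXm3.
    rewrite scaleRE.
    case: (m) tmn0 => [|k] tkn0; first by rewrite !(mul0r, mulr0, oppr0).
    rewrite /= -mulr_natl !exprS; field.
    by rewrite tn0 expf_neq0.
  rewrite /flat t0.
  have dE : is_derive t 1 (fun s : R => expR (- s^-1)) (expR (- t^-1) * t ^- 2).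
    have dN := is_deriveN dV.
    have := @is_derive1_comp R expR (fun s => - s^-1) t _ _ (is_derive_expR _) dN.
    by rewrite opprK.
  have [D1 D2] := is_deriveM dX dE.
  apply: DeriveDef; first exact: D1.
  apply: (eq_trans D2); rewrite !scaleRE !exprS; field.
  by rewrite tn0 expf_neq0.
- rewrite !flat_le0// mulr0 subr0.
  have : (flat m (h + 0) - flat m 0) / h @[h --> 0^'] --> (0 : R).
    apply/cvgrPdist_le => e e0 /=.
    have c0 : 0 < m.+2`!%:R + 1 :> R by rewrite ltr_wpDl.
    apply/nbhs_ballP; exists (e / (m.+2`!%:R + 1)); first by rewrite /= divr_gt0.
    move=> h; rewrite -ball_normE /= sub0r normrN => he h0.
    rewrite addr0 (flat_le0 m (lexx 0)) subr0 sub0r normrN normrM normfV.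
    rewrite ler_pdivrMr ?normr_gt0// (le_trans (flat_sqr m h))//.
    rewrite -real_normK ?num_real// expr2 mulrA ler_wpM2r//.
    move: he; rewrite ltr_pdivlMr// => /ltW; apply: le_trans.
    by rewrite mulrC ler_wpM2l// lerDl.
  move=> H.
  have E : (fun h : R => h^-1 *: ((flat m \o shift (0 : R)) (h *: 1) - flat m 0)) =
       (fun h : R => (flat m (h + 0) - flat m 0) / h).
    by apply/funext => h; rewrite /= [h *: 1]mulr1 [_ *: _]mulrC.
  apply: DeriveDef; first by apply/cvg_ex; exists 0; rewrite E.
  by rewrite /derive E; exact: cvg_lim.
Qed.

(** Differentiation turns a member of the family composed with [q] into other
    members times derivatives of [q], so all orders are reached at once. *)
Lemma Ck_flat n k m (U : set 'rV[R]_n) (q : 'rV[R]_n -> R) : open U ->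
  smooth_on U q -> Ck k U (flat m \o q).
Proof.
move=> oU sq.
have dflat l (t : R) : differentiable (flat l) t.
  by apply/derivable1_diffP; case: (is_derive_flat l t).
have dq u : U u -> differentiable q u.
  by move=> Uu; have [] := smooth_differentiable oU (sq 1%N) Uu.
elim: k m => [|k IHk] m.
  split=> // u Uu; apply: continuous_comp; first exact: smooth_cont sq Uu.
  exact/differentiable_continuous/dflat.
split=> [u Uu|i].
  apply: continuous_comp; first exact: smooth_cont sq Uu.
  exact/differentiable_continuous/dflat.
split=> [u Uu|].
  by apply: diff_derivable; apply: differentiable_comp; [exact: dq|exact: dflat].
apply: (Ck_ext (f := fun u => (((- m%:R) \*: (flat m.+1 \o q) + (flat m.+2 \o q))
    * (fun u => 'D_(delta_mx 0 i) q u)) u)) => //.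
  move=> u Uu; rewrite [RHS]deriveE; last first.
    by apply: differentiable_comp; [exact: dq|exact: dflat].
  rewrite diff_comp; [|exact: dq|exact: dflat].
  rewrite /= -(deriveE _ (dq _ Uu)).
  have [d1 d2] := is_derive_flat m (q u).
  rewrite deriv1E// derive1E d2 !fctE /=.
  rewrite [RHS]mulrC scaleRE; congr (_ * _).
  by rewrite mulNr addrC.
apply: Ck_mul => //; first by apply: Ck_lin => //; exact: IHk.
by have [_ /(_ i)[_]] := sq k.+1.
Qed.

End euclidean_calculus.

(** * Hadamard's lemma *)

Lemma rV_continuousP (R : realType) n (f : 'rV[R]_n -> R) u :
  (forall e : R, 0 < e -> exists2 d : R, 0 < d &
     forall v, `|u - v| < d -> `|f u - f v| <= e) -> {for u, continuous f}.
Proof.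
move=> Hf; apply/(@cvgrPdist_le _ _ _ _ (nbhs_filter u)) => e e0.
have [d d0 Hd] := Hf _ e0; apply/nbhs_ballP; exists d => // v.
by rewrite -ball_normE; exact: Hd.
Qed.

Lemma Rintegral_sum d (T : measurableType d) (R : realType)
    (mu : {measure set T -> \bar R}) (D : set T) (I : Type) (s : seq I)
    (f : I -> T -> R) : measurable D ->
  (forall i, mu.-integrable D (EFin \o f i)) ->
  mu.-integrable D (EFin \o (fun t => \sum_(i <- s) f i t)) /\
  (\int[mu]_(t in D) (\sum_(i <- s) f i t) =
   \sum_(i <- s) \int[mu]_(t in D) f i t)%R.
Proof.
move=> mD intf; elim: s => [|i s [IH1 IH2]].
  have -> : (fun t => \sum_(i <- [::]) f i t) = (fun=> 0).
    by apply/funext => t; rewrite big_nil.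
  by rewrite big_nil /Rintegral integral0; split=> //; exact: integrable0.
have -> : (fun t => \sum_(i <- i :: s) f i t) = (fun t => f i t + \sum_(j <- s) f j t).
  by apply/funext => t; rewrite big_cons.
rewrite big_cons RintegralD// IH2; split=> //.
exact: (integrableD mD (intf i) IH1).
Qed.

Section hadamard.
Context {R : realType} {n : nat}.
Variables (u0 : 'rV[R]_n) (r : R).
Local Notation B := (ball u0 r).
Local Notation mu := (@lebesgue_measure R).

Lemma ball_open_rV : open B. Proof. exact: ball_open. Qed.

Lemma cball_compact (r' : R) : compact [set x | `|u0 - x| <= r'].
Proof.
apply: bounded_closed_compact.
  exists (`|u0| + r'); split; first exact: num_real.
  move=> M ltM x /= xr; apply/ltW/(le_lt_trans _ ltM).
  by rewrite -[x](subKr u0) (le_trans (ler_normB _ _))// lerD2l.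
have -> : [set x | `|u0 - x| <= r'] = (fun x => `|u0 - x|) @^-1` [set t | t <= r'].
  by [].
apply: closed_comp; last exact: closed_le.
move=> x _.
have h1 : {for x, continuous (fun _ : 'rV[R]_n => u0)} by exact: cst_continuous.
have h2 : {for x, continuous (fun y : 'rV[R]_n => y)} by exact: cvg_id.
have h3 : {for x, continuous (fun y : 'rV[R]_n => u0 - y)} := continuousB h1 h2.
exact: (continuous_comp h3 (@norm_continuous _ _ _)).
Qed.

Lemma bounded_on_cball (c : 'rV[R]_n -> R) r' : r' < r ->
  (forall x, B x -> {for x, continuous c}) ->
  exists2 b, 0 <= b & forall x, `|u0 - x| <= r' -> `|c x| <= b.
Proof.
move=> r'r cc.
have cB x : `|u0 - x| <= r' -> B x.
  by move=> xr; rewrite -ball_normE /=; exact: le_lt_trans r'r.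
have [r0|r0] := ltP r' 0.
  by exists 0 => // x xr; have := le_lt_trans xr r0; rewrite normr_lt0.
have [|||z zr zm] := @EVT_max_rV R n (fun x => `|c x|) [set x | `|u0 - x| <= r'].
- by exists u0; rewrite /= subrr normr0.
- exact: cball_compact.
- apply: continuous_in_subspaceT => x; rewrite inE /= => /cB /cc ccx.
  exact: (continuous_comp ccx (@norm_continuous _ _ _)).
- exists `|c z| => // x xr; apply: zm.
  by rewrite inE.
Qed.

Lemma lipschitz_on_cball (b : 'rV[R]_n -> R) r' : r' < r -> Ck 1 B b ->
  exists2 L, 0 <= L & forall x y, `|u0 - x| <= r' -> `|u0 - y| <= r' ->
    `|b x - b y| <= L * `|x - y|.
Proof.
move=> r'r sb.
have cB x : `|u0 - x| <= r' -> B x.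
  by move=> xr; rewrite -ball_normE /=; exact: le_lt_trans r'r.
have /choice [bd bdP] : forall i : 'I_n, exists b', 0 <= b' /\
    forall x, `|u0 - x| <= r' -> `|'D_(delta_mx 0 i) b x| <= b'.
  move=> i; have [_ /(_ i)[_ sdb]] := sb.
  have [|b' b'0 Hb'] := @bounded_on_cball (fun v => 'D_(delta_mx 0 i) b v) _ r'r.
    by have [cdb _] := sdb; move=> x Bx; exact: cdb.
  by exists b'.
exists (\sum_i bd i); first by apply: sumr_ge0 => i _; case: (bdP i).
move=> x y xr yr.
set c := 2^-1 *: (x + y); set e := 2^-1 *: (x - y).
have inr' (s : R) : `|s| <= `|1 : R| -> `|u0 - (c + s *: e)| <= r'.
  rewrite normr1 => s1.
  have -> : u0 - (c + s *: e) = ((1 + s) / 2) *: (u0 - x) + ((1 - s) / 2) *: (u0 - y).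
    by apply/rowP => i; rewrite !mxE; field.
  move: s1; rewrite ler_norml => /andP[s1 s2].
  rewrite (le_trans (ler_normD _ _))// !normrZ.
  rewrite (@ger0_norm _ (1 + s)) ?(@ger0_norm _ (1 - s)) ?(@ger0_norm _ 2^-1) ?invr_ge0//; [|lra|lra].
  have -> : r' = (1 + s) / 2 * r' + (1 - s) / 2 * r' by field.
  by apply: lerD; apply: ler_wpM2l => //; lra.
have dbnd (s : R) : `|s| <= `|1 : R| ->
    `|'D_e b (c + s *: e)| <= (\sum_i bd i) * `|e|.
  move=> /inr' sr; have [dbs dE] := smooth_differentiable ball_open_rV sb (cB _ sr).
  rewrite deriveE// dE mulr_suml (le_trans (ler_norm_sum _ _ _))//.
  apply: ler_sum => i _; rewrite normrM mulrC ler_pM//; last exact: coord_le_norm.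
  by have [_] := bdP i; exact.
have der e' : (e' = e \/ e' = - e) -> forall s : R, `|s| <= `|1 : R| -> derivable b (c + s *: e') e'.
  move=> He s s1; apply: diff_derivable.
  suff sr : `|u0 - (c + s *: e')| <= r'.
    by have [] := smooth_differentiable ball_open_rV sb (cB _ sr).
  case: He => ->; first exact: inr'.
  by rewrite scalerN -scaleNr; apply: inr'; rewrite normrN.
have [s s1 E1] := mvt_line (der e (or_introl erefl)).
have [s' s1' E2] := mvt_line (der (- e) (or_intror erefl)).
have xE : x = c + 1 *: e by apply/rowP => i; rewrite !mxE; field.
have yE : y = c + 1 *: (- e) by apply/rowP => i; rewrite !mxE; field.
have -> : b x - b y = (b (c + 1 *: e) - b c) - (b (c + 1 *: (- e)) - b c).
  by rewrite -xE -yE; ring.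
rewrite E1 E2.
rewrite !mul1r scalerN -scaleNr.
have sr' : `|u0 - (c + (- s') *: e)| <= r' by apply: inr'; rewrite normrN.
have [dbs _] := smooth_differentiable ball_open_rV sb (cB _ sr').
rewrite (deriveE (- e) dbs) linearN -(deriveE e dbs) opprK.
rewrite (le_trans (ler_normD _ _))//.
have -> : `|x - y| = `|e| + `|e|.
  by rewrite /e normrZ ger0_norm ?invr_ge0//; field.
by rewrite mulrDr lerD// dbnd// normrN.
Qed.

Definition ray (u : 'rV[R]_n) (t : R) : 'rV[R]_n := u0 + t *: (u - u0).

Lemma ray_norm u t : `|u0 - ray u t| = `|t| * `|u0 - u|.
Proof. by rewrite /ray opprD addrA subrr sub0r normrN normrZ (distrC u). Qed.

Lemma ray_le u t : 0 <= t <= 1 -> `|u0 - ray u t| <= `|u0 - u|.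
Proof.
move=> /andP[t0 t1]; rewrite ray_norm ger0_norm//.
by rewrite ler_piMl.
Qed.

Lemma ray_ball u t : B u -> 0 <= t <= 1 -> B (ray u t).
Proof.
by rewrite -ball_normE /= => Bu /(ray_le u) /le_lt_trans; exact.
Qed.

Lemma ray_continuous u : continuous (ray u).
Proof.
move=> t; rewrite /ray.
have h1 : {for t, continuous (fun _ : R => u0)} by exact: cst_continuous.
have h2 : {for t, continuous (fun t : R => t *: (u - u0))}.
  exact: scalel_continuous.
exact: (continuousD h1 h2).
Qed.

(** The weight [t ^ k] appears because differentiating in [u] under the integral
    brings out one factor [t]: the family [ray_mean k] is stable under partial
    derivatives. *)
Definition ray_integrand k (b : 'rV[R]_n -> R) u (t : R) : R :=
  t ^+ k * b (ray u t).

Definition ray_mean k (b : 'rV[R]_n -> R) (u : 'rV[R]_n) : R :=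
  (\int[mu]_(t in `[0%R, 1%R]) ray_integrand k b u t)%R.

Lemma ray_integrand_at k b u (t : R) : (forall x, B x -> {for x, continuous b}) ->
  B u -> 0 <= t <= 1 -> {for t, continuous (ray_integrand k b u)}.
Proof.
move=> cb Bu t01.
have h1 : {for t, continuous (fun t : R => t ^+ k)} by exact: exprn_continuous.
have h2 : {for t, continuous (fun t : R => b (ray u t))}.
  apply: continuous_comp; first exact: ray_continuous.
  by apply: cb; exact: ray_ball.
exact: (continuousM h1 h2).
Qed.

Lemma continuous_on01 (f : R -> R) :
  (forall t : R, 0 <= t <= 1 -> {for t, continuous f}) ->
  {within `[0, 1], continuous f}.
Proof.
by move=> cf; apply: continuous_in_subspaceT => t; rewrite inE /= in_itv /=; exact: cf.
Qed.

Lemma ray_integrable k b u : (forall x, B x -> {for x, continuous b}) ->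
  B u -> mu.-integrable `[0, 1] (EFin \o ray_integrand k b u).
Proof.
move=> cb Bu; apply: continuous_compact_integrable; first exact: segment_compact.
by apply: continuous_on01 => t; exact: ray_integrand_at.
Qed.

Lemma lebesgue_measure01 : (@lebesgue_measure R) `[0, 1]%classic = 1%E.
Proof. by rewrite lebesgue_measure_itv /= lte_fin ltr01 sube0. Qed.

Lemma ray_mean_continuous k b u : Ck 1 B b -> B u ->
  {for u, continuous (ray_mean k b)}.
Proof.
move=> sb Bu.
have cb := Ck_cont sb.
have Bu' : `|u0 - u| < r by move: Bu; rewrite -ball_normE.
pose r' := (`|u0 - u| + r) / 2.
have r'r : r' < r by rewrite /r'; lra.
have [L L0 HL] := lipschitz_on_cball r'r sb.
apply: rV_continuousP => e e0.
have d0 : 0 < Num.min ((r - `|u0 - u|) / 2) (e / (L + 1)).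
  by rewrite lt_min divr_gt0//= ?divr_gt0//; lra.
exists (Num.min ((r - `|u0 - u|) / 2) (e / (L + 1))) => //.
move=> v; rewrite lt_min => /andP[uv1 uv2].
have vr' : `|u0 - v| <= r'.
  have -> : u0 - v = (u0 - u) + (u - v) by rewrite addrA subrK.
  by rewrite (le_trans (ler_normD _ _))// /r'; lra.
have Bv : B v by rewrite -ball_normE /=; exact: le_lt_trans r'r.
have ur' : `|u0 - u| <= r' by rewrite /r'; lra.
rewrite /ray_mean -RintegralB//; [|exact: ray_integrable..].
have intB : mu.-integrable `[0, 1]
    (EFin \o (fun t => ray_integrand k b u t - ray_integrand k b v t)).
  have i1 := ray_integrable k cb Bu; have i2 := ray_integrable k cb Bv.
  exact: (integrableB _ i1 i2).
rewrite (le_trans (le_normr_Rintegral _ intB))//.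
have -> : e = (\int[mu]_(t in `[0%R, 1%R]) e)%R.
  rewrite Rintegral_cst// -[LHS]mulr1 -[in LHS](_ : fine 1%E = 1 :> R)//.
  by rewrite -lebesgue_measure01.
apply: le_Rintegral => //.
- by apply: integrable_norm.
- apply: continuous_compact_integrable; first exact: segment_compact.
  by apply: continuous_subspaceT => ?; exact: cst_continuous.
move=> t; rewrite /= in_itv /= => t01; have /andP[t0 t1] := t01.
rewrite /ray_integrand -mulrBr normrM ger0_norm ?exprn_ge0//.
have H : `|b (ray u t) - b (ray v t)| <= e.
  rewrite (le_trans (HL _ _ _ _))//.
  - exact: le_trans (ray_le _ t01) _.
  - exact: le_trans (ray_le _ t01) _.
  have -> : ray u t - ray v t = t *: (u - v).
    by apply/rowP => i; rewrite !mxE; ring.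
  rewrite normrZ ger0_norm//.
  move: uv2; rewrite ltr_pdivlMr; last by lra.
  move=> /ltW; apply: le_trans.
  apply: (@le_trans _ _ (L * `|u - v|)); first by rewrite ler_wpM2l// ler_piMl.
  by rewrite [leRHS]mulrC ler_wpM2r// lerDl.
rewrite (le_trans _ H)// ler_piMl// exprn_ile1//.
Qed.

(** Differentiation under the integral sign, by dominated convergence of the
    difference quotients on a smaller closed ball. *)
Lemma ray_mean_derive k b u j : Ck 2 B b -> B u ->
  derivable (ray_mean k b) u (delta_mx 0 j) /\
  'D_(delta_mx 0 j) (ray_mean k b) u =
  ray_mean k.+1 (fun v => 'D_(delta_mx 0 j) b v) u.
Proof.
move=> sb Bu.
have cb := Ck_cont sb.
have sdb : Ck 1 B (fun v => 'D_(delta_mx 0 j) b v) by have [_ /(_ j)[]] := sb.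
have cdb := Ck_cont sdb.
set e : 'rV[R]_n := delta_mx 0 j.
have Bu' : `|u0 - u| < r by move: Bu; rewrite -ball_normE.
pose r' := (`|u0 - u| + r) / 2.
have r'r : r' < r by rewrite /r'; lra.
pose d := (r - `|u0 - u|) / 2.
have d0 : 0 < d by rewrite /d; lra.
have e1 : `|e| <= 1.
  apply: rV_norm_le => // i; rewrite mxE eqxx /=.
  by case: eqP => _; rewrite ?normr1 ?normr0.
have near_u (s : R) : `|s| < d -> `|u0 - (s *: e + u)| <= r'.
  move=> sd; rewrite [s *: e + u]addrC opprD addrA (le_trans (ler_normB _ _))// normrZ.
  have : `|s| * `|e| <= `|s| by rewrite ler_piMr.
  by rewrite /r' /d in sd *; lra.
have nearB (s : R) : `|s| < d -> B (s *: e + u).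
  by move=> /near_u ur'; rewrite -ball_normE /=; exact: le_lt_trans r'r.
have [c c0 Hc] := bounded_on_cball r'r cdb.
pose f (s t : R) := ray_integrand k b (s *: e + u) t.
have rayE (s t : R) : ray (s *: e + u) t = ray u t + s *: (t *: e).
  by apply/rowP => i; rewrite !mxE; ring.
have Is (s : R) : `]- d, d[%classic s -> `|s| < d.
  by rewrite /= in_itv /= ltr_norml.
have df (s t : R) : `]- d, d[%classic s -> `[0, 1]%classic t ->
    derivable (f ^~ t) s 1 /\
    'D_1 (f ^~ t) s = t ^+ k.+1 * 'D_e b (ray (s *: e + u) t).
  move=> /Is sd; rewrite /= in_itv /= => t01.
  have Br := ray_ball (nearB _ sd) t01.
  have [dbr _] := smooth_differentiable ball_open_rV (CkW sb) Br.
  have /derivable_line [d1 d2] : derivable b (ray u t + s *: (t *: e)) (t *: e).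
    by rewrite -rayE; exact: diff_derivable.
  have fE : f ^~ t = (t ^+ k) \*: (fun s : R => b (ray u t + s *: (t *: e))).
    by apply/funext => z; rewrite /f /ray_integrand rayE.
  split; first by rewrite fE; exact: derivableZ.
  rewrite fE deriveZ// d2 -rayE (deriveE _ dbr) linearZ -(deriveE _ dbr) !scaleRE.
  by rewrite mulrA exprSr.
have Fh : (fun s : R => ray_mean k b (s *: e + u)) =
    (fun s : R => (\int[mu]_(t in `[0%R, 1%R]) f s t)%R) by [].
have I0 : `]- d, d[%classic (0 : R) by rewrite /= in_itv /= oppr_lt0 d0.
have intf s : `]- d, d[%classic s -> mu.-integrable `[0, 1] (EFin \o f s).
  by move=> /Is sd; apply: ray_integrable => //; exact: nearB.
have intc : mu.-integrable `[0, 1] (EFin \o (fun _ : R => c)).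
  apply: continuous_compact_integrable; first exact: segment_compact.
  by apply: continuous_subspaceT => ?; exact: cst_continuous.
have bnd s t : `]- d, d[%classic s -> `[0, 1]%classic t ->
    `|partial1of2 f s t| <= c.
  move=> sd t01; rewrite partial1of2E; have [_ ->] := df _ _ sd t01.
  move: t01; rewrite /= in_itv /= => t01; have /andP[t0 t1] := t01.
  have H : `|'D_e b (ray (s *: e + u) t)| <= c.
    apply: Hc; apply: le_trans (ray_le _ t01) _; apply: near_u; exact: Is.
  rewrite normrM; apply: le_trans H; rewrite ler_piMl//.
  by rewrite ger0_norm ?exprn_ge0// exprn_ile1.
have df1 s t : `]- d, d[%classic s -> `[0, 1]%classic t -> derivable (f ^~ t) s 1.
  by move=> sd t01; case: (df _ _ sd t01).
have C := @cvg_differentiation_under_integral R _ _ mu f `[0, 1]%classic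
  (measurable_itv _) 0 (- d) d I0 intf df1 (fun=> c) (fun=> c0) intc bnd.
have E : (\int[mu]_(t in `[0%R, 1%R]) (partial1of2 f 0 t))%R =
    ray_mean k.+1 (fun v => 'D_e b v) u.
  apply: eq_Rintegral => t; rewrite inE => t01.
  by rewrite partial1of2E; have [_ ->] := df _ _ I0 t01; rewrite scale0r add0r.
rewrite E in C.
have CE : (fun h : R => h^-1 *: ((\int[mu]_(y in `[0%R, 1%R]) f (h + 0)%R y)%R -
      (\int[mu]_(y in `[0%R, 1%R]) f 0%R y)%R)) =
    (fun h : R => h^-1 *: ((ray_mean k b \o shift u) (h *: e) - ray_mean k b u)).
  apply/funext => h; rewrite addr0 /= /f /ray_mean.
  by rewrite scale0r add0r.
rewrite CE in C.
split; first by apply/cvg_ex; exists (ray_mean k.+1 (fun v => 'D_e b v) u).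
exact: cvg_lim.
Qed.

Lemma smooth_ray_mean k b : smooth_on B b -> smooth_on B (ray_mean k b).
Proof.
move=> sb N; elim: N k b sb => [|N IHN] k b sb.
  by split=> // u; exact: ray_mean_continuous.
split=> [u|j]; first exact: ray_mean_continuous.
split=> [u Bu|]; first by have [] := ray_mean_derive k j (sb 2%N) Bu.
apply: Ck_ext (IHN k.+1 _ (smooth_derive j sb)); first exact: ball_open_rV.
by move=> u Bu; have [_ ->] := ray_mean_derive k j (sb 2%N) Bu.
Qed.

Lemma ray_mean_center b i :
  ray_mean 0 (fun v => 'D_(delta_mx 0 i) b v) u0 = 'D_(delta_mx 0 i) b u0.
Proof.
rewrite /ray_mean /ray_integrand.
transitivity (\int[mu]_(t in `[0%R, 1%R]) ('D_(delta_mx 0 i) b u0))%R.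
  apply: eq_Rintegral => t _.
  by rewrite expr0 mul1r /ray subrr scaler0 addr0.
rewrite Rintegral_cst// -[RHS]mulr1 -[in RHS](_ : fine 1%E = 1 :> R)//.
by rewrite -lebesgue_measure01.
Qed.

(** Hadamard's lemma: the fundamental theorem of calculus along the segment from
    [u0] to [u]. *)
Lemma hadamard b u : smooth_on B b -> B u ->
  b u = b u0 + \sum_i (u 0 i - u0 0 i) *
    ray_mean 0 (fun v => 'D_(delta_mx 0 i) b v) u.
Proof.
move=> sb Bu.
pose g t := b (ray u t).
have dg (t : R) : 0 <= t <= 1 -> is_derive t 1 g
    (\sum_i (u 0 i - u0 0 i) * ray_integrand 0 (fun v => 'D_(delta_mx 0 i) b v) u t).
  move=> t01; have Br := ray_ball Bu t01.
  have [dbr dE] := smooth_differentiable ball_open_rV (sb 1%N) Br.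
  have /derivable_line [d1 d2] : derivable b (u0 + t *: (u - u0)) (u - u0).
    exact: diff_derivable.
  apply: DeriveDef; first exact: d1.
  rewrite d2 (deriveE _ dbr) dE; apply: eq_bigr => i _.
  by rewrite !mxE /ray_integrand expr0 mul1r.
have cD i x : B x -> {for x, continuous (fun v => 'D_(delta_mx 0 i) b v)}.
  exact: smooth_cont (smooth_derive i sb).
set g' := fun t => \sum_i (u 0 i - u0 0 i) * ray_integrand 0 (fun v => 'D_(delta_mx 0 i) b v) u t.
have ci i (t : R) : 0 <= t <= 1 -> {for t, continuous (fun t => (u 0 i - u0 0 i) *
    ray_integrand 0 (fun v => 'D_(delta_mx 0 i) b v) u t)}.
  move=> t01.
  have h1 : {for t, continuous (fun _ : R => u 0 i - u0 0 i)}.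
    exact: cst_continuous.
  have h2 := ray_integrand_at (k := 0) (cD i) Bu t01.
  have h3 := continuousM h1 h2.
  exact: h3.
have cg' : {within `[0, 1], continuous g'}.
  apply: continuous_on01 => t t01.
  by apply: (cvg_sumr (FF := nbhs_filter t)) => i; exact: ci.
have cg (t : R) : 0 <= t <= 1 -> {for t, continuous g}.
  by move=> /dg [d _]; apply: differentiable_continuous; exact/derivable1_diffP.
have FTC := @continuous_FTC2 R g' g 0 1 ltr01 cg'.
have {FTC} FTC : (\int[mu]_(t in `[0%R, 1%R]) g' t)%R = g 1 - g 0.
  rewrite /Rintegral FTC//.
  split=> [t t01||].
  - by case: (dg t) => //; move: t01; rewrite in_itv /= => /andP[? ?]; rewrite !ltW.
  - by apply: cvg_at_right_filter; apply: cg; rewrite lexx ler01.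
  - by apply: cvg_at_left_filter; apply: cg; rewrite lexx ler01.
  move=> t; rewrite in_itv /= => /andP[t0 t1]; rewrite derive1E.
  by have [|_ ->] := dg t; rewrite ?ltW.
have -> : b u = b u0 + (g 1 - g 0).
  by rewrite /g /ray scale1r scale0r addr0 !subrKC.
congr (_ + _); rewrite -FTC /g'.
have inti i : mu.-integrable `[0, 1] (EFin \o (fun t => (u 0 i - u0 0 i) *
    ray_integrand 0 (fun v => 'D_(delta_mx 0 i) b v) u t)).
  apply: continuous_compact_integrable; first exact: segment_compact.
  by apply: continuous_on01; exact: ci.
have [_ ->] := Rintegral_sum (index_enum 'I_n)
  (f := fun (i : 'I_n) (t : measurableTypeR R) => (u 0 i - u0 0 i) * ray_integrand 0 (fun v => 'D_(delta_mx 0 i) b v) u t)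
  (measurable_itv _) inti.
apply: eq_bigr => i _; rewrite RintegralZl//.
exact: (ray_integrable 0 (cD i) Bu).
Qed.

End hadamard.

(** * Smooth functions and charts *)

Section eval.
Context {R : realType} {X : topologicalType} {n : nat}.
Variable M : smooth_manifold R X n.
Local Notation C := (smoothfun M).
Local Notation VF := (vfield M).

Lemma sfD (f h : C) x : (f + h) x = f x + h x. Proof. by []. Qed.
Lemma sfM (f h : C) x : (f * h) x = f x * h x. Proof. by []. Qed.
Lemma sfB (f h : C) x : (f - h) x = f x - h x. Proof. by []. Qed.
Lemma sfZ (a : R) (f : C) x : (a *: f) x = a * f x. Proof. by []. Qed.
Lemma sf0 x : (0 : C) x = 0. Proof. by []. Qed.
Lemma sf1 x : (1 : C) x = 1. Proof. by []. Qed.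
Lemma sfX (f : C) k x : (f ^+ k) x = f x ^+ k.
Proof. by elim: k => // k IHk; rewrite !exprS sfM IHk. Qed.
Lemma sf_sum (I : Type) (r : seq I) (P : pred I) (F : I -> C) x :
  (\sum_(i <- r | P i) F i) x = \sum_(i <- r | P i) F i x.
Proof. by apply: (big_morph (fun f : C => f x)). Qed.
Lemma sf_prod (I : Type) (r : seq I) (P : pred I) (F : I -> C) x :
  (\prod_(i <- r | P i) F i) x = \prod_(i <- r | P i) F i x.
Proof. by apply: (big_morph (fun f : C => f x)). Qed.
Lemma sf_sign k x : ((-1 : C) ^+ k) x = (-1) ^+ k.
Proof. by rewrite sfX. Qed.

Lemma sfP (f h : C) : (forall x, f x = h x) -> f = h.
Proof. by move=> fh; apply/val_inj/funext. Qed.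

Lemma vfD (U V : VF) f : (U + V) f = U f + V f. Proof. by []. Qed.
Lemma vfB (U V : VF) f : (U - V) f = U f - V f. Proof. by []. Qed.
Lemma vfZ (h : C) (V : VF) f : (h *: V) f = h * V f. Proof. by []. Qed.
Lemma vf0 f : (0 : VF) f = 0. Proof. by []. Qed.
Lemma vf_sum (I : Type) (r : seq I) (P : pred I) (F : I -> VF) f :
  (\sum_(i <- r | P i) F i) f = \sum_(i <- r | P i) F i f.
Proof. by apply: (big_morph (fun V : VF => V f)). Qed.

Lemma vf_add (V : VF) f h : V (f + h) = V f + V h.
Proof. by have := vfield_linear V 1 f h; rewrite !scale1r. Qed.
Lemma vf_zero (V : VF) : V 0 = 0.
Proof. by apply: (addrI (V 0)); rewrite -vf_add !addr0. Qed.
Lemma vf_scale (V : VF) a f : V (a *: f) = a *: V f.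
Proof. by have := vfield_linear V a f 0; rewrite vf_zero !addr0. Qed.
Lemma vf_opp (V : VF) f : V (- f) = - V f.
Proof. by rewrite -scaleN1r vf_scale scaleN1r. Qed.
Lemma vf_sub (V : VF) f h : V (f - h) = V f - V h.
Proof. by rewrite vf_add vf_opp. Qed.
Lemma vf_one (V : VF) : V 1 = 0.
Proof.
have := vfieldM V 1 1; rewrite !mul1r => E.
by apply: (addrI (V 1)); rewrite -E addr0.
Qed.
Lemma vf_sumr (I : Type) (r : seq I) (P : pred I) (F : I -> C) (V : VF) :
  V (\sum_(i <- r | P i) F i) = \sum_(i <- r | P i) V (F i).
Proof. by apply: (big_morph V (vf_add V) (vf_zero V)). Qed.
Lemma vf_expn (V : VF) f k : V (f ^+ k.+1) = k.+1%:R * f ^+ k * V f.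
Proof.
elim: k => [|k IHk]; first by rewrite !expr1 expr0 !mul1r.
rewrite exprS vfieldM IHk -[in RHS](@natr1 C k.+1) mulrDl mulrDl mul1r; congr (_ + _).
by rewrite [in RHS]exprS !mulrA (mulrC f).
Qed.

End eval.

Section manifold.
Context {R : realType} {X : topologicalType} {n : nat}.
Variable M : smooth_manifold R X n.
Local Notation C := (smoothfun M).
Local Notation VF := (vfield M).
Implicit Types c : chart R X n.

Lemma chart_codom c u : atlas M c -> codom_chart c u ->
  dom c (param c u) /\ coord c (param c u) = u.
Proof. by move=> Mc [x dx <-]; rewrite (coordK Mc). Qed.

Lemma open_param_preim c (A : set X) : atlas M c -> open A ->
  open (codom_chart c `&` param c @^-1` A).
Proof.
move=> Mc oA; rewrite openE => u [cu Au]; apply: filterI.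
  by apply: open_nbhs_nbhs; split=> //; exact: (open_codom Mc).
by apply: (param_continuous Mc cu); apply: open_nbhs_nbhs.
Qed.

Lemma open_coord_preim c (W : set 'rV[R]_n) : atlas M c -> open W ->
  open (dom c `&` coord c @^-1` W).
Proof.
move=> Mc oW; rewrite openE => x [dx Wx]; apply: filterI.
  by apply: open_nbhs_nbhs; split=> //; exact: (open_dom Mc).
by apply: (Defs.coord_continuous Mc dx); apply: open_nbhs_nbhs.
Qed.

(** Smoothness may be checked near each point in a single chart, since the
    transition maps are smooth. *)
Lemma smooth_local (f : X -> R) :
  (forall x, exists c (W : set 'rV[R]_n), [/\ atlas M c, dom c x, open W,
     W (coord c x) & W `<=` codom_chart c /\ smooth_on W (f \o param c)]) ->
  f \in smooth M.
Proof.
move=> Hf; apply/smoothP => c' Mc' k; apply: Ck_local => u cu.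
have [dx uE] := chart_codom Mc' cu.
have [c [W [Mc dcx oW Wx [Wc sf]]]] := Hf (param c' u).
pose V := codom_chart c' `&` param c' @^-1` (dom c `&` coord c @^-1` W).
have oV : open V by apply: open_param_preim => //; exact: open_coord_preim.
exists V; first by split.
apply: (Ck_ext (f := (f \o param c) \o (fun v => coord c (param c' v)))) => //.
  by move=> v [_ [dv _]] /=; rewrite (coordK Mc).
apply: (Ck_comp k oV oW) => //.
  by move=> v [_ []].
move=> i k'; apply: Ck_sub (atlas_compatible Mc' Mc i k') => v [cv [dv _]].
by have [dv' vE] := chart_codom Mc' cv; exists (param c' v).
Qed.

Lemma smooth_continuous (f : C) : continuous f.
Proof.
move=> x; have [c Mc dx] := atlas_cover M x.
have /smoothP sf := valP f.
have cf : {for coord c x, continuous (f \o param c)}.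
  by apply: smooth_cont (sf c Mc) _; exists x.
have cfc : {for x, continuous ((f \o param c) \o coord c)}.
  by apply: continuous_comp; [exact: (Defs.coord_continuous Mc dx)|].
have E : \forall y \near x, ((f \o param c) \o coord c) y = f y.
  have : open_nbhs x (dom c) by split=> //; exact: (open_dom Mc).
  by move=> /open_nbhs_nbhs; apply: filterS => y dy /=; rewrite (coordK Mc).
move: cfc; rewrite /prop_for /continuous_at /= (coordK Mc dx) => cfc.
by apply: cvg_trans cfc; exact: (near_eq_cvg E).
Qed.

Definition chart_ext c (W : set 'rV[R]_n) (b : 'rV[R]_n -> R) (x : X) : R :=
  if `[< dom c x /\ W (coord c x) >] then b (coord c x) else 0.

Lemma chart_ext_smooth c (W K : set 'rV[R]_n) b : atlas M c -> open W ->
  W `<=` codom_chart c -> compact K -> K `<=` W -> smooth_on W b ->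
  (forall u, W u -> ~ K u -> b u = 0) -> chart_ext c W b \in smooth M.
Proof.
move=> Mc oW Wc cK KW sb b0.
have cptK : compact (param c @` K).
  apply: continuous_compact => //; apply: continuous_in_subspaceT => u.
  by rewrite inE => /KW /Wc; exact: param_continuous Mc _.
have oK : open (~` (param c @` K)).
  by rewrite openC; apply: compact_closed => //; exact: manifold_hausdorff M.
apply: smooth_local => x; have [[dx Wx]|nx] := pselect (dom c x /\ W (coord c x)).
  exists c, W; split=> //; split=> // k.
  apply: Ck_ext (sb k) => // u Wu.
  have [du uE] := chart_codom Mc (Wc _ Wu).
  by rewrite /= /chart_ext uE asboolT.
have [c' Mc' dx'] := atlas_cover M x.
have nKx : ~ (param c @` K) x.
  move=> [u Ku ux]; have [du uE] := chart_codom Mc (Wc _ (KW _ Ku)).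
  by apply: nx; rewrite -ux uE; split=> //; exact: KW.
exists c', (codom_chart c' `&` param c' @^-1` (~` (param c @` K))); split=> //.
- exact: open_param_preim.
- by split; [exists x|rewrite /= (coordK Mc')].
- split=> [u []//|k]; apply: Ck_ext (Ck_cst k _ 0); first exact: open_param_preim.
  move=> u [cu nKu]; rewrite /= /chart_ext; case: asboolP => // -[dv Wv].
  symmetry; apply: b0 => // Kv; apply: nKu.
  by exists (coord c (param c' u)) => //; rewrite (coordK Mc).
Qed.

Lemma flat0_le (s t : R) : s <= t -> flat 0 s <= flat 0 t.
Proof.
move=> st; have [s0|s0] := leP s 0; first by rewrite flat_le0// flat_ge0.
have t0 := lt_le_trans s0 st.
by rewrite /flat s0 t0 !expr0 invr1 !mul1r ler_expR lerN2 lef_pV2 ?posrE.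
Qed.

(** The numerator is constant for [t <= 0] and vanishes for [s <= t]: composing flat
    functions replaces the integration of a bump. *)
Definition plateau (s t : R) : R := flat 0 (flat 0 s - flat 0 t) / flat 0 (flat 0 s).

Lemma plateau1 s t : 0 < s -> t <= 0 -> plateau s t = 1.
Proof.
move=> s0 t0; rewrite /plateau (flat_le0 _ t0) subr0 divff// gt_eqF//.
exact/flat0_gt0/flat0_gt0.
Qed.

Lemma plateau0 s t : s <= t -> plateau s t = 0.
Proof. by move=> st; rewrite /plateau flat_le0 ?mul0r// subr_le0 flat0_le. Qed.

Lemma plateau_ge0 s t : 0 <= plateau s t.
Proof. by rewrite mulr_ge0 ?invr_ge0 ?flat_ge0. Qed.

Lemma Ck_plateau m k (U : set 'rV[R]_m) q s : open U -> smooth_on U q ->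
  Ck k U (plateau s \o q).
Proof.
move=> oU sq.
have sf : smooth_on U ((-1) \*: (flat 0 \o q) + cst (flat 0 s)).
  by move=> k'; apply: Ck_lin => //; [exact: Ck_flat|exact: Ck_cst].
have := Ck_lin (flat 0 (flat 0 s))^-1 oU (Ck_flat k 0 oU sf) (Ck_cst k U 0).
congr Ck; apply/funext => u.
have E (a b d : R) : d^-1 * flat 0 (-1 * a + b) + 0 = flat 0 (b - a) / d.
  by rewrite addr0 mulrC mulN1r addrC.
exact: E.
Qed.

Lemma Ck_coord m k (U : set 'rV[R]_m) i : open U -> Ck k U (fun v => v 0 i).
Proof.
move=> oU; have dc (v : 'rV[R]_m) j : is_derive v (delta_mx 0 j) (fun v => v 0 i : R) (i == j)%:R.
  have dv : differentiable (fun v : 'rV[R]_m => v 0 i : R) v by exact: differentiable_coord.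
  apply: DeriveDef; first exact: diff_derivable.
  have -> : (i == j)%:R = lin_form (fun l => (l == i)%:R) (delta_mx 0 j) :> R.
    rewrite /lin_form (bigD1 j)//= mxE !eqxx mul1r eq_sym big1 ?addr0//.
    by move=> l /negbTE lj; rewrite mxE lj andbF mul0r.
  have -> : (fun v : 'rV[R]_m => v 0 i) = lin_form (fun l => (l == i)%:R).
    apply/funext => z; rewrite /lin_form (bigD1 i)//= eqxx mulr1 big1 ?addr0//.
    by move=> l /negbTE ->; rewrite mulr0.
  rewrite deriveE ?diff_lin//; try exact: lin_form_continuous.
  by apply: linear_differentiable; exact: lin_form_continuous.
have cc (u : 'rV[R]_m) : U u -> {for u, continuous (fun v : 'rV[R]_m => v 0 i : R)}.
  by move=> _; exact: coord_continuous.
case: k => [|k]; split=> //.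
move=> j; split=> [v _|]; first by case: (dc v j).
by apply: Ck_ext (Ck_cst k U (i == j)%:R) => // v _; case: (dc v j).
Qed.

Lemma Ck_sqdist m k (U : set 'rV[R]_m) (u : 'rV[R]_m) (a : R) : open U ->
  Ck k U (fun v => \sum_i (v 0 i - u 0 i) ^+ 2 - a).
Proof.
move=> oU.
have c1 i : Ck k U (fun v => v 0 i - u 0 i).
  have := Ck_lin 1 oU (Ck_coord k i oU) (Ck_cst k U (- u 0 i)).
  congr Ck; apply/funext => v.
  have E (a1 b1 : R) : 1 * a1 + b1 = a1 + b1 by rewrite mul1r.
  exact: E.
have c2 : Ck k U (fun v => \sum_i (v 0 i - u 0 i) ^+ 2).
  by apply: Ck_sum => // i; exact: (Ck_mul oU (c1 i) (c1 i)).
have := Ck_lin 1 oU c2 (Ck_cst k U (- a)).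
congr Ck; apply/funext => v.
have E (a1 b1 : R) : 1 * a1 + b1 = a1 + b1 by rewrite mul1r.
exact: E.
Qed.

Lemma chart_plateau c (W : set 'rV[R]_n) u : atlas M c -> open W ->
  W `<=` codom_chart c -> W u ->
  exists (eta : 'rV[R]_n -> R) (K N : set 'rV[R]_n),
  [/\ open N, N u, N `<=` K, compact K /\ K `<=` W &
   [/\ smooth_on W eta, forall v, 0 <= eta v, forall v, N v -> eta v = 1 &
       forall v, ~ K v -> eta v = 0]].
Proof.
move=> Mc oW Wc Wu.
have /nbhs_ballP [r /= r0 rW] : nbhs u W by exact: open_nbhs_nbhs.
pose s := r / 2.
have s0 : 0 < s by rewrite /s; lra.
pose q (v : 'rV[R]_n) := \sum_i (v 0 i - u 0 i) ^+ 2 - (s / 2) ^+ 2.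
pose d := s ^+ 2 - (s / 2) ^+ 2.
have d0 : 0 < d by rewrite /d; nra.
have sq k U : open U -> Ck k U q by exact: Ck_sqdist.
pose N := [set v | q v < 0].
exists (plateau d \o q), [set v | `|u - v| <= s], N; split.
- apply: (@open_comp _ _ q [set t | t < 0]); last exact: open_lt.
  by move=> v _; apply: (Ck_cont (sq 0%N setT openT)).
- rewrite /N /= /q big1; first by rewrite sub0r oppr_lt0 exprn_gt0// divr_gt0.
  by move=> i _; rewrite subrr expr0n.
- move=> v; rewrite /N /= /q subr_lt0 => qv.
  apply: rV_norm_le; first exact: ltW.
  move=> i; rewrite !mxE -(@ler_pXn2r _ 2)// ?nnegrE ?normr_ge0 ?(ltW s0)//.
  rewrite real_normK ?num_real//.
  have : (u 0 i - v 0 i) ^+ 2 <= \sum_i (v 0 i - u 0 i) ^+ 2.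
    rewrite (bigD1 i)//= -[(u 0 i - _)]opprB sqrrN lerDl.
    by apply: sumr_ge0 => j _; exact: sqr_ge0.
  by nra.
- split; first exact: cball_compact.
  move=> v vs; apply: rW; rewrite -ball_normE /=.
  by apply: le_lt_trans vs _; rewrite /s; lra.
split=> [k||v qv|v vs].
- by apply: Ck_plateau => // k'; exact: sq.
- by move=> v; exact: plateau_ge0.
- by apply: plateau1 => //; exact: ltW.
- apply: plateau0; rewrite /d /q lerD2r.
  have [//|qs] := leP (s ^+ 2) (\sum_i (v 0 i - u 0 i) ^+ 2).
  exfalso; apply: vs; apply: rV_norm_le; first exact: ltW.
  move=> i; rewrite !mxE -(@ler_pXn2r _ 2)// ?nnegrE ?normr_ge0 ?(ltW s0)//.
  rewrite real_normK ?num_real//; apply: le_trans (ltW qs).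
  rewrite (bigD1 i)//= -[(u 0 i - _)]opprB sqrrN lerDl.
  by apply: sumr_ge0 => j _; exact: sqr_ge0.
Qed.

End manifold.

(** * Bump functions and local frames *)

Section frames.
Context {R : realType} {X : topologicalType} {n : nat}.
Variable M : smooth_manifold R X n.
Local Notation C := (smoothfun M).
Local Notation VF := (vfield M).
Implicit Types c : chart R X n.

Lemma chart_extE c (W : set 'rV[R]_n) b x : dom c x -> W (coord c x) ->
  chart_ext c W b x = b (coord c x).
Proof. by move=> dx Wx; rewrite /chart_ext asboolT. Qed.

(** Multiply by a plateau of the chart and extend by zero. *)
Lemma chart_function c (W : set 'rV[R]_n) u F : atlas M c -> open W ->
  W `<=` codom_chart c -> W u -> smooth_on W F ->
  exists (f : C) (N : set 'rV[R]_n), [/\ open N, N u, N `<=` W &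
    forall v, N v -> f (param c v) = F v].
Proof.
move=> Mc oW Wc Wu sF.
have [eta [K [N [oN Nu NK [cK KW] [seta _ eta1 eta0]]]]] := chart_plateau Mc oW Wc Wu.
have sb : chart_ext c W (eta * F) \in smooth M.
  apply: (chart_ext_smooth Mc oW Wc cK KW) => [k|v Wv nKv].
    exact: (Ck_mul oW (seta k) (sF k)).
  by rewrite fctE /= eta0// mul0r.
exists (SmoothFun sb), N; split=> // [v /NK /KW //|v Nv].
have Wv := KW _ (NK _ Nv); have [dv vE] := chart_codom Mc (Wc _ Wv).
by rewrite /= chart_extE ?vE// fctE /= eta1// mul1r.
Qed.

(** A plateau of a chart, extended by zero. *)
Lemma sf_bump (U : set X) x : open U -> U x ->
  exists (b : C) (N K : set X), [/\ open N, N x, N `<=` K, K `<=` U /\ compact K &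
    [/\ forall y, N y -> b y = 1, forall y, 0 <= b y & forall y, ~ K y -> b y = 0]].
Proof.
move=> oU Ux; have [c Mc dx] := atlas_cover M x.
pose W := codom_chart c `&` param c @^-1` U.
have oW : open W by exact: (open_param_preim Mc oU).
have Wc : W `<=` codom_chart c by move=> u [].
have Wx : W (coord c x) by split; [exists x|rewrite /= (coordK Mc dx)].
have [eta [K [N [oN Nu NK [cK KW] [seta eta_ge0 eta1 eta0]]]]] := chart_plateau Mc oW Wc Wx.
have sb : chart_ext c W eta \in smooth M.
  by apply: (chart_ext_smooth Mc oW Wc cK KW) => // v Wv nKv; exact: eta0.
exists (SmoothFun sb), (dom c `&` coord c @^-1` N), (param c @` K); split.
- exact: (open_coord_preim Mc oN).
- by split.
- by move=> y [dy Ny]; exists (coord c y); [exact: NK|rewrite (coordK Mc)].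
- split; first by move=> _ [u Ku <-]; have [] := KW _ Ku.
  apply: continuous_compact => //; apply: continuous_in_subspaceT => u.
  by rewrite inE => /KW /Wc; exact: (param_continuous Mc).
split=> [y [dy Ny]|y|y nKy] /=.
- by rewrite chart_extE ?eta1//; exact: KW _ (NK _ Ny).
- by rewrite /chart_ext; case: asboolP.
- rewrite /chart_ext; case: asboolP => // -[dy Wy]; apply: eta0 => Ky.
  by apply: nKy; exists (coord c y); rewrite ?(coordK Mc).
Qed.

(** A derivation is a local operator: multiply by a bump function. *)
Lemma vf_local0 (V : VF) (f : C) (U : set X) x : open U -> U x ->
  (forall y, U y -> f y = 0) -> V f x = 0.
Proof.
move=> oU Ux f0.
have [b [N [K [oN Nx NK [KU cK] [b1 _ b0]]]]] := sf_bump oU Ux.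
have bf : b * f = 0.
  apply: sfP => y; rewrite sfM sf0; have [Ky|nKy] := pselect (K y).
    by rewrite f0 ?mulr0//; exact: KU.
  by rewrite b0 ?mul0r.
have := vfieldM V b f; rewrite bf vf_zero => /(congr1 (fun h : C => h x)).
by rewrite sfD !sfM (f0 _ Ux) mul0r addr0 (b1 _ Nx) mul1r.
Qed.

Lemma vf_local (V : VF) (f h : C) (U : set X) x : open U -> U x ->
  (forall y, U y -> f y = h y) -> V f x = V h x.
Proof.
move=> oU Ux fh; apply/subr0_eq; rewrite -sfB -vf_sub.
by apply: (vf_local0 V oU Ux) => y Uy; rewrite sfB fh// subrr.
Qed.

Lemma vf_cst (V : VF) (f : C) (a : R) (U : set X) x : open U -> U x ->
  (forall y, U y -> f y = a) -> V f x = 0.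
Proof.
move=> oU Ux fa; rewrite (@vf_local V f (a *: (1 : C)) U)//.
  by rewrite vf_scale vf_one scaler0.
by move=> y Uy; rewrite fa// sfZ mulr1.
Qed.

Section coordinate_fields.
Variables (c : chart R X n) (eta : 'rV[R]_n -> R) (K : set 'rV[R]_n).
Hypotheses (Mc : atlas M c) (cK : compact K) (KW : K `<=` codom_chart c).
Hypotheses (seta : smooth_on (codom_chart c) eta) (eta0 : forall v, ~ K v -> eta v = 0).

(** The partial derivative in a chart, cut off by a plateau [eta] so that it acts on
    global functions. *)
Lemma coord_field_smooth (i : 'I_n) (f : C) : chart_ext c (codom_chart c)
  (eta * (fun u => 'D_(delta_mx 0 i) (f \o param c) u)) \in smooth M.
Proof.
have /smoothP sf := valP f.
apply: (chart_ext_smooth Mc _ _ cK KW) => //; first exact: open_codom Mc.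
  move=> k; apply: Ck_mul; first exact: open_codom Mc; first exact: seta.
  exact: (smooth_derive i (sf _ Mc)).
by move=> v _ nKv; rewrite fctE /= eta0// mul0r.
Qed.

Definition coord_field_fun (i : 'I_n) (f : C) : C := SmoothFun (coord_field_smooth i f).

Lemma coord_field_funE i f y : dom c y -> coord_field_fun i f y =
  eta (coord c y) * 'D_(delta_mx 0 i) (f \o param c) (coord c y).
Proof. by move=> dy; rewrite /= chart_extE//; exists y. Qed.

Lemma coord_field_fun0 i f y : ~ dom c y -> coord_field_fun i f y = 0.
Proof. by move=> ndy; rewrite /= /chart_ext; case: asboolP => // -[]. Qed.

Lemma coord_field_derivation i : coord_field_fun i \in derivation (M := M).
Proof.
have der (f : C) y : dom c y -> derivable (f \o param c) (coord c y) (delta_mx 0 i).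
  move=> dy; have /smoothP sf := valP f.
  have cy : codom_chart c (coord c y) by exists y.
  have H : smooth_on (codom_chart c) (f \o param c) := sf c Mc.
  exact: (smooth_derivable H cy).
apply/derivationP; split=> [a f h|f h]; apply: sfP => y.
  rewrite sfD sfZ; have [dy|ndy] := pselect (dom c y); last first.
    by rewrite !coord_field_fun0// mulr0 addr0.
  rewrite !coord_field_funE//.
  have E : (a *: f + h : C) \o param c = a \*: (f \o param c) + (h \o param c) by [].
  rewrite E deriveD; [|by apply: derivableZ; exact: der|exact: der].
  by rewrite deriveZ ?scaleRE; [ring|exact: der].
rewrite sfD !sfM; have [dy|ndy] := pselect (dom c y); last first.
  by rewrite !coord_field_fun0// !mulr0 addr0.
rewrite !coord_field_funE//.
have E : (f * h : C) \o param c = (f \o param c) * (h \o param c) by [].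
rewrite E deriveM; [|exact: der|exact: der].
by rewrite !scaleRE /= (coordK Mc dy); ring.
Qed.

Definition coord_field i : VF := VField (coord_field_derivation i).

End coordinate_fields.

(** Coordinate vector fields form a local frame, dual to the coordinate functions:
    every derivation is determined by its values on coordinates, by Hadamard's
    lemma. *)
Lemma local_frame_inj x : exists (N : set X) (E : 'I_n -> VF) (u : 'I_n -> C),
  [/\ open N, N x, forall y i j, N y -> E i (u j) y = (i == j)%:R &
      forall (V : VF) f y, N y -> V f y = \sum_i V (u i) y * E i f y] /\
  (forall y y', N y -> N y' -> (forall i, u i y = u i y') -> y = y').
Proof.
have [c Mc dx] := atlas_cover M x.
have oc := open_codom Mc.
have xc : codom_chart c (coord c x) by exists x.
have [eta [K [N [oN Nu NK [cK KW] [seta eta_ge0 eta1 eta0]]]]] :=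
  chart_plateau Mc oc (@subset_refl _ _) xc.
have su (i : 'I_n) : chart_ext c (codom_chart c) (eta * (fun v => v 0 i)) \in smooth M.
  apply: (chart_ext_smooth Mc oc _ cK KW) => // [k|v _ nKv].
    exact: (Ck_mul oc (seta k) (Ck_coord k i oc)).
  by rewrite fctE /= eta0// mul0r.
pose u i : C := SmoothFun (su i).
pose E i := coord_field Mc cK KW seta eta0 i.
pose N' := dom c `&` coord c @^-1` N.
have oN' : open N' by exact: (open_coord_preim Mc oN).
have uE i v : N v -> u i (param c v) = v 0 i.
  move=> Nv; have [dv vE] := chart_codom Mc (KW _ (NK _ Nv)).
  rewrite /= chart_extE// ?vE; last exact: KW _ (NK _ Nv).
  by rewrite fctE /= eta1// mul1r.
have EE i f y : N' y -> E i f y = 'D_(delta_mx 0 i) (f \o param c) (coord c y).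
  move=> [dy Ny].
  by rewrite -[E i f y]/(coord_field_fun Mc cK KW seta eta0 i f y) coord_field_funE// eta1// mul1r.
have derc (v : 'rV[R]_n) i j : 'D_(delta_mx 0 i) (fun v : 'rV[R]_n => v 0 j : R) v = (i == j)%:R.
  have dv : differentiable (fun v : 'rV[R]_n => v 0 j : R) v by exact: differentiable_coord.
  have -> : (fun v : 'rV[R]_n => v 0 j) = lin_form (fun l => (l == j)%:R).
    apply/funext => z; rewrite /lin_form (bigD1 j)//= eqxx mulr1 big1 ?addr0//.
    by move=> l /negbTE ->; rewrite mulr0.
  have dl : differentiable (lin_form (fun l : 'I_n => (l == j)%:R : R)) v.
    by apply: linear_differentiable; exact: lin_form_continuous.
  rewrite (deriveE _ dl) diff_lin; last exact: lin_form_continuous.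
  rewrite /= /lin_form (bigD1 i)//= mxE !eqxx mul1r big1 ?addr0//.
  by move=> l /negbTE li; rewrite mxE li andbF mul0r.
exists N', E, u; split; last first.
  move=> y y' [dy Ny] [dy' Ny'] uyy'.
  rewrite -[LHS](coordK Mc dy) -[RHS](coordK Mc dy'); congr (param c _).
  apply/rowP => i; have := uyy' i.
  by rewrite -{1}[y](coordK Mc dy) -{1}[y'](coordK Mc dy') !uE.
split=> //.
  move=> y i j N'y; have [dy Ny] := N'y; rewrite EE// -(derc (coord c y) i j).
  apply: near_eq_derive.
  by apply: filterS (open_nbhs_nbhs (conj oN Ny)) => v Nv; exact: uE.
move=> V f y N'y; have [dy Ny] := N'y.
set w := coord c y.
have /smoothP sf := valP f.
have /nbhs_ballP [r /= r0 rN] : nbhs w N by exact: open_nbhs_nbhs.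
have oB : open (ball w r) by exact: ball_open.
have Bc : ball w r `<=` codom_chart c by move=> v /rN /NK /KW.
have sfball : smooth_on (ball w r) (f \o param c).
  by move=> k; apply: Ck_sub Bc _; exact: sf.
pose gm i := ray_mean w 0 (fun v => 'D_(delta_mx 0 i) (f \o param c) v).
have sgm i : smooth_on (ball w r) (gm i).
  by apply: smooth_ray_mean; exact: smooth_derive.
have Bw : ball w r w by exact: ballxx.
have /choice [G HG] : forall i : 'I_n, exists G : C, exists N2 : set 'rV[R]_n,
    [/\ open N2, N2 w, N2 `<=` ball w r & forall v, N2 v -> G (param c v) = gm i v].
  by move=> i; exact: (chart_function Mc oB Bc Bw (sgm i)).
have /choice [N2 HN2] := HG.
(* Near [y] the function [f] is its Hadamard expansion, whose coefficients have been
   extended to global functions. *)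
pose rhs : C := f y *: (1 : C) + \sum_i (u i - (w 0 i) *: (1 : C)) * G i.
have fE : \forall v \near w, ball w r v /\ forall i, N2 i v.
  apply: filterI; first exact: open_nbhs_nbhs.
  apply: (filter_forall (nbhs_filter w)) => i.
  by have [oN2 N2w _ _] := HN2 i; exact: open_nbhs_nbhs.
have [N3 [oN3 N3w] N3P] : exists2 N3, open N3 /\ N3 w & N3 `<=` [set v | ball w r v /\ forall i, N2 i v].
  exists (interior [set v | ball w r v /\ forall i, N2 i v]); last exact: interior_subset.
  by split; [exact: open_interior|exact: fE].
rewrite (@vf_local V f rhs (dom c `&` coord c @^-1` N3))//; first last.
- move=> z [dz N3z]; have [Bz N2z] := N3P _ N3z.
  rewrite [RHS]sfD sfZ mulr1 sf_sum.
  have H := hadamard sfball Bz; rewrite /= !(coordK Mc) // in H; rewrite H {H}.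
  congr (_ + _).
  apply: eq_bigr => i _; rewrite sfM sfB sfZ mulr1.
  have [_ _ _ HGi] := HN2 i.
  have HG2 := HGi _ (N2z i); rewrite (coordK Mc dz) in HG2.
  have uz := uE i _ (rN _ Bz); rewrite (coordK Mc dz) in uz.
  by rewrite HG2 uz.
- exact: (open_coord_preim Mc oN3).
rewrite /rhs vf_add vf_scale vf_one scaler0 add0r vf_sumr sf_sum.
apply: eq_bigr => i _; rewrite vfieldM sfD !sfM sfB sfZ mulr1.
rewrite -{1}(uE i w Ny) (coordK Mc dy) subrr mul0r add0r.
rewrite vf_sub vf_scale vf_one scaler0 subr0 mulrC; congr (_ * _).
apply: etrans (esym (EE i f y N'y)).
have [_ N2w _ HGi] := HN2 i.
by rewrite -[y in LHS](coordK Mc dy) (HGi _ N2w) /gm ray_mean_center.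
Qed.

Lemma local_frame x : exists (N : set X) (E : 'I_n -> VF) (u : 'I_n -> C),
  [/\ open N, N x, forall y i j, N y -> E i (u j) y = (i == j)%:R &
      forall (V : VF) f y, N y -> V f y = \sum_i V (u i) y * E i f y].
Proof. by have [N [E [u []]]] := local_frame_inj x; exists N, E, u. Qed.

End frames.

(** * Alternating multilinear maps *)

Section slots.
Context {A : Type} {p : nat}.
Implicit Types (V : 'I_p -> A) (i j : 'I_p) (U W : A).

Definition upd V i U : 'I_p -> A := fun j => if j == i then U else V j.

Lemma updE V i U : [eta V with i |-> U] = upd V i U :> ('I_p -> A).
Proof. by apply/funext => j /=; rewrite /upd. Qed.

Lemma upd_same V i U : upd V i U i = U. Proof. by rewrite /upd eqxx. Qed.
Lemma upd_other V i j U : j != i -> upd V i U j = V j.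
Proof. by rewrite /upd => /negbTE ->. Qed.
Lemma upd_id V i : upd V i (V i) = V.
Proof. by apply/funext => j; rewrite /upd; case: eqP => // ->. Qed.
Lemma upd_upd V i U W : upd (upd V i U) i W = upd V i W.
Proof. by apply/funext => j; rewrite /upd; case: eqP. Qed.
Lemma updC V i j U W : i != j -> upd (upd V i U) j W = upd (upd V j W) i U.
Proof.
move=> ij; apply/funext => k; rewrite /upd; case: eqP => // ->.
by rewrite eq_sym (negbTE ij).
Qed.

(** Interpolates between two families by replacing the slots one after the other. *)
Definition hyb (m : nat) V V' : 'I_p -> A := fun k => if (k < m)%N then V' k else V k.

Lemma hyb0 V V' : hyb 0 V V' = V. Proof. by []. Qed.
Lemma hybn V V' : hyb p V V' = V'.
Proof. by apply/funext => k; rewrite /hyb ltn_ord. Qed.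
Lemma hybS V V' i : hyb i.+1 V V' = upd (hyb i V V') i (V' i).
Proof.
apply/funext => k; rewrite /hyb /upd ltnS leq_eqVlt -val_eqE /=.
by case: eqP => [/val_inj ->|].
Qed.
Lemma hyb_at V V' i : hyb i V V' i = V i. Proof. by rewrite /hyb ltnn. Qed.

End slots.

Section multilinear.
Context {S : comPzRingType} {A : Type} {p N : nat}.
Variables (w : ('I_p -> A) -> S) (V : 'I_p -> A) (a : 'I_p -> 'I_N -> S) (E : 'I_N -> A).
Hypothesis wE : forall V' k, V' k = V k -> w V' = \sum_i a k i * w (upd V' k (E i)).

Let F := {ffun 'I_p -> 'I_N}.

(** Induction on the number [m] of slots already expanded; the multi-indices are
    frozen at [i0] on the remaining slots. *)
Let partial_expand (i0 : 'I_N) m : (m <= p)%N ->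
  w V = \sum_(I : F | [forall k : 'I_p, (m <= k)%N ==> (I k == i0)])
     (\prod_(k : 'I_p | (k < m)%N) a k (I k)) * w (hyb m V (E \o I)).
Proof.
elim: m => [|m IHm] mp.
  rewrite (big_pred1 [ffun=> i0]); last first.
    move=> I; apply/forallP/eqP => [H|-> k]; last by rewrite ffunE eqxx.
    by apply/ffunP => k; rewrite ffunE; exact/eqP/H.
  by rewrite big_pred0 ?mul1r ?hyb0// => k.
pose k0 : 'I_p := Ordinal mp.
rewrite (IHm (ltnW mp)).
pose up (I : F) i : F := [ffun k => if k == k0 then i else I k].
have E1 (I : F) : w (hyb m V (E \o I)) =
    \sum_i a k0 i * w (hyb m.+1 V (E \o up I i)).
  rewrite (wE (k := k0)); last exact: (hyb_at V _ k0).
  apply: eq_bigr => i _; congr (_ * w _).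
  rewrite -[m.+1]/(k0.+1) hybS /= ffunE eqxx; congr upd.
  apply/funext => k; rewrite /hyb; case: ifP => // km.
  by rewrite /= ffunE; case: eqP => // kk0; move: km; rewrite kk0 ltnn.
rewrite [RHS](partition_big (fun I : F => up I i0)
  (fun I : F => [forall k : 'I_p, (m <= k)%N ==> (I k == i0)])) /=; last first.
  move=> I /forallP H; apply/forallP => k; apply/implyP => mk.
  rewrite ffunE; have [//|kk0] := eqVneq k k0.
  apply: (implyP (H k)); rewrite ltn_neqAle mk andbT.
  by apply: contra kk0 => /eqP mk'; apply/eqP/val_inj.
apply: eq_bigr => I /forallP HI; rewrite E1 mulr_sumr.
rewrite (reindex_onto (fun i => up I i) (fun I' : F => I' k0)) /=; last first.
  move=> I' /andP[_ /eqP <-]; apply/ffunP => k; rewrite !ffunE.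
  by case: eqP => [->|].
rewrite [RHS](eq_bigl xpredT) /=; last first.
  move=> i; rewrite ffunE eqxx eqxx andbT; apply/andP; split.
    apply/forallP => k; apply/implyP => mk; rewrite ffunE; have [kk0|_] := eqVneq k k0.
      by move: mk; rewrite kk0 ltnn.
    by apply: (implyP (HI k)); exact: ltnW.
  apply/eqP/ffunP => k; rewrite !ffunE; have [->|//] := eqVneq k k0.
  by apply/eqP; rewrite eq_sym; apply: (implyP (HI k0)).
apply: eq_bigr => i _; rewrite mulrA; congr (_ * _).
rewrite [RHS](bigD1 k0)//= ffunE eqxx mulrC; congr (_ * _).
apply: eq_big => [k|k km].
  by rewrite ltnS [RHS]andbC -val_eqE /= -ltn_neqAle.
by rewrite ffunE; case: eqP => // kk0; move: km; rewrite kk0 ltnn.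
Qed.

Lemma multilinear_expand :
  w V = \sum_(I : F) (\prod_k a k (I k)) * w (E \o I).
Proof.
have [[i0]|N0] := pselect (inhabited 'I_N).
  rewrite (partial_expand i0 (leqnn p)); apply: eq_big => [I|I _].
    by apply/forallP => k; rewrite leqNgt ltn_ord.
  by rewrite hybn; congr (_ * _); apply: eq_bigl => k; rewrite ltn_ord.
have [[k0]|p0] := pselect (inhabited 'I_p).
  rewrite (wE (k := k0) erefl) big1; last by move=> i; exfalso; apply: N0.
  by rewrite big1// => I; exfalso; apply: N0; constructor; exact: I k0.
have np (k : 'I_p) : False by apply: p0.
pose I0 : F := [ffun k => match np k with end].
rewrite (bigD1 I0)//= [X in _ + X]big1 ?addr0 => [|I /eqP []]; last first.
  by apply/ffunP => k; case: (np k).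
rewrite big1 ?mul1r => [|k]; last by case: (np k).
by congr w; apply/funext => k; case: (np k).
Qed.

End multilinear.

Section forms.
Context {R : realType} {X : topologicalType} {n : nat}.
Variable M : smooth_manifold R X n.
Local Notation C := (smoothfun M).
Local Notation VF := (vfield M).

Section one_form.
Context {p : nat}.
Variable w : cochain M p.
Hypothesis fw : is_form w.
Implicit Types (V : 'I_p -> VF).

Lemma form_lin V i f U W : w (upd V i (f *: U + W)) =
  f * w (upd V i U) + w (upd V i W).
Proof. by have [/(_ V i f U W) + _] := fw; rewrite !updE. Qed.

Lemma form_alt V i j : i != j -> V i = V j -> w V = 0.
Proof. by have [_ H] := fw => ij Vij; apply: H ij Vij. Qed.

Lemma form_add V i U W : w (upd V i (U + W)) = w (upd V i U) + w (upd V i W).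
Proof. by have := form_lin V i 1 U W; rewrite scale1r mul1r. Qed.
Lemma form_0 V i : w (upd V i 0) = 0.
Proof. by apply: (addrI (w (upd V i 0))); rewrite -form_add !addr0. Qed.
Lemma form_scale V i f U : w (upd V i (f *: U)) = f * w (upd V i U).
Proof. by have := form_lin V i f U 0; rewrite form_0 !addr0. Qed.
Lemma form_opp V i U : w (upd V i (- U)) = - w (upd V i U).
Proof. by rewrite -scaleN1r form_scale mulN1r. Qed.
Lemma form_sum V i (I : Type) (r : seq I) (P : pred I) (F : I -> VF) :
  w (upd V i (\sum_(l <- r | P l) F l)) = \sum_(l <- r | P l) w (upd V i (F l)).
Proof. by apply: (big_morph (fun U => w (upd V i U)) (form_add V i) (form_0 V i)). Qed.

(** Expand the vanishing value at [V_i + V_j] placed in both slots. *)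
Lemma form_swap V i j : i != j -> w (V \o tperm i j) = - w V.
Proof.
move=> ij.
have := form_alt (V := upd (upd V i (V i + V j)) j (V i + V j)) ij.
rewrite upd_same (upd_other _ _ ij) upd_same => /(_ erefl).
rewrite form_add (updC _ _ _ ij) form_add (updC _ _ _ ij) form_add.
have ji : j != i by rewrite eq_sym.
rewrite -!(updC _ _ _ ij) !upd_id.
have -> : w (upd V j (V i)) = 0.
  by apply: (form_alt ij); rewrite upd_same (upd_other _ _ ij).
have -> : w (upd (upd V i (V j)) j (V j)) = 0.
  by apply: (form_alt ij); rewrite upd_same (upd_other _ _ ij) upd_same.
rewrite add0r addr0 => /eqP; rewrite addr_eq0 => /eqP H.
have -> : V \o tperm i j = upd (upd V i (V j)) j (V i).
  apply/funext => k; rewrite /upd /=; case: tpermP => [->|->|/eqP/negbTE -> /eqP/negbTE ->] //.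
  - by rewrite (negbTE ij) eqxx.
  - by rewrite eqxx.
exact: H.
Qed.

Lemma form_perm V (s : 'S_p) : w (V \o s) = (-1) ^+ s * w V.
Proof.
have [ts -> dts] := prod_tpermP s.
elim: ts dts V => [_|[i j] ts IHts] /= => [V|/andP[ij dts] V].
  rewrite big_nil odd_perm1 expr0 mul1r; congr w.
  by apply/funext => k /=; rewrite perm1.
rewrite big_cons /= odd_mul_tperm ij signr_addb.
rewrite (_ : V \o _ = (V \o (\prod_(t <- ts) tperm t.1 t.2)%g) \o tperm i j); last first.
  by apply/funext => k /=; rewrite permM.
by rewrite form_swap// IHts// expr1 mulN1r mulNr.
Qed.

(** Repeated indices contribute 0 and permutations their sign, which leaves the
    Leibniz formula. *)
Lemma form_det V (L : 'M[C]_p) :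
  w (fun k => \sum_l L k l *: V l) = \det L * w V.
Proof.
rewrite (multilinear_expand (a := fun k l => L k l) (E := V)); last first.
  move=> V' k V'k; rewrite -{1}(upd_id V' k) V'k form_sum.
  by apply: eq_bigr => l _; rewrite form_scale.
rewrite (bigID (fun f : {ffun 'I_p -> 'I_p} => injectiveb f)) /= addrC big1 ?add0r; last first.
  move=> I /injectivePn [k [l kl Ikl]].
  by rewrite (form_alt kl) ?mulr0//= Ikl.
rewrite (reindex (fun s : 'S_p => val s)) /=; last first.
  have s0 : 'S_p := 1%g; pose uf (f : {ffun 'I_p -> 'I_p}) := if insub f is Some s then s else s0.
  by exists uf => [s _|f Uf]; rewrite /uf; [rewrite valK|rewrite insubT].
rewrite /determinant mulr_suml.
apply: eq_big => [s|s _]; first exact: (valP s).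
have -> : V \o val s = V \o s by apply/funext => k /=; rewrite pvalE.
rewrite form_perm mulrA [X in X * _]mulrC; congr (_ * _ * _).
by apply: eq_bigr => k _; rewrite pvalE.
Qed.

End one_form.
End forms.

(** * Pointwise values of forms, and gradients *)

Section pointwise.
Context {R : realType} {X : topologicalType} {n : nat}.
Variable M : smooth_manifold R X n.
Local Notation C := (smoothfun M).
Local Notation VF := (vfield M).

Definition veq (x : X) (U V : VF) := forall f : C, U f x = V f x.

Lemma sf_glue (f : X -> R) : (forall x, exists (h : C) (U : set X),
  [/\ open U, U x & forall y, U y -> f y = h y]) -> f \in smooth M.
Proof.
move=> Hf; apply: smooth_local => x; have [h [U [oU Ux fh]]] := Hf x.
have [c Mc dx] := atlas_cover M x.
exists c, (codom_chart c `&` param c @^-1` U); split=> //.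
- exact: (open_param_preim Mc oU).
- by split; [exists x|rewrite /= (coordK Mc dx)].
split=> [v []//|k]; have /smoothP sh := valP h.
apply: (Ck_ext (f := h \o param c)); first exact: (open_param_preim Mc oU).
  by move=> v [_ Uv] /=; rewrite fh.
by apply: (Ck_sub _ (sh c Mc k)) => v [].
Qed.

(** Reciprocals exist locally only: a global one would need [d] without zeros. *)
Lemma sf_inv (d : C) x : d x != 0 ->
  exists (e : C) (U : set X), [/\ open U, U x & forall y, U y -> e y * d y = 1].
Proof.
move=> dx0; have [c Mc dx] := atlas_cover M x.
pose A := d @^-1` [set t | t != 0].
have oA : open A.
  apply: open_comp; last exact: open_neq.
  by move=> y _; exact: smooth_continuous.
pose W := codom_chart c `&` param c @^-1` A.
have oW : open W by exact: (open_param_preim Mc oA).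
have Wx : W (coord c x) by split; [exists x|rewrite /= (coordK Mc dx)].
have Wc : W `<=` codom_chart c by move=> v [].
have /smoothP sd := valP d.
have sF : smooth_on W (fun v => (d (param c v))^-1).
  move=> k; apply: (Ck_inv oW); first by move=> v [].
  exact: (Ck_sub Wc (sd c Mc k)).
have [e [N [oN Nx NW eE]]] := chart_function Mc oW Wc Wx sF.
exists e, (dom c `&` coord c @^-1` N); split=> //; first exact: (open_coord_preim Mc oN).
move=> y [dy Ny]; have [_ Ay] := NW _ Ny.
have := eE _ Ny; rewrite /= (coordK Mc dy) => ->.
by rewrite mulVf//; move: Ay; rewrite /= (coordK Mc dy).
Qed.

Section one_form.
Context {p : nat}.
Variable w : cochain M p.
Hypothesis fw : is_form w.

(** The value at [x] of a form only depends on the values at [x] of its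
    arguments: expand in a local frame. *)
Lemma form_point0 (V : 'I_p -> VF) i U x : veq x U 0 -> w (upd V i U) x = 0.
Proof.
move=> U0; have [N [E [u [oN Nx Eu EV]]]] := local_frame M x.
have [b [N' [K [oN' N'x NK [KN cK] [b1 _ b0]]]]] := sf_bump M oN Nx.
have bU : b *: U = \sum_i (b * U (u i)) *: E i.
  apply: vfieldP => f; apply: sfP => y; rewrite vfZ sfM vf_sum sf_sum.
  have [Ky|nKy] := pselect (K y); last first.
    rewrite b0// mul0r big1// => j _.
    by rewrite vfZ !sfM b0// !mul0r.
  rewrite EV ?mulr_sumr; last exact: KN.
  by apply: eq_bigr => j _; rewrite vfZ !sfM mulrA.
have := form_scale fw V i b U; rewrite bU (form_sum fw).
move=> /(congr1 (fun f : C => f x)); rewrite sfM (b1 _ N'x) mul1r => <-.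
rewrite sf_sum big1// => j _.
by rewrite (form_scale fw) !sfM U0 vf0 sf0 mulr0 mul0r.
Qed.

(** Replace the arguments one slot at a time. *)
Lemma form_point (V V' : 'I_p -> VF) x : (forall k, veq x (V k) (V' k)) ->
  w V x = w V' x.
Proof.
move=> VV'.
suff H m : (m <= p)%N -> w (hyb m V V') x = w V x by rewrite -(H p)// hybn.
elim: m => // m IHm mp; pose i : 'I_p := Ordinal mp.
rewrite -[m.+1]/(i.+1) hybS -[V' i](subrK (V i)) (form_add fw) sfD.
rewrite form_point0; last by move=> f; rewrite vfB sfB VV' subrr.
by rewrite add0r -[V i](hyb_at V V' i) upd_id IHm// ltnW.
Qed.

Lemma form_frame (K : nat) (E : 'I_K -> VF) (u : 'I_K -> C) V y :
  (forall (V : VF) f, V f y = \sum_i V (u i) y * E i f y) ->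
  w V y = \sum_(I : {ffun 'I_p -> 'I_K}) (\prod_k V k (u (I k)) y) * w (E \o I) y.
Proof.
move=> EV.
rewrite (@form_point V (fun k => \sum_i V k (u i) *: E i)); last first.
  move=> k f; rewrite EV vf_sum sf_sum; apply: eq_bigr => i _.
  by rewrite vfZ sfM.
rewrite (multilinear_expand (a := fun k l => V k (u l)) (E := E)); last first.
  move=> V' k V'k; rewrite -{1}(upd_id V' k) V'k (form_sum fw).
  by apply: eq_bigr => l _; rewrite (form_scale fw).
by rewrite sf_sum; apply: eq_bigr => I _; rewrite sfM sf_prod.
Qed.

Lemma form_det_at (V : 'I_p -> VF) (L : 'M[R]_p) x :
  w (fun k => \sum_l (L k l *: (1 : C)) *: V l) x = \det L * w V x.
Proof.
have := form_det fw V (map_mx (fun a : R => a *: (1 : C)) L).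
move=> /(congr1 (fun f : C => f x)); rewrite sfM => E.
transitivity (w (fun k => \sum_l map_mx (fun a : R => a *: (1 : C)) L k l *: V l) x).
  by congr (smoothfun_fun (w _) x); apply/funext => k; apply: eq_bigr => l _; rewrite mxE.
rewrite E; congr (_ * _); rewrite /determinant sf_sum; apply: eq_bigr => s _.
rewrite sfM sf_sign sf_prod; congr (_ * _); apply: eq_bigr => i _.
by rewrite mxE sfZ mulr1.
Qed.

End one_form.

Section metric.
Variable g : riemannian_metric M.

(** Seeing [g] as a form of degree 1 in its first argument gives it all pointwise
    properties of forms. *)
Lemma metric_is_form (V : VF) : @is_form _ _ _ M 1 (fun U => g (U ord0) V).
Proof.
split=> [U i f U' W|U i j]; last by rewrite !ord1.
by rewrite !updE ord1 !upd_same metric_linear.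
Qed.

Lemma gD U U' V : g (U + U') V = g U V + g U' V.
Proof. by have := metric_linear g 1 U U' V; rewrite scale1r mul1r. Qed.
Lemma g0 V : g 0 V = 0.
Proof. by apply: (addrI (g 0 V)); rewrite -gD !addr0. Qed.
Lemma gZ f U V : g (f *: U) V = f * g U V.
Proof. by have := metric_linear g f U 0 V; rewrite g0 !addr0. Qed.
Lemma gN U V : g (- U) V = - g U V.
Proof. by rewrite -scaleN1r gZ mulN1r. Qed.
Lemma gB U U' V : g (U - U') V = g U V - g U' V.
Proof. by rewrite gD gN. Qed.
Lemma g_sum (I : Type) (r : seq I) (P : pred I) (F : I -> VF) V :
  g (\sum_(l <- r | P l) F l) V = \sum_(l <- r | P l) g (F l) V.
Proof. exact: (big_morph (fun U => g U V) (fun U U' => gD U U' V) (g0 V)). Qed.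
Lemma gDr U V V' : g U (V + V') = g U V + g U V'.
Proof. by rewrite Defs.metric_sym gD !(Defs.metric_sym g U). Qed.
Lemma gZr f U V : g U (f *: V) = f * g U V.
Proof. by rewrite Defs.metric_sym gZ !(Defs.metric_sym g U). Qed.
Lemma gBr U V V' : g U (V - V') = g U V - g U V'.
Proof. by rewrite Defs.metric_sym gB !(Defs.metric_sym g U). Qed.
Lemma g_sumr (I : Type) (r : seq I) (P : pred I) (F : I -> VF) V :
  g V (\sum_(l <- r | P l) F l) = \sum_(l <- r | P l) g V (F l).
Proof. by rewrite Defs.metric_sym g_sum; apply: eq_bigr => l _; exact: Defs.metric_sym. Qed.

Lemma g_point (U U' V : VF) x : veq x U U' -> g U V x = g U' V x.
Proof.
move=> UU'.
exact: (form_point (metric_is_form V) (V := fun=> U) (V' := fun=> U') (fun=> UU')).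
Qed.

Lemma g_nondeg (U : VF) x : (forall V, g U V x = 0) -> veq x U 0.
Proof. by move=> U0 f; apply: (metric_eq0 (U0 U)). Qed.

(** Gradients exist: in a local frame the Gram matrix is invertible. *)
Lemma grad_local (f : C) x : exists (W : VF) (U : set X),
  [/\ open U, U x & forall y (V : VF), U y -> g W V y = V f y].
Proof.
have [N [E [u [oN Nx Eu EV]]]] := local_frame M x.
pose G : 'M[C]_n := \matrix_(i, j) g (E i) (E j).
pose Gat y : 'M[R]_n := \matrix_(i, j) g (E i) (E j) y.
have detE y : (\det G) y = \det (Gat y).
  rewrite /determinant sf_sum; apply: eq_bigr => s _.
  rewrite sfM sf_sign sf_prod; congr (_ * _).
  by apply: eq_bigr => i _; rewrite !mxE.
have det0 : (\det G) x != 0.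
  rewrite detE; apply/negP => /det0P [a a0 aG].
  move/negP: a0; apply; apply/eqP/rowP => j; rewrite mxE.
  pose W : VF := \sum_i (a 0 i *: (1 : C)) *: E i.
  have gWE k : g W (E k) x = 0.
    transitivity ((a *m Gat x) 0 k); last by rewrite aG mxE.
    rewrite /W g_sum sf_sum mxE; apply: eq_bigr => i _.
    by rewrite gZ sfM sfZ mulr1 mxE.
  have gWW : g W W x = 0.
    rewrite {2}/W g_sumr sf_sum big1// => i _.
    by rewrite gZr sfM gWE mulr0.
  have := metric_eq0 gWW (u j); rewrite /W vf_sum sf_sum => W0; apply: etrans W0; symmetry.
  rewrite (bigD1 j)// vfZ sfM sfZ mulr1 Eu// eqxx mulr1 big1 => [|i ij]; first exact: addr0.
  by rewrite vfZ sfM Eu// (negbTE ij) mulr0.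
have [e [U [oU Ux eU]]] := sf_inv det0.
pose h : 'rV[C]_n := (\row_j E j f) *m (e *: \adj G).
exists (\sum_i h 0 i *: E i), (U `&` N); split; [exact: openI|by []|].
move=> y V [Uy Ny].
have gE k : g (\sum_i h 0 i *: E i) (E k) y = E k f y.
  rewrite g_sum; transitivity ((h *m G) 0 k y).
    rewrite mxE; congr (smoothfun_fun _ y); apply: eq_bigr => i _.
    by rewrite gZ !mxE.
  rewrite /h -mulmxA -scalemxAl mul_adj_mx -scalemxAr mul_mx_scalar scalerA.
  by rewrite !mxE !sfM eU// mul1r.
transitivity (g (\sum_i h 0 i *: E i) (\sum_k V (u k) *: E k) y).
  rewrite Defs.metric_sym [RHS](congr1 (fun f : C => f y) (Defs.metric_sym g _ _)).
  apply: g_point => k; rewrite EV// vf_sum sf_sum.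
  by apply: eq_bigr => i _; rewrite vfZ sfM.
rewrite g_sumr sf_sum EV//; apply: eq_bigr => k _.
by rewrite gZr sfM gE.
Qed.

(** The local gradients agree on overlaps by nondegeneracy, so they define one
    global derivation. *)
Lemma grad_exists (f : C) : exists G : VF, forall V, g G V = V f.
Proof.
have /choice [W HW] := grad_local f.
have /choice [U HU] := HW.
have WE x y k : U x y -> W x k y = W y k y.
  move=> Uxy; apply/subr0_eq; rewrite -sfB -vfB.
  apply: (@g_nondeg (W x - W y) y) => V; rewrite gB sfB.
  have [_ _ ->//] := HU x; have [_ Uyy ->//] := HU y.
  by rewrite subrr.
have sG k : (fun y => W y k y) \in smooth M.
  apply: sf_glue => x; have [oU Ux _] := HU x.
  by exists (W x k), (U x); split=> // y Uy; rewrite WE.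
pose G k : C := SmoothFun (sG k).
have dG : G \in derivation (M := M).
  apply/derivationP; split=> [a f1 f2|f1 f2]; apply: sfP => y.
    by rewrite /G /= vfield_linear.
  by rewrite [LHS](congr1 (fun h : C => h y) (vfieldM (W y) f1 f2)).
exists (VField dG) => V; apply: sfP => y; have [oU Uy HgU] := HU y.
by rewrite -HgU//; apply: g_point.
Qed.

Lemma grad_spec f V : g (grad g f) V = V f.
Proof.
have := xgetPex 0 (grad_exists f).
by move/(_ V).
Qed.

Lemma grad_unique f G : (forall V, g G V = V f) -> grad g f = G.
Proof.
move=> HG; apply/subr0_eq; apply: vfieldP => k; apply: sfP => x.
by apply: (@g_nondeg (grad g f - G) x) => V; rewrite gB grad_spec HG subrr sf0.
Qed.

Lemma grad_lin a f h : grad g (a *: f + h) = (a *: (1 : C)) *: grad g f + grad g h.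
Proof.
apply: grad_unique => V; rewrite gD gZ !grad_spec vfield_linear; congr (_ + _).
by apply: sfP => x; rewrite sfM !sfZ mulr1.
Qed.

Lemma grad_cst a : grad g (a *: (1 : C)) = 0.
Proof. by apply: grad_unique => V; rewrite g0 vf_scale vf_one scaler0. Qed.

Lemma grad_expn f k : grad g (f ^+ k.+1) = (k.+1%:R * f ^+ k) *: grad g f.
Proof. by apply: grad_unique => V; rewrite gZ grad_spec vf_expn. Qed.

Lemma grad_loc (f h : C) (U : set X) x : open U -> U x ->
  (forall y, U y -> f y = h y) -> veq x (grad g f) (grad g h).
Proof.
move=> oU Ux fh k; apply/subr0_eq; rewrite -sfB -vfB.
apply: (@g_nondeg (grad g f - grad g h) x) => V.
by rewrite gB sfB !grad_spec (vf_local V oU Ux fh) subrr.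
Qed.

End metric.
End pointwise.

(** * Orthonormal frames and the first cousin principle *)

(** A Cholesky reduction: a semidefinite matrix with nonzero determinant has a
    positive corner, and eliminating its row and column leaves a matrix of the same
    kind. *)
Lemma psd_reduce (R : realType) m (S : 'M[R]_m) :
  S^T = S -> (forall v : 'rV[R]_m, 0 <= (v *m S *m v^T) 0 0) -> \det S != 0 ->
  exists L : 'M[R]_m, L *m S *m L^T = 1%:M.
Proof.
elim: m S => [|m IHm] S symS posS detS.
  by exists 0; apply/matrixP => -[].
change 'M[R]_(1 + m) in S.
pose a := S 0 0; pose b : 'rV[R]_m := ursubmx S; pose D : 'M[R]_m := drsubmx S.
have SE : S = block_mx a%:M b b^T D.
  rewrite -[LHS]submxK; congr block_mx.
    by rewrite [LHS]mx11_scalar; congr (_%:M); rewrite !mxE /a; congr (S _ _); apply: val_inj.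
  by rewrite /b -[in RHS]symS; apply/matrixP => i j; rewrite !mxE.
have vSv (s : R) (v : 'rV[R]_m) : (row_mx s%:M v *m S *m (row_mx s%:M v)^T) 0 0 =
    s ^+ 2 * a + 2 * s * (v *m b^T) 0 0 + (v *m D *m v^T) 0 0.
  rewrite SE mul_row_block tr_row_mx mul_row_col !mulmxDl.
  rewrite tr_scalar_mx !mul_scalar_mx !mul_mx_scalar.
  have -> : s *: b *m v^T = s *: (v *m b^T)^T by rewrite trmx_mul trmxK scalemxAl.

  by rewrite !mxE /= mulr1n; ring.
have a0 : 0 < a.
  rewrite lt_def; apply/andP; split; last first.
    by have := posS (row_mx 1%:M 0); rewrite vSv !mul0mx !mxE; lra.
  apply/eqP => a0; case/negP: detS.
  have b0 (v : 'rV[R]_m) : (v *m b^T) 0 0 = 0.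
    set t := (v *m b^T) 0 0; set d := (v *m D *m v^T) 0 0.
    have d0 : 0 <= d by have := posS (row_mx 0%:M v); rewrite vSv -/t -/d; lra.
    have := posS (row_mx (- (d + 1) / (2 * t))%:M v); rewrite vSv -/t -/d a0.
    have [//|t0] := eqVneq t 0.
    have -> : (- (d + 1) / (2 * t)) ^+ 2 * 0 + 2 * (- (d + 1) / (2 * t)) * t + d = -1.
      by field.
    by rewrite oppr_ge0 ler10.
  have bE : b = 0.
    apply/rowP => j; rewrite mxE; have := b0 (delta_mx 0 j).
    by rewrite -rowE !mxE.
  apply/det0P; exists (delta_mx 0 0).
    by apply/eqP => /rowP /(_ 0); rewrite !mxE eqxx /= => /eqP; rewrite oner_eq0.
  rewrite -rowE; apply/rowP => j; rewrite SE bE a0 !mxE.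
  by case: splitP => k; rewrite !mxE; case: splitP => l; rewrite !mxE ?mul0rn ?mxE.
pose l : 'M[R]_(1 + m) := block_mx 1%:M 0 (- a^-1 *: b^T) 1%:M.
pose D' : 'M[R]_m := D - a^-1 *: (b^T *m b).
have an0 : a != 0 by rewrite gt_eqF.
have lSl : l *m S *m l^T = block_mx a%:M 0 0 D'.
  pose cc : 'cV[R]_m := - a^-1 *: b^T.
  have ca : cc *m a%:M + b^T = 0.
    by rewrite mul_mx_scalar /cc scalerA mulrN divff// scaleN1r addNr.
  have ac : a%:M *m cc^T + b = 0.
    by rewrite mul_scalar_mx /cc linearZ /= trmxK scalerA mulrN divff// scaleN1r addNr.
  rewrite SE /l -/cc tr_block_mx !mulmx_block !trmx0 !trmx1.
  rewrite !mul1mx !mul0mx !mulmx1 !mulmx0 !addr0 ca ac mul0mx add0r.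
  by rewrite /cc -scalemxAl scaleNr addrC.
have symD : D'^T = D'.
  rewrite /D' linearB linearZ /= trmx_mul trmxK; congr (_ - _).
  by rewrite /D -[in RHS]symS; apply/matrixP => i j; rewrite !mxE.
have posD (v : 'rV[R]_m) : 0 <= (v *m D' *m v^T) 0 0.
  have := posS (row_mx (- a^-1 * (v *m b^T) 0 0)%:M v); rewrite vSv.
  have -> : (v *m D' *m v^T) 0 0 = (v *m D *m v^T) 0 0 - a^-1 * ((v *m b^T) 0 0) ^+ 2.
    have E : v *m (b^T *m b) *m v^T = (v *m b^T) *m (v *m b^T)^T.
      by rewrite trmx_mul trmxK !mulmxA.
    rewrite /D' mulmxBr mulmxBl -scalemxAr -scalemxAl E.
    move: (v *m b^T) (v *m D *m v^T) => y1 y2.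
    by rewrite !mxE big_ord1 !mxE !ord1; ring.
  congr (0 <= _); field.
  exact: an0.
have detl : \det l = 1 by rewrite /l det_lblock !det1 mulr1.
have detD : \det D' != 0.
  have : \det (l *m S *m l^T) != 0 by rewrite !det_mulmx det_tr detl mul1r mulr1.
  by rewrite lSl det_ublock det_scalar1 mulf_eq0 negb_or => /andP[].
have [L' HL'] := IHm D' symD posD detD.
pose K : 'M[R]_(1 + m) := block_mx (Num.sqrt a)^-1%:M 0 0 L'.
exists (K *m l).
have -> : (K *m l) *m S *m (K *m l)^T = K *m (l *m S *m l^T) *m K^T.
  by rewrite trmx_mul !mulmxA.
rewrite lSl /K tr_block_mx !mulmx_block !trmx0 tr_scalar_mx.
rewrite !(mul0mx, mulmx0, addr0, add0r) HL'.
rewrite -!scalar_mxM.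
have -> : (Num.sqrt a)^-1 * a * (Num.sqrt a)^-1 = 1.
  rewrite -[X in _ * X * _](sqr_sqrtr (ltW a0)) expr2; field.
  by rewrite gt_eqF// sqrtr_gt0.
exact: (esym (scalar_mx_block 1 m 1)).
Qed.

Section planes.
Context {R : realType} {X : topologicalType} {n : nat}.
Variable M : smooth_manifold R X n.
Variable g : riemannian_metric M.
Local Notation C := (smoothfun M).
Local Notation VF := (vfield M).

Definition orthonormal_at p (x : X) (V : 'I_p -> VF) :=
  forall k l, g (V k) (V l) x = (k == l)%:R.

Lemma gram_lc p (V : 'I_p -> VF) (L : 'M[R]_p) x k l :
  g (\sum_i (L k i *: (1 : C)) *: V i) (\sum_j (L l j *: (1 : C)) *: V j) x =
  (L *m (\matrix_(i < p, j < p) g (V i) (V j) x) *m L^T) k l.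
Proof.
rewrite g_sum sf_sum -mulmxA mxE; apply: eq_bigr => i _.
rewrite gZ sfM sfZ mulr1 mxE; congr (_ * _).
rewrite g_sumr sf_sum; apply: eq_bigr => j _.
by rewrite gZr sfM sfZ mulr1 !mxE mulrC.
Qed.

(** A change of basis that makes the Gram matrix trivial has determinant 1 or -1;
    after correcting the sign it preserves the values of all forms, by [form_det]. *)
Lemma orthonormalize p x (V : 'I_p.+1 -> VF) : unit_simple g x V ->
  exists V' : 'I_p.+1 -> VF, orthonormal_at x V' /\
    forall w : cochain M p.+1, is_form w -> w V' x = w V x.
Proof.
rewrite /unit_simple; set S := \matrix_(i, j) _ => detS.
have symS : S^T = S by apply/matrixP => i j; rewrite !mxE Defs.metric_sym.
have posS (v : 'rV[R]_p.+1) : 0 <= (v *m S *m v^T) 0 0.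
  have := metric_ge0 g (\sum_i (v 0 i *: (1 : C)) *: V i) x.
  congr (0 <= _).
  rewrite g_sum sf_sum -mulmxA mxE; apply: eq_bigr => i _.
  rewrite gZ sfM sfZ mulr1 mxE; congr (_ * _).
  rewrite g_sumr sf_sum; apply: eq_bigr => j _.
  by rewrite gZr sfM sfZ mulr1 !mxE mulrC.
have [|L HL] := psd_reduce symS posS; first by rewrite detS oner_eq0.
have detL : \det L = 1 \/ \det L = -1.
  have := congr1 determinant HL; rewrite !det_mulmx det_tr detS det1 mulr1 -expr2.
  by move/eqP; rewrite sqrf_eq1 => /orP[] /eqP ->; [left|right].
have [L' [HL' detL']] : exists L' : 'M[R]_p.+1, L' *m S *m L'^T = 1%:M /\ \det L' = 1.
  case: detL => detL; first by exists L.
  (* Reversing the first vector changes the sign of the determinant. *)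
  pose s : 'rV[R]_p.+1 := \row_i (if i == 0 then -1 else 1).
  pose D := diag_mx s.
  have DD : D *m D = 1%:M.
    rewrite /D mulmx_diag; apply/matrixP => i j; rewrite !mxE.
    by congr (_ *+ _); case: ifP => _; rewrite ?mulrNN mulr1.
  exists (D *m L); split.
    have -> : (D *m L) *m S *m (D *m L)^T = D *m (L *m S *m L^T) *m D^T.
      by rewrite trmx_mul !mulmxA.
    by rewrite HL mulmx1 tr_diag_mx.
  rewrite det_mulmx detL det_diag (bigD1 0)//= mxE eqxx big1 => [|i /negbTE i0].
    by rewrite mulr1 mulrNN mulr1.
  by rewrite mxE i0.
exists (fun k => \sum_l (L' k l *: (1 : C)) *: V l); split.
  by move=> k l; rewrite gram_lc HL' mxE.
by move=> w fw; rewrite form_det_at// detL' mul1r.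
Qed.

Lemma orthonormal_unit p x (V : 'I_p -> VF) : orthonormal_at x V -> unit_simple g x V.
Proof.
move=> oV; rewrite /unit_simple.
have -> : \matrix_(i < p, j < p) g (V i) (V j) x = 1%:M.
  by apply/matrixP => i j; rewrite !mxE oV.
exact: det1.
Qed.

(** The calibration bounds [phi] by 1 on the orthonormal frames obtained by rotating
    [V_i] towards a normal direction, with equality at [V]: the derivative in that
    direction must vanish, and only the component of [W] along [V_i] contributes. *)
Lemma first_cousin p (phi : cochain M p) x (V : 'I_p -> VF) i (W : VF) :
  calibration g phi -> orthonormal_at x V -> phi V x = 1 ->
  phi (upd V i W) x = g W (V i) x.
Proof.
move=> [fphi _ phi1] oV phiV.
pose W0 : VF := W - \sum_k (g W (V k) x *: (1 : C)) *: V k.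
have W0V k : g W0 (V k) x = 0.
  rewrite /W0 gB g_sum sfB sf_sum (bigD1 k)// gZ sfM sfZ mulr1 oV eqxx mulr1.
  rewrite big1 => [|l lk]; first by apply/eqP; rewrite subr_eq0 eq_sym; apply/eqP/addr0.
  by rewrite gZ sfM oV (negbTE lk) mulr0.
set c := phi (upd V i W0) x.
suff c0 : c = 0.
  rewrite -[W](subrK (\sum_k (g W (V k) x *: (1 : C)) *: V k)) -/W0.
  rewrite (form_add fphi) sfD -/c c0 add0r (form_sum fphi) sf_sum.
  rewrite (bigD1 i)// (form_scale fphi) sfM sfZ mulr1 upd_id phiV mulr1.
  rewrite big1 => [|l li]; last first.
    rewrite (form_scale fphi) sfM (form_alt fphi (V := upd V i (V l)) li) ?mulr0//.
    by rewrite upd_same upd_other.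
  rewrite gD sfD W0V add0r g_sum sf_sum (bigD1 i)// gZ sfM sfZ mulr1 oV eqxx mulr1.
  by congr (_ + _); rewrite big1// => l li; rewrite gZ sfM oV (negbTE li) mulr0.
clearbody W0; set q := g W0 W0 x.
have q0 : 0 <= q by exact: metric_ge0.
apply/eqP; apply/negPn/negP => cn0.
(* Rotating by the angle of tangent [t] would increase [phi] beyond 1: any [t]
   between 0 and [2 c / q] does. *)
pose t := c / (q + 1).
pose r := Num.sqrt (1 + t ^+ 2 * q).
have r0 : 0 < r by rewrite sqrtr_gt0 ltr_wpDr// mulr_ge0// sqr_ge0.
have rr : r ^+ 2 = 1 + t ^+ 2 * q by rewrite sqr_sqrtr// addr_ge0// mulr_ge0// sqr_ge0.
pose U : VF := (r^-1 *: (1 : C)) *: (V i + (t *: (1 : C)) *: W0).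
have gUk k : k != i -> g U (V k) x = 0.
  move=> ki; rewrite /U gZ gD gZ sfM sfD sfM W0V oV eq_sym (negbTE ki).
  by rewrite mulr0 addr0 mulr0.
have gUU : g U U x = 1.
  rewrite /U !(gZ, gZr, gD, gDr) !(sfM, sfD, sfZ, sf1) oV eqxx W0V.
  rewrite (congr1 (fun f : C => f x) (Defs.metric_sym g (V i) W0)) W0V -/q.
  have : r^-1 ^+ 2 * r ^+ 2 = 1 by rewrite -exprMn mulVf ?expr1n ?gt_eqF.
  by rewrite rr => H; apply: etrans _ H; rewrite !mulr1n; ring.
have oU : orthonormal_at x (upd V i U).
  move=> k l; have [->|ki] := eqVneq k i.
    rewrite upd_same; have [->|li] := eqVneq l i; first by rewrite upd_same.
    by rewrite upd_other// gUk.
  rewrite (upd_other _ _ ki); have [->|li] := eqVneq l i.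
    by rewrite upd_same Defs.metric_sym gUk// (negbTE ki).
  by rewrite (upd_other _ _ li) oV.
have := phi1 x _ (orthonormal_unit oU).
rewrite /U (form_scale fphi) sfM sfZ mulr1 (form_add fphi) sfD upd_id phiV.
rewrite (form_scale fphi) sfM sfZ mulr1 -/c ler_pdivrMl// mulr1.
have tc0 : 0 <= 1 + t * c.
  by rewrite addr_ge0// /t mulrAC divr_ge0// ?addr_ge0// -expr2 sqr_ge0.
move=> H.
have : (1 + t * c) ^+ 2 <= r ^+ 2 by rewrite ler_pXn2r// nnegrE// ltW.
rewrite rr leNgt => /negP; apply.
have c2 : 0 < c ^+ 2 by rewrite lt_def sqrf_eq0 cn0 sqr_ge0.
have q1 : 0 < q + 1 by lra.
have -> : (1 + t * c) ^+ 2 = 1 + t ^+ 2 * q + (c ^+ 2 * (q + 2 + c ^+ 2)) / (q + 1) ^+ 2.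
  by rewrite /t; field; rewrite gt_eqF.
by rewrite ltrDl divr_gt0 ?exprn_gt0// mulr_gt0//; lra.
Qed.

End planes.

(** * The operator dd^phi of a parallel form *)

Section hessian.
Context {R : realType} {X : topologicalType} {n : nat}.
Variable M : smooth_manifold R X n.
Variable g : riemannian_metric M.
Local Notation C := (smoothfun M).
Local Notation VF := (vfield M).

Lemma sf_nat m x : (m%:R : C) x = m%:R.
Proof. by elim: m => // m IHm; rewrite !mulrS sfD IHm. Qed.

Definition ins p (U : VF) (V : 'I_p -> VF) : 'I_p.+1 -> VF :=
  fun i => if unlift ord0 i is Some j then V j else U.

Lemma ins0 p U (V : 'I_p -> VF) : ins U V ord0 = U.
Proof. by rewrite /ins unlift_none. Qed.
Lemma insS p U (V : 'I_p -> VF) k : ins U V (lift ord0 k) = V k.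
Proof. by rewrite /ins liftK. Qed.

Lemma ins_upd0 p U U' (V : 'I_p -> VF) : upd (ins U V) ord0 U' = ins U' V.
Proof.
apply/funext => i; have [j ->|->] := unliftP ord0 i.
  by rewrite upd_other ?insS// eq_sym neq_lift.
by rewrite upd_same ins0.
Qed.

Lemma ins_updS p U U' (V : 'I_p -> VF) k :
  upd (ins U V) (lift ord0 k) U' = ins U (upd V k U').
Proof.
apply/funext => i; have [j ->|->] := unliftP ord0 i; last first.
  by rewrite upd_other ?neq_lift// !ins0.
rewrite insS; have [->|jk] := eqVneq j k; first by rewrite !upd_same.
by rewrite !upd_other ?insS// (inj_eq lift_inj).
Qed.

Lemma contract_form p U (w : cochain M p.+1) : is_form w -> is_form (Defs.contract U w).
Proof.
move=> fw; split=> [V i f U' W|V i j ij Vij].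
  rewrite !updE /Defs.contract -!/(ins U _) -!ins_updS.
  exact: form_lin.
apply: (form_alt fw (V := ins U V) (i := lift ord0 i) (j := lift ord0 j)).
  by rewrite (inj_eq lift_inj).
by rewrite !insS.
Qed.

(** The permutation that moves slot [i] to the front has sign [(-1) ^ i]. *)
Lemma form_ins p (w : cochain M p.+1) (V : 'I_p.+1 -> VF) i W : is_form w ->
  w (upd V i W) = (-1) ^+ i * w (ins W (V \o lift i)).
Proof.
move=> fw; have -> : upd V i W = ins W (V \o lift i) \o lift_perm i ord0 1%g.
  apply/funext => k; have [j ->|->] := unliftP i k => /=.
    by rewrite lift_perm_lift perm1 insS upd_other// eq_sym neq_lift.
  by rewrite lift_perm_id ins0 upd_same.
rewrite form_perm//; congr (_ * _).
by rewrite odd_lift_perm odd_perm1 /= !addbF signr_odd.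
Qed.

(** Moving an argument from slot [k] to slot [i] crosses [k - i] others. *)
Lemma form_move p (w : cochain M p.+1) (V : 'I_p.+2 -> VF) (i k : 'I_p.+1) (W : VF)
    (a b : 'I_p.+2) : is_form w -> (i <= k)%N -> a = i :> nat -> b = k.+1 :> nat ->
  w (upd (V \o lift a) k W) = (-1) ^+ (k + i) * w (upd (V \o lift b) i W).
Proof.
move=> fw ik ai bk.
have -> : upd (V \o lift a) k W = upd (V \o lift b) i W \o lift_perm k i 1%g.
  apply/funext => m; have [j ->|->] := unliftP k m => /=; last first.
    by rewrite lift_perm_id !upd_same.
  rewrite lift_perm_lift perm1.
  rewrite [LHS]upd_other; last by rewrite eq_sym neq_lift.
  rewrite [RHS]upd_other; last by rewrite eq_sym neq_lift.
  congr V; apply: val_inj; rewrite /= ai bk /bump.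
  have [kj|kj] := leqP k j.
    have ij : (i <= j)%N by exact: leq_trans kj.
    have h1 : (i <= 1 + j)%N by exact: leqW.
    have h2 : (k.+1 <= 1 + j)%N by rewrite add1n.
    by rewrite ij h1 h2.
  rewrite !add0n; have [ij|ij] := leqP i j; last first.
    by rewrite [(k < _)%N]ltnNge ltnW//= ltnW.
  by rewrite [(k < _)%N]ltnNge add1n kj.
rewrite form_perm//; congr (_ * _).
by rewrite odd_lift_perm odd_perm1 addbF signr_addb !signr_odd exprD.
Qed.

(** In Koszul's formula each pair [i < j] contributes twice through covariant
    derivatives and once through the bracket; a torsion-free connection makes the
    three terms cancel. *)
Lemma torsion_cancel p (w : cochain M p) (V : 'I_p.+1 -> VF) (B : VF -> VF -> VF) :
  is_form w -> (forall U W, B U W - B W U = lie U W) ->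
  \sum_(i < p.+1) (-1) ^+ i * (\sum_(k < p) w (upd (V \o lift i) k (B (V i) (V (lift i k))))) +
  \sum_(j < p.+1) \sum_(i < p | (i < j)%N)
     (-1) ^+ j * w (upd (V \o lift j) i (lie (V (lift j i)) (V j))) = 0.
Proof.
case: p w V => [|p] w V fw HB.
  rewrite big1 => [|i _]; last by rewrite big_ord0 mulr0.
  by rewrite add0r big1// => j _; rewrite big1// => -[].
pose T (q : 'I_p.+2 * 'I_p.+1) := (-1) ^+ q.1 * w (upd (V \o lift q.1) q.2 (B (V q.1) (V (lift q.1 q.2)))).
pose S (q : 'I_p.+2 * 'I_p.+1) := (-1) ^+ q.1 * w (upd (V \o lift q.1) q.2 (B (V (lift q.1 q.2)) (V q.1))).
have -> : \sum_(i < p.+2) (-1) ^+ i * (\sum_(k < p.+1) w (upd (V \o lift i) k (B (V i) (V (lift i k))))) =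
    \sum_q T q.
  rewrite -(pair_big xpredT xpredT (fun i k => T (i, k))) /=.
  by apply: eq_bigr => i _; rewrite mulr_sumr.
have -> : \sum_(j < p.+2) \sum_(i < p.+1 | (i < j)%N)
     (-1) ^+ j * w (upd (V \o lift j) i (lie (V (lift j i)) (V j))) =
    \sum_(q : 'I_p.+2 * 'I_p.+1 | (q.2 < q.1)%N) (S q - T q).
  rewrite -(pair_big_dep xpredT (fun (j : 'I_p.+2) (i : 'I_p.+1) => (i < j)%N)
    (fun i k => S (i, k) - T (i, k))) /=.
  apply: eq_bigr => j _; apply: eq_bigr => i _.
  by rewrite -HB (form_add fw) (form_opp fw) mulrBr.
rewrite (bigID (fun q : 'I_p.+2 * 'I_p.+1 => (q.2 < q.1)%N)) /= sumrB.
have E (x y z : C) : x + y + (z - x) = y + z.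
  by rewrite (addrC x) -addrA (addrC z) addNKr.
rewrite E {E}.
rewrite [X in _ + X](reindex_onto (fun q : 'I_p.+2 * 'I_p.+1 => (lift ord0 q.2, inord q.1 : 'I_p.+1))
  (fun q : 'I_p.+2 * 'I_p.+1 => (widen_ord (leqnSn _) q.2, inord q.1.-1 : 'I_p.+1))) /=; last first.
  move=> [j i] /= ij; congr (_, _); apply: val_inj => /=.
    have j0 : (0 < j)%N := leq_ltn_trans (leq0n i) ij.
    have jp : (j.-1 < p.+1)%N by have := ltn_ord j; rewrite -{1}(prednK j0) ltnS.
    by rewrite inordK// /bump /= add1n prednK.
  by rewrite inordK.
rewrite [X in _ + X](eq_bigl (fun q : 'I_p.+2 * 'I_p.+1 => ~~ (q.2 < q.1)%N)); last first.
  move=> [i k] /=; rewrite -leqNgt; apply/idP/idP => [/andP[H1 /eqP[E1 E2]]|ik].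
    have E1' : (inord i : 'I_p.+1) = i :> nat := congr1 val E1.
    by move: H1; rewrite /= /bump /= add1n ltnS E1'.
  have ip : (i < p.+1)%N by exact: leq_ltn_trans ik (ltn_ord k).
  apply/andP; split; first by rewrite inordK// /bump /= add1n ltnS.
  by apply/eqP; congr (_, _); apply: val_inj; rewrite /= ?inordK ?add1n //= ltn_ord.
rewrite -big_split /= big1// => -[i k] /=; rewrite -leqNgt => ik.
have ip : (i < p.+1)%N by exact: leq_ltn_trans ik (ltn_ord k).
pose i' : 'I_p.+1 := inord i.
have i'E : i' = i :> nat by rewrite inordK.
rewrite /S /T /= -/i'.
have li : lift (lift ord0 k) i' = i.
  by apply: val_inj; rewrite /= /bump i'E /= add1n ltnNge ik.
have lk : lift i k = lift ord0 k.
  by apply: val_inj; rewrite /= /bump ik.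
rewrite li lk (form_move (i := i') (b := lift ord0 k) _ _ fw)//; last by rewrite i'E.
rewrite mulrA i'E -exprD /bump /= add1n.
rewrite addnC -addnA addnn exprD -muln2 exprM.
by rewrite sqrr_sign mulr1 exprS mulN1r mulNr addrC addNr.
Qed.

Variables (p : nat) (phi : cochain M p.+1) (nabla : VF -> VF -> VF).
Hypotheses (fphi : is_form phi) (LC : levi_civita g nabla).
Hypothesis par : forall (U : VF) (V : 'I_p.+1 -> VF),
  U (phi V) = \sum_(i < p.+1) phi [eta V with i |-> nabla U (V i)].

Definition hess (f : C) (V : 'I_p.+1 -> VF) : C :=
  \sum_i phi (upd V i (nabla (V i) (grad g f))).

(** For parallel [phi] the second-order operator is the Hessian, acting as a
    derivation on the tangent vector: the terms with covariant derivatives of the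
    arguments cancel against the brackets because the connection is torsion free. *)
Lemma ddphiE f V : ddphi g phi f V = hess f V.
Proof.
have [_ _ _ tors _] := LC.
rewrite /ddphi /dphi /extd.
set G := grad g f.
have fc := contract_form G fphi.
have E i : V i (Defs.contract G phi (V \o lift i)) =
    phi (ins (nabla (V i) G) (V \o lift i)) +
    \sum_(k < p) Defs.contract G phi (upd (V \o lift i) k (nabla (V i) (V (lift i k)))).
  rewrite -[Defs.contract G phi _]/(phi (ins G _)) par big_ord_recl updE ins0 ins_upd0.
  by congr (_ + _); apply: eq_bigr => k _; rewrite updE insS ins_updS.
under eq_bigr do rewrite E mulrDr.
rewrite big_split /= -addrA.
have -> : \sum_(j < p.+1) \sum_(i < p | (i < j)%N) (-1) ^+ j *
     Defs.contract G phi [eta V \o lift j with i |-> lie (V (lift j i)) (V j)] =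
   \sum_(j < p.+1) \sum_(i < p | (i < j)%N) (-1) ^+ j *
     Defs.contract G phi (upd (V \o lift j) i (lie (V (lift j i)) (V j))).
  by apply: eq_bigr => j _; apply: eq_bigr => i _; rewrite updE.
rewrite (torsion_cancel V fc tors) addr0; apply: eq_bigr => i _.
by rewrite form_ins.
Qed.

Lemma nabla0 U : nabla U 0 = 0.
Proof.
have [_ nD _ _ _] := LC.
by apply: (addrI (nabla U 0)); rewrite -nD !addr0.
Qed.

Lemma ddphi_form f : is_form (ddphi g phi f).
Proof.
have [nl nD nZ _ _] := LC.
split=> [V i h U W|V a b ab Vab]; rewrite ?updE !ddphiE /hess.
  rewrite mulr_sumr -big_split /=; apply: eq_bigr => j _.
  have [->|ji] := eqVneq j i.
    by rewrite !upd_same !upd_upd nl form_lin.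
  have ij : i != j by rewrite eq_sym.
  by rewrite !(upd_other _ _ ji) !(updC _ _ _ ij) form_lin.
rewrite (bigD1 a)// (bigD1 b) 1?eq_sym//= big1 => [|i /andP[ia ib]]; last first.
  by apply: (form_alt fphi ab); rewrite !upd_other// eq_sym.
rewrite addr0 -Vab; set A := nabla _ _.
have -> : upd V b A = upd V a A \o tperm a b.
  apply/funext => k /=; case: tpermP => [->|->|ka kb].
  - by rewrite !upd_other// eq_sym.
  - by rewrite !upd_same.
  - by rewrite !upd_other//; apply/eqP.
by rewrite form_swap// addrN.
Qed.

Lemma ddphi_lin (a : R) f h V :
  ddphi g phi (a *: f + h) V = a *: ddphi g phi f V + ddphi g phi h V.
Proof.
have [_ nD nZ _ _] := LC.
rewrite !ddphiE /hess scaler_sumr -big_split; apply: eq_bigr => i _ /=.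
rewrite grad_lin nD nZ vf_scale vf_one scaler0 scale0r add0r form_lin//.
by congr (_ + _); apply: sfP => x; rewrite sfM !sfZ mulr1.
Qed.

Lemma ddphi_cst (a : R) V : ddphi g phi (a *: (1 : C)) V = 0.
Proof.
rewrite ddphiE /hess grad_cst big1// => i _.
by rewrite nabla0 form_0.
Qed.

(** The two gradients coincide near [x]; the connection, being linear over functions
    up to derivatives of the coefficient, only sees them there. *)
Lemma ddphi_loc (f h : C) (U : set X) x V : open U -> U x ->
  (forall y, U y -> f y = h y) -> ddphi g phi f V x = ddphi g phi h V x.
Proof.
move=> oU Ux fh; have [_ nD nZ _ _] := LC.
rewrite !ddphiE /hess !sf_sum; apply: eq_bigr => i _.
apply: form_point => // k; rewrite /upd; case: eqP => // _ q.
set G := grad g f; set H := grad g h.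
have GH y : U y -> veq y G H by move=> Uy; apply: grad_loc oU Uy fh.
have [b [N [K [oN Nx NK [KU cK] [b1 _ b0]]]]] := sf_bump M oU Ux.
have bGH : b *: G = b *: H.
  apply: vfieldP => f'; apply: sfP => y; rewrite !vfZ !sfM.
  have [Ky|nKy] := pselect (K y); first by rewrite GH//; exact: KU.
  by rewrite b0// !mul0r.
have := congr1 (fun W : VF => W q x) (congr1 (nabla (V i)) bGH).
by rewrite /= !nZ !vfD !sfD !vfZ !sfM GH// (b1 _ Nx) !mul1r => /addrI.
Qed.

(** The Hessian of [f ^ k] is the multiple of that of [f] plus a term
    [df * grad f]; on a phi-plane the first cousin principle turns the latter into
    the sum of the squares of [V_i f]. *)
Lemma ddphi_expn (f : C) k V x : calibration g phi -> orthonormal_at g x V ->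
  phi V x = 1 -> 0 <= f x ->
  k.+2%:R * f x ^+ k.+1 * ddphi g phi f V x <= ddphi g phi (f ^+ k.+2) V x.
Proof.
move=> cal oV phiV fx0; have [_ nD nZ _ _] := LC.
rewrite !ddphiE /hess !sf_sum grad_expn.
set q : C := k.+2%:R * f ^+ k.+1.
have qx : q x = k.+2%:R * f x ^+ k.+1 by rewrite /q sfM sfX sf_nat.
have Vq i : V i q = (k.+2%:R * k.+1%:R * f ^+ k) * V i f.
  have nat0 : V i k.+2%:R = 0.
    apply: sfP => y; apply: (@vf_cst _ _ _ _ _ _ k.+2%:R setT) => //; first exact: openT.
    by move=> z _; exact: sf_nat.
  by rewrite /q vfieldM nat0 mulr0 addr0 vf_expn !mulrA.
clearbody q; rewrite mulr_sumr; apply: ler_sum => i _.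
rewrite nZ form_lin// form_scale// sfD !sfM qx lerDr.
rewrite (first_cousin _ _ cal oV phiV) grad_spec Vq sfM -mulrA mulr_ge0//; last first.
  by rewrite -expr2 sqr_ge0.
by rewrite !sfM !sf_nat sfX !mulr_ge0// exprn_ge0.
Qed.

End hessian.

(** * Compactness of the planes over a compact set *)

Section finite_frame.
Context {R : realType} {X : ptopologicalType} {n : nat}.
Variable M : smooth_manifold R X n.
Local Notation C := (smoothfun M).
Local Notation VF := (vfield M).

Definition catf T K1 K2 (f : 'I_K1 -> T) (h : 'I_K2 -> T) (l : 'I_(K1 + K2)) : T :=
  match fintype.split l with inl a => f a | inr b => h b end.

Lemma catfl T K1 K2 (f : 'I_K1 -> T) (h : 'I_K2 -> T) l : catf f h (lshift K2 l) = f l.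
Proof. by rewrite /catf -[lshift K2 l]/(unsplit (inl l)) unsplitK. Qed.
Lemma catfr T K1 K2 (f : 'I_K1 -> T) (h : 'I_K2 -> T) l : catf f h (rshift K1 l) = h l.
Proof. by rewrite /catf -[rshift K1 l]/(unsplit (inr l)) unsplitK. Qed.

(** The frame is allowed to be overcomplete, which lets frames of finitely many
    pieces be concatenated; the functions [s] separate points of [S] and serve as
    an embedding. *)
Definition framed (S : set X) := exists (K N : nat) (E : 'I_K -> VF) (u : 'I_K -> C)
    (b : C) (s : 'I_N -> C),
  [/\ forall (V : VF) f, b * V f = \sum_l V (u l) * E l f,
      forall y, S y -> b y = 1 &
      forall y y', S y -> (forall l, s l y = s l y') -> y = y'].

Lemma framed0 : framed set0.
Proof.
exists 0%N, 0%N, (fun=> 0), (fun=> 0), 0, (fun=> 0); split=> //.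
by move=> V f; rewrite mul0r big_ord0.
Qed.

(** Concatenate the two frames, the second one cut off by [1 - b1] so that together
    they represent vector fields with coefficient [b1 + (1 - b1) * b2]. *)
Lemma framedU S1 S2 : framed S1 -> framed S2 -> framed (S1 `|` S2).
Proof.
move=> [K1 [N1 [E1 [u1 [b1 [s1 [H1 b11 sep1]]]]]]] [K2 [N2 [E2 [u2 [b2 [s2 [H2 b21 sep2]]]]]]].
exists (K1 + K2)%N, (N1 + N2)%N, (catf E1 (fun l => (1 - b1) *: E2 l)), (catf u1 u2),
  (b1 + (1 - b1) * b2), (catf s1 s2); split.
- move=> V f; rewrite big_split_ord /= mulrDl -mulrA H1 H2; congr (_ + _).
    by apply: eq_bigr => l _; rewrite !catfl.
  rewrite mulr_sumr; apply: eq_bigr => l _; rewrite !catfr vfZ.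
  by rewrite mulrCA.
- move=> y [/b11|/b21] E; rewrite sfD sfM sfB sf1 E; first by rewrite subrr mul0r addr0.
  by rewrite mulr1 addrC subrK.
- move=> y y' [S1y|S2y] yy'.
    by apply: sep1 => // l; have := yy' (lshift _ l); rewrite !catfl.
  by apply: sep2 => // l; have := yy' (rshift _ l); rewrite !catfr.
Qed.

(** Adding the bump function itself to the coordinates separates the points near [x]
    from those far away. *)
Lemma framed_near x : exists2 U, open U /\ U x & framed U.
Proof.
have [N [E [u [[oN Nx Eu EV] inj]]]] := local_frame_inj M x.
have [b [N' [K [oN' N'x NK [KN cK] [b1 _ b0]]]]] := sf_bump M oN Nx.
exists N'; first by split.
exists n, n.+1, (fun l => b *: E l), u, b, (fun l => if unlift ord0 l is Some j then u j else b).
split=> // [V f|y y' N'y yy'].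
  apply: sfP => y; rewrite sfM sf_sum; have [Ky|nKy] := pselect (K y).
    rewrite EV ?mulr_sumr; last exact: KN.
    by apply: eq_bigr => l _; rewrite sfM vfZ sfM mulrCA.
  rewrite b0// mul0r big1// => l _.
  by rewrite sfM vfZ sfM b0// mul0r mulr0.
have by' : b y' = 1 by have := yy' ord0; rewrite unlift_none b1.
apply: inj; first exact: KN _ (NK _ N'y).
  apply: KN; apply: contrapT => nK; move: by'; rewrite b0// => /eqP.
  by rewrite eq_sym oner_eq0.
by move=> i; have := yy' (lift ord0 i); rewrite liftK.
Qed.

Lemma framed_sub S S' : S `<=` S' -> framed S' -> framed S.
Proof.
move=> SS' [K [N [E [u [b [s [H1 H2 H3]]]]]]]; exists K, N, E, u, b, s; split=> //.
- by move=> y /SS'; exact: H2.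
- by move=> y y' /SS'; exact: H3.
Qed.

Lemma compact_framed A : compact A -> framed A.
Proof.
move=> cA.
have /choice [U HU] : forall x, exists U, (open U /\ U x) /\ framed U.
  by move=> x; have [U ? ?] := framed_near x; exists U.
move: cA; rewrite compact_cover => /(_ X A U).
case=> [x _|x Ax|D DA AD]; first by have [[]] := HU x.
  by exists x => //; have [[]] := HU x.
have Hr (r : seq X) : framed (\bigcup_(x in [set` r]) U x).
  elim: r => [|x r IHr]; first by rewrite bigcup_seq big_nil; exact: framed0.
  rewrite bigcup_seq big_cons -bigcup_seq; apply: framedU => //.
  by have [] := HU x.
by apply: (framed_sub _ (Hr (finmap.enum_fset D))) => y /AD.
Qed.

End finite_frame.

Section continuity_aux.
Context {R : realType} {T : topologicalType}.

Lemma continuous_sum (I : Type) (r : seq I) (f : I -> T -> R) :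
  (forall i, continuous (f i)) -> continuous (fun q => \sum_(i <- r) f i q).
Proof. by move=> cf q; apply: (cvg_sumr (FF := nbhs_filter q)) => i; exact: cf. Qed.

Lemma continuous_mul (f h : T -> R) : continuous f -> continuous h ->
  continuous (fun q => f q * h q).
Proof. by move=> cf ch q; exact: (continuousM (cf q) (ch q)). Qed.

Lemma continuous_prod (I : Type) (r : seq I) (f : I -> T -> R) :
  (forall i, continuous (f i)) -> continuous (fun q => \prod_(i <- r) f i q).
Proof.
move=> cf; elim: r => [|i r IHr].
  under [fun q => _]funext do rewrite big_nil.
  exact: cst_continuous.
have -> : (fun q => \prod_(j <- i :: r) f j q) = (fun q => f i q * \prod_(j <- r) f j q).
  by apply/funext => q; rewrite big_cons.
exact: continuous_mul.
Qed.

Lemma compact_bounded_fun (A : set T) (f : T -> R) : compact A -> continuous f ->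
  exists2 b, 0 <= b & forall y, A y -> `|f y| <= b.
Proof.
move=> cA cf; have : compact (f @` A).
  by apply: continuous_compact => //; exact: continuous_subspaceT.
move=> /compact_bounded [b [_ Hb]]; exists (`|b| + 1); first by rewrite addr_ge0.
move=> y Ay; apply: (Hb (`|b| + 1)); last by exists y.
by rewrite (le_lt_trans (ler_norm b))// ltrDl.
Qed.

End continuity_aux.

Section planes_compact.
Context {R : realType} {X : ptopologicalType} {n p : nat}.
Variable M : smooth_manifold R X n.
Variable g : riemannian_metric M.
Local Notation C := (smoothfun M).
Local Notation VF := (vfield M).
Variables (A : set X) (K : nat) (E : 'I_K -> VF) (u : 'I_K -> C).
Hypothesis cA : compact A.
Hypothesis EV : forall y (V : VF) f, A y -> V f y = \sum_l V (u l) y * E l f y.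

Notation D := (p * K)%N.

(** The frame is overcomplete, so not every vector of this space is an encoding. *)
Definition encode (V : 'I_p -> VF) (y : X) : 'rV[R]_D :=
  mxvec (\matrix_(k, l) V k (u l) y).

Definition entry (v : 'rV[R]_D) (k : 'I_p) (l : 'I_K) : R := v 0 (mxvec_index k l).

Lemma entry_encode V y k l : entry (encode V y) k l = V k (u l) y.
Proof. by rewrite /entry mxvecE mxE. Qed.

Lemma entry_inj v v' : (forall k l, entry v k l = entry v' k l) -> v = v'.
Proof.
move=> vv'; apply/rowP => j.
by case/mxvec_indexP: j => k l; exact: vv'.
Qed.

Lemma entry_continuous k l : continuous (fun q : X * 'rV[R]_D => entry q.2 k l).
Proof.
move=> q; apply: (@continuous_comp _ _ _ snd (fun v : 'rV[R]_D => entry v k l)).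
  exact: cvg_snd.
exact: coord_continuous.
Qed.

Lemma base_continuous (f : C) : continuous (fun q : X * 'rV[R]_D => f q.1).
Proof.
move=> q; apply: (@continuous_comp _ _ _ fst f); first exact: cvg_fst.
exact: smooth_continuous.
Qed.

Definition monom (v : 'rV[R]_D) (I : {ffun 'I_p -> 'I_K}) : R := \prod_k entry v k (I k).

(** The value of a form on a tuple of vectors, as a polynomial in the encoding. *)
Definition eval_form (w : cochain M p) (q : X * 'rV[R]_D) : R :=
  \sum_(I : {ffun 'I_p -> 'I_K}) monom q.2 I * w (fun k => E (I k)) q.1.

Lemma monom_continuous I : continuous (fun q : X * 'rV[R]_D => monom q.2 I).
Proof. by apply: continuous_prod => k; exact: entry_continuous. Qed.

Lemma eval_form_continuous w : continuous (eval_form w).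
Proof.
apply: continuous_sum => I; apply: continuous_mul; first exact: monom_continuous.
exact: base_continuous.
Qed.

Lemma eval_formE w V y : is_form w -> A y -> eval_form w (y, encode V y) = w V y.
Proof.
move=> fw Ay; rewrite (form_frame fw V (fun V' f => EV V' f Ay)).
apply: eq_bigr => I _; congr (_ * _); apply: eq_bigr => k _.
by rewrite entry_encode.
Qed.

Variable phi : cochain M p.
Hypothesis fphi : is_form phi.

Definition oplane (y : X) (V : 'I_p -> VF) := orthonormal_at g y V /\ phi V y = 1.

Definition enc_planes : set (X * 'rV[R]_D) :=
  [set q | A q.1 /\ exists V, oplane q.1 V /\ q.2 = encode V q.1].

(** Vanishes when row [k] of the matrix encodes a tangent vector at the base point. *)
Definition tangency_defect k l (q : X * 'rV[R]_D) : R :=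
  entry q.2 k l - \sum_j entry q.2 k j * E j (u l) q.1.
(** The inner product of the vectors encoded by rows [k] and [l]. *)
Definition gram_entry k l (q : X * 'rV[R]_D) : R :=
  \sum_i entry q.2 k i * (\sum_j entry q.2 l j * g (E i) (E j) q.1).

Lemma tangency_defect_continuous k l : continuous (tangency_defect k l).
Proof.
have c : continuous (fun q : X * 'rV[R]_D => \sum_j entry q.2 k j * E j (u l) q.1).
  apply: continuous_sum => j; apply: continuous_mul; first exact: entry_continuous.
  exact: base_continuous.
by move=> q; exact: (continuousB (@entry_continuous k l q) (c q)).
Qed.

Lemma gram_entry_continuous k l : continuous (gram_entry k l).
Proof.
apply: continuous_sum => i; apply: continuous_mul; first exact: entry_continuous.
apply: continuous_sum => j; apply: continuous_mul; first exact: entry_continuous.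
exact: base_continuous.
Qed.

Lemma lincomb_frame (v : 'rV[R]_D) k (f : C) y :
  (\sum_j (entry v k j *: (1 : C)) *: E j) f y = \sum_j entry v k j * E j f y.
Proof.
rewrite vf_sum sf_sum; apply: eq_bigr => j _.
by rewrite vfZ sfM sfZ mulr1.
Qed.

Lemma gram_entryE v k l y : gram_entry k l (y, v) =
  g (\sum_i (entry v k i *: (1 : C)) *: E i) (\sum_j (entry v l j *: (1 : C)) *: E j) y.
Proof.
rewrite g_sum sf_sum; apply: eq_bigr => i _; rewrite gZ sfM sfZ mulr1; congr (_ * _).
rewrite g_sumr sf_sum; apply: eq_bigr => j _.
by rewrite gZr sfM sfZ mulr1.
Qed.

(** Being the encoding of a plane is a closed condition: the rows are tangent
    vectors, they are orthonormal, and [phi] is 1 on them. *)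
Lemma enc_planesE : enc_planes = [set q | [/\ A q.1, forall k l, tangency_defect k l q = 0,
  forall k l, gram_entry k l q = (k == l)%:R & eval_form phi q = 1]].
Proof.
apply/seteqP; split=> -[y v] /= => [[Ay [V [[oV phiV] /= vE]]]|[Ay e1 e2 e3]].
  rewrite /= in Ay oV phiV; subst v.
  have veqV k : veq y (V k) (\sum_j (entry (encode V y) k j *: (1 : C)) *: E j).
    move=> f; rewrite lincomb_frame (EV _ _ Ay); apply: eq_bigr => j _.
    by rewrite entry_encode.
  split=> // [k l|k l|].
  - apply/eqP; rewrite subr_eq0 entry_encode (EV _ _ Ay); apply/eqP.
    by apply: eq_bigr => j _; rewrite entry_encode.
  - rewrite gram_entryE -oV -(g_point g _ (veqV k)) Defs.metric_sym.
    by rewrite -(g_point g _ (veqV l)) Defs.metric_sym.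
  - by rewrite eval_formE.
split=> //.
pose V k : VF := \sum_j (entry v k j *: (1 : C)) *: E j.
have vE : v = encode V y.
  apply: entry_inj => k l; rewrite entry_encode lincomb_frame.
  by apply/eqP; rewrite -subr_eq0; apply/eqP; exact: e1.
exists V; split=> //; split=> [k l|]; first by rewrite -e2 gram_entryE.
by rewrite -eval_formE// -vE.
Qed.

Lemma cauchy_schwarz_unit (U V : VF) y : g V V y = 1 -> g U V y ^+ 2 <= g U U y.
Proof.
move=> gV; set a := g U V y.
have := metric_ge0 g (U - (a *: (1 : C)) *: V) y.
rewrite gB !gBr !gZ !gZr !sfB !sfM !sfZ !sf1 gV -/a.
rewrite (congr1 (fun f : C => f y) (Defs.metric_sym g V U)) -/a => H.
rewrite -subr_ge0; apply: le_trans H _; lra.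
Qed.

(** Closed by [enc_planesE], and bounded since unit vectors have coordinates bounded
    by the norms of the gradients of the [u l] (Cauchy-Schwarz). *)
Lemma enc_planes_compact : compact enc_planes.
Proof.
have /choice [B HB] : forall l : 'I_K, exists b, 0 <= b /\
    forall y, A y -> `|g (grad g (u l)) (grad g (u l)) y| <= b.
  move=> l; have [b b0 Hb] := compact_bounded_fun cA
    (@smooth_continuous _ _ _ _ (g (grad g (u l)) (grad g (u l)))).
  by exists b.
pose BB := \sum_l B l.
have B_le l : B l <= BB.
  by rewrite /BB (bigD1 l)//= lerDl; apply: sumr_ge0 => j _; case: (HB j).
pose box : set 'rV[R]_D := [set v | forall j, `[- (BB + 1), BB + 1]%classic (v ord0 j)].
have cbox : compact box
  by apply: (rV_compact (A := fun=> `[- (BB + 1), BB + 1]%classic)) => j; exact: segment_compact.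
have -> : enc_planes = (A `*` box) `&` [set q | [/\ forall k l, tangency_defect k l q = 0,
    forall k l, gram_entry k l q = (k == l)%:R & eval_form phi q = 1]].
  rewrite enc_planesE; apply/seteqP; split=> -[y v] /=; last first.
    by move=> [[Ay _] [? ? ?]]; split.
  move=> [Ay e1 e2 e3]; split=> //; split=> // j.
  have [_ [V [[oV _] /= vE]]] : enc_planes (y, v) by rewrite enc_planesE; split.
  case/mxvec_indexP: j => k l; rewrite /= in_itv /= -ler_norml.
  rewrite -[v _ _]/(entry v k l) vE entry_encode.
  have := cauchy_schwarz_unit (grad g (u l)) (V := V k) (y := y).
  rewrite oV eqxx grad_spec => /(_ erefl) H.
  have [Bl0 /(_ _ Ay) Bl] := HB l.
  have H2 : V k (u l) y ^+ 2 <= BB.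
    by apply: le_trans H _; apply: le_trans (ler_norm _) _; apply: le_trans Bl _.
  rewrite -(@ler_pXn2r _ 2)// ?nnegrE//; last first.
    by rewrite addr_ge0// (le_trans Bl0).
  rewrite real_normK ?num_real//; apply: le_trans H2 _.
  have : 0 <= BB by exact: le_trans Bl0 _.
  by nra.
apply: compact_closedI; first exact: compact_setX.
have cl1 : closed (\bigcap_(kl in [set: 'I_p * 'I_K]) [set q | tangency_defect kl.1 kl.2 q = 0]).
  apply: closed_bigI => kl _; apply: (@closed_comp _ _ (tangency_defect kl.1 kl.2) [set t | t = 0]).
    by move=> q _; exact: tangency_defect_continuous.
  exact: closed_eq.
have cl2 : closed (\bigcap_(kl in [set: 'I_p * 'I_p]) [set q | gram_entry kl.1 kl.2 q = (kl.1 == kl.2)%:R]).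
  apply: closed_bigI => kl _; apply: (@closed_comp _ _ (gram_entry kl.1 kl.2) [set t | t = (kl.1 == kl.2)%:R]).
    by move=> q _; exact: gram_entry_continuous.
  exact: closed_eq.
have cl3 : closed [set q | eval_form phi q = 1].
  apply: (@closed_comp _ _ (eval_form phi) [set t | t = 1]).
    by move=> q _; exact: eval_form_continuous.
  exact: closed_eq.
have := closedI (closedI cl1 cl2) cl3; congr closed.
apply/seteqP; split=> q /= => [[[h1 h2] h3]|[h1 h2 h3]].
  by split=> // [k l|k l]; [exact: (h1 (k, l))|exact: (h2 (k, l))].
by split=> //; split=> -[k l] _ /=.
Qed.

Lemma planes_bounded w : is_form w -> exists2 b, 0 <= b &
  forall y V, A y -> oplane y V -> `|w V y| <= b.
Proof.
move=> fw; have [b b0 Hb] := compact_bounded_fun enc_planes_compact (@eval_form_continuous w).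
exists b => // y V Ay oV; rewrite -eval_formE//; apply: Hb; split=> //=.
by exists V.
Qed.

Lemma planes_positive w : is_form w ->
  (forall y V, A y -> oplane y V -> 0 < w V y) ->
  exists2 e, 0 < e & forall y V, A y -> oplane y V -> e <= w V y.
Proof.
move=> fw w0; have [ne|e0] := pselect (enc_planes !=set0); last first.
  exists 1 => // y V Ay oV; exfalso; apply: e0; exists (y, encode V y).
  by split=> //; exists V.
have [|[y v]] := compact_EVT_min ne enc_planes_compact (f := eval_form w).
  by apply: continuous_subspaceT; exact: eval_form_continuous.
rewrite inE => -[/= Ay [V [oV vE]]] Hmin; exists (w V y); first exact: w0.
move=> y' V' Ay' oV'; rewrite -!eval_formE// -vE; apply: Hmin.
by rewrite inE; split=> //; exists V'.
Qed.

End planes_compact.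

(** * Convex hulls in Euclidean space *)

Section convex_hull.
Context {R : realType} {d : nat}.
Implicit Types (u v b q tau eta : 'rV[R]_d).

Definition dot u v : R := (u *m v^T) 0 0.

Lemma dotDr u v w : dot u (v + w) = dot u v + dot u w.
Proof. by rewrite /dot linearD mulmxDr mxE. Qed.
Lemma dotBr u v w : dot u (v - w) = dot u v - dot u w.
Proof. by rewrite /dot linearB mulmxBr !mxE. Qed.
Lemma dotZr u a v : dot u (a *: v) = a * dot u v.
Proof. by rewrite /dot linearZ -scalemxAr mxE. Qed.
Lemma dot_sym u v : dot u v = dot v u.
Proof. by rewrite /dot !mxE; apply: eq_bigr => i _; rewrite !mxE mulrC. Qed.
Lemma dotE u v : dot u v = \sum_i u 0 i * v 0 i.
Proof. by rewrite /dot mxE; apply: eq_bigr => i _; rewrite mxE. Qed.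
Lemma dotBl u v w : dot (u - v) w = dot u w - dot v w.
Proof. by rewrite !(dot_sym _ w) dotBr. Qed.
Lemma dotZl u a v : dot (a *: u) v = a * dot u v.
Proof. by rewrite !(dot_sym _ v) dotZr. Qed.
Lemma dot_sumr u (I : Type) (r : seq I) (F : I -> 'rV[R]_d) :
  dot u (\sum_(i <- r) F i) = \sum_(i <- r) dot u (F i).
Proof.
elim: r => [|i r IHr]; last by rewrite !big_cons dotDr IHr.
by rewrite !big_nil /dot linear0 mulmx0 mxE.
Qed.
Lemma dot_ge0 u : 0 <= dot u u.
Proof. by rewrite dotE; apply: sumr_ge0 => i _; rewrite -expr2 sqr_ge0. Qed.
Lemma dot_eq0 u : dot u u = 0 -> u = 0.
Proof.
rewrite dotE => /eqP; rewrite psumr_eq0 => [|i _]; last by rewrite -expr2 sqr_ge0.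
move=> /allP H; apply/rowP => i; rewrite mxE; apply/eqP.
by have := H i (mem_index_enum _); rewrite -expr2 sqrf_eq0.
Qed.

Variable G : set 'rV[R]_d.

Definition weights (c : 'I_d.+1 -> R) := (forall k, 0 <= c k) /\ \sum_k c k = 1.

Definition comb (c : 'I_d.+1 -> R) (xi : 'I_d.+1 -> 'rV[R]_d) := \sum_k c k *: xi k.

(** By Caratheodory's theorem [d.+1] points give the usual convex hull; a fixed
    number of points keeps the set of combinations compact. *)
Definition hull q := exists c xi, [/\ weights c, forall k, G (xi k) & comb c xi = q].

Lemma weights_mix c k (s : R) : weights c -> 0 <= s <= 1 ->
  weights (fun j => (1 - s) * c j + s * (j == k)%:R).
Proof.
move=> [c0 c1] /andP[s0 s1]; split=> [j|].
  by rewrite addr_ge0 ?mulr_ge0 ?subr_ge0// ler0n.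
rewrite big_split /= -!mulr_sumr c1 (bigD1 k)//= eqxx big1 => [|j /negbTE ->//].
by rewrite addr0 !mulr1 subrK.
Qed.

Lemma comb_mix c xi k (s : R) eta : (xi k = eta \/ c k = 0) ->
  comb (fun j => (1 - s) * c j + s * (j == k)%:R)
       (fun j => if j == k then eta else xi j) =
  comb c xi + s *: (eta - comb c xi).
Proof.
move=> H; rewrite /comb.
transitivity (\sum_j ((1 - s) *: (c j *: xi j) + (s * (j == k)%:R) *: eta)).
  apply: eq_bigr => j _; rewrite [LHS]scalerDl; case: eqP => [->|_]; last first.
    by rewrite mulr0 !scale0r -scalerA.
  by congr (_ + _); rewrite -scalerA; case: H => [->|->]; rewrite ?scale0r.
have sk : \sum_j ((j == k)%:R : R) = 1.
  by rewrite (bigD1 k)//= eqxx big1 ?addr0// => j /negbTE ->.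
rewrite big_split /= -scaler_sumr -scaler_suml -mulr_sumr sk mulr1 scalerBl scale1r scalerBr.
by rewrite -!addrA; congr (_ + _); rewrite addrC.
Qed.

(** First variation of the squared distance along the segment from [q] to [eta]. *)
Lemma closest_optimal tau q eta :
  (forall q', hull q' -> dot (tau - q) (tau - q) <= dot (tau - q') (tau - q')) ->
  (forall s : R, 0 <= s <= 1 -> hull (q + s *: (eta - q))) ->
  dot (tau - q) (eta - q) <= 0.
Proof.
move=> Hmin Hs; set b := tau - q; set e := eta - q; set t := dot b e; set Q := dot e e.
rewrite leNgt; apply/negP => t0.
have Q0 : 0 <= Q by exact: dot_ge0.
have Q1 : 0 < Q + 1 by lra.
pose s := Num.min 1 (t / (Q + 1)).
have s0 : 0 < s by rewrite lt_min ltr01 divr_gt0.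
have s1 : s <= 1 by rewrite ge_min lexx.
have st : s * (Q + 1) <= t by rewrite -ler_pdivlMr// ge_min lexx orbT.
have := Hmin _ (Hs s _); rewrite (ltW s0) s1 => /(_ erefl).
have -> : tau - (q + s *: (eta - q)) = b - s *: e by rewrite opprD addrA.
rewrite -/b; clearbody b e; rewrite !(dotBl, dotBr, dotZl, dotZr) (dot_sym e b) -/t -/Q => H.
have h1 := ler_wpM2l (ltW s0) st; have h2 := mulr_gt0 s0 t0; have h3 := mulr_gt0 s0 s0.
rewrite mulrDr mulr1 mulrDr in h1; clearbody s t Q; lra.
Qed.

(** All [d.+1] points with nonzero weight lie on the hyperplane through the
    combination orthogonal to [tau - comb c xi], hence are affinely dependent; moving
    the weights along the dependency makes one of them reach zero. *)
Lemma drop_vertex tau c xi : weights c -> (forall k, G (xi k)) ->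
  tau != comb c xi ->
  (forall k, c k != 0 -> dot (tau - comb c xi) (xi k - comb c xi) = 0) ->
  exists c', [/\ weights c', comb c' xi = comb c xi & exists k, c' k = 0].
Proof.
move=> [c0 c1] Gxi tq Hd; set q := comb c xi in tq Hd *.
have [[k ck]|nz] := pselect (exists k, c k = 0); first by exists c; split=> //; exists k.
have cn0 k : c k != 0 by apply/negP => /eqP ck; apply: nz; exists k.
(* A row kernel vector of this matrix is an affine dependency between the points;
   [tau - q] shows that the matrix is singular. *)
pose Mx : 'M[R]_(d + 1) := \matrix_(k < d + 1)
  row_mx (xi (cast_ord (addn1 d) k) - q) (1%:M : 'M[R]_1).
have dM : \det Mx = 0.
  rewrite -det_tr; apply/eqP/det0P; exists (row_mx (tau - q) 0).
    apply/negP => /eqP /(congr1 lsubmx); rewrite row_mxKl linear0 => /eqP.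
    by rewrite subr_eq0 (negbTE tq).
  apply/rowP => k; rewrite mxE [RHS]mxE.
  transitivity (\sum_i row_mx (tau - q) 0 0 i * row_mx (xi (cast_ord (addn1 d) k) - q) (1%:M : 'M[R]_1) 0 i).
    by apply: eq_bigr => i _; congr (_ * _); rewrite mxE /Mx mxE.
  rewrite big_split_ord /= [X in _ + X]big1 => [|i _]; last by rewrite row_mxEr mxE mul0r.
  rewrite addr0; apply: etrans _ (Hd _ (cn0 (cast_ord (addn1 d) k))); rewrite dotE; apply: eq_bigr => i _.
  by rewrite !row_mxEl.
have [lam lam0 lamM] : exists2 v : 'rV_(d + 1), v != 0 & v *m Mx = 0 by apply/det0P/eqP.
pose l (k : 'I_d.+1) := lam 0 (cast_ord (esym (addn1 d)) k).
have castK k : cast_ord (addn1 d) (cast_ord (esym (addn1 d)) k) = k by exact: cast_ordKV.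
have lsum (f : 'I_d.+1 -> R) : \sum_k l k * f k = \sum_(k < d + 1) lam 0 k * f (cast_ord (addn1 d) k).
  rewrite (reindex (cast_ord (addn1 d))) /=; last first.
    by exists (cast_ord (esym (addn1 d))) => k _; [exact: cast_ordK|exact: cast_ordKV].
  by apply: eq_bigr => k _; rewrite /l cast_ordK.
have l1 : \sum_k l k = 0.
  transitivity (\sum_k l k * 1); first by apply: eq_bigr => k _; rewrite mulr1.
  rewrite lsum; have /rowP /(_ (rshift d ord0)) := lamM; rewrite mxE [RHS]mxE => E0.
  apply: etrans _ E0.
  apply: eq_bigr => k _; congr (_ * _).
  by rewrite /Mx mxE row_mxEr mxE eqxx.
have lxi : \sum_k l k *: (xi k - q) = 0.
  apply/rowP => j; rewrite summxE [RHS]mxE.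
  transitivity (\sum_k l k * (xi k - q) 0 j); first by apply: eq_bigr => k _; rewrite mxE.
  rewrite (lsum (fun k => (xi k - q) 0 j)).
  have /rowP /(_ (lshift 1 j)) := lamM; rewrite mxE [RHS]mxE => E0.
  apply: etrans _ E0.
  apply: eq_bigr => k _; congr (_ * _).
  by rewrite /Mx [RHS]mxE row_mxEl.
have [k1 lk1] : exists k, l k < 0.
  apply: contrapT => Hn; have lge k : 0 <= l k.
    by rewrite leNgt; apply/negP => lk; apply: Hn; exists k.
  move/eqP: l1; rewrite psumr_eq0 // => /allP Hl.
  move/negP: lam0; apply; apply/eqP/rowP => k; rewrite mxE.
  have := Hl (cast_ord (addn1 d) k) (mem_index_enum _); rewrite /l cast_ordK.
  by move/eqP.
case: (@arg_minP _ R 'I_d.+1 k1 (fun k => l k < 0) (fun k => c k / - l k) lk1) => k0 lk0 Hk0.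
pose t := c k0 / - l k0.
have t0 : 0 <= t by rewrite /t divr_ge0// oppr_ge0 ltW.
exists (fun k => c k + t * l k); split.
- split=> [k|]; last by rewrite big_split /= -mulr_sumr l1 mulr0 addr0.
  have [lk|lk] := ltP (l k) 0; last by rewrite addr_ge0// mulr_ge0.
  have := Hk0 k lk; rewrite -/t ler_pdivlMr ?oppr_gt0//.
  by rewrite mulrN; lra.
- rewrite /comb; under eq_bigr do rewrite scalerDl.
  rewrite big_split /= -/(comb c xi) -/q.
  suff -> : \sum_i (t * l i) *: xi i = 0 by rewrite addr0.
  under eq_bigr do rewrite -scalerA.
  rewrite -scaler_sumr.
  have -> : \sum_k l k *: xi k = \sum_k l k *: (xi k - q) + (\sum_k l k) *: q.
    rewrite scaler_suml -big_split /=; apply: eq_bigr => k _.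
    by rewrite scalerBr subrK.
  by rewrite lxi l1 scale0r addr0 scaler0.
- exists k0; rewrite /t; field.
  by rewrite lt_eqF.
Qed.

(** The weights and points range over a compact set. *)
Lemma closest_point tau : compact G -> G !=set0 -> exists c xi,
  [/\ weights c, forall k, G (xi k) & forall q', hull q' ->
    dot (tau - comb c xi) (tau - comb c xi) <= dot (tau - q') (tau - q')].
Proof.
move=> cG [x0 Gx0].
pose PT := prod_topology (fun _ : 'I_d.+1 => 'rV[R]_d).
pose S : set ('rV[R]_d.+1 * PT) :=
  ([set v : 'rV[R]_d.+1 | forall j, `[0, 1]%classic (v ord0 j)] `&` [set v | \sum_k v 0 k = 1])
  `*` [set xi : PT | forall k, G (xi k)].
have cS : compact S.
  apply: compact_setX; last exact: (tychonoff (fun=> cG)).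
  apply: compact_closedI.
    by apply: (rV_compact (A := fun=> `[0 : R, 1 : R]%classic)) => j; exact: segment_compact.
  apply: (@closed_comp _ _ (fun v : 'rV[R]_d.+1 => \sum_k v 0 k) [set t | t = 1]).
    by move=> v _; apply: continuous_sum => k z; exact: coord_continuous.
  exact: closed_eq.
pose F (q : 'rV[R]_d.+1 * PT) : R :=
  \sum_j (tau 0 j - \sum_k q.1 0 k * (q.2 k : 'rV[R]_d) 0 j) * (tau 0 j - \sum_k q.1 0 k * (q.2 k : 'rV[R]_d) 0 j).
have FE (q : 'rV[R]_d.+1 * PT) : F q = dot (tau - comb (fun k => q.1 0 k) q.2) (tau - comb (fun k => q.1 0 k) q.2).
  rewrite dotE; apply: eq_bigr => j _; rewrite !mxE summxE.
  by congr ((_ - _) * (_ - _)); apply: eq_bigr => k _; rewrite mxE.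
have cF : continuous F.
  apply: continuous_sum => j q.
  have c1 : {for q, continuous (fun q : 'rV[R]_d.+1 * PT => tau 0 j - \sum_k q.1 0 k * (q.2 k : 'rV[R]_d) 0 j)}.
    have c2 : {for q, continuous (fun q : 'rV[R]_d.+1 * PT => \sum_k q.1 0 k * (q.2 k : 'rV[R]_d) 0 j)}.
      apply: continuous_sum => k z.
      have c3 : {for z, continuous (fun q : 'rV[R]_d.+1 * PT => q.1 0 k)}.
        apply: (@continuous_comp _ _ _ fst (fun v : 'rV[R]_d.+1 => v 0 k)).
          exact: cvg_fst.
        exact: coord_continuous.
      have c4 : {for z, continuous (fun q : 'rV[R]_d.+1 * PT => (q.2 k : 'rV[R]_d) 0 j)}.
        apply: (@continuous_comp _ _ _ (fun q : 'rV[R]_d.+1 * PT => q.2 k : 'rV[R]_d) (fun v : 'rV[R]_d => v 0 j)).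
          apply: (@continuous_comp _ _ _ snd (fun xi : PT => xi k)).
            exact: cvg_snd.
          exact: proj_continuous.
        exact: coord_continuous.
      exact: (continuousM c3 c4).
    have c5 : {for q, continuous (fun q : 'rV[R]_d.+1 * PT => tau 0 j)} by exact: cst_continuous.
    exact: (continuousB c5 c2).
  exact: (continuousM c1 c1).
have S0 : S !=set0.
  exists (delta_mx 0 0, (fun=> x0)); split=> //=; split=> [j|].
    by rewrite mxE /= in_itv /=; case: (j == 0); rewrite /= ?mulr1n ?mulr0n ?lexx ?ler01.
  rewrite (bigD1 0)//= mxE !eqxx big1 ?addr0// => k k0.
  by rewrite mxE (negbTE k0) andbF.
have [|[v xi]] := compact_EVT_min S0 cS (f := F); first exact: continuous_subspaceT.
rewrite inE => -[[/= v01 v1] Gxi] Hmin.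
exists (fun k => v 0 k), xi; split=> //.
  by split=> // k; have := v01 k; rewrite in_itv /= => /andP[].
move=> q' [c' [xi' [[c'0 c'1] Gxi' <-]]].
have := Hmin (\row_k c' k, xi'); rewrite !FE /=.
have -> : comb (fun k => (\row_k c' k) 0 k) xi' = comb c' xi'.
  by apply: eq_bigr => k _; rewrite mxE.
apply; rewrite inE; split=> //=; split=> [j|].
  rewrite mxE in_itv /= c'0 -c'1 (bigD1 j)//= lerDl; exact: sumr_ge0.
by rewrite -[RHS]c'1; apply: eq_bigr => k _; rewrite mxE.
Qed.

(** A point that no hyperplane separates from a compact set is a convex
    combination of its points. At a closest point of the set of combinations of
    [d + 1] points one weight can be made to vanish, which frees a slot for an
    arbitrary point of the set. *)
Lemma hull_of_support tau : compact G ->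
  (forall b, exists2 xi, G xi & dot b tau <= dot b xi) -> hull tau.
Proof.
move=> cG Hb; have [x0 Gx0 _] := Hb 0.
have [c [xi [wc Gxi Hmin]]] := closest_point tau cG (ex_intro _ _ Gx0).
have [->|tq] := eqVneq tau (comb c xi); first by exists c, xi.
exfalso.
have opt k : dot (tau - comb c xi) (xi k - comb c xi) <= 0.
  apply: closest_optimal => // s s01.
  exists (fun j => (1 - s) * c j + s * (j == k)%:R), (fun j => if j == k then xi k else xi j).
  split; [exact: weights_mix|by move=> j; case: eqP|].
  by apply: comb_mix; left.
have [k ck|c' [wc' cc' [k0 ck0]]] := drop_vertex wc Gxi tq.
  have S0 : \sum_k c k * - dot (tau - comb c xi) (xi k - comb c xi) = 0.
    have E : \sum_k c k *: (xi k - comb c xi) = 0.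
      under eq_bigr do rewrite scalerBr.
      by rewrite sumrB -scaler_suml; have [_ ->] := wc; rewrite scale1r subrr.
    transitivity (- dot (tau - comb c xi) (\sum_k c k *: (xi k - comb c xi))).
      under eq_bigr do rewrite mulrN.
      by rewrite sumrN dot_sumr; congr (- _); apply: eq_bigr => j _; rewrite dotZr.
    by rewrite E /dot linear0 mulmx0 mxE oppr0.
  move/eqP: S0; rewrite psumr_eq0 => [/allP /(_ k (mem_index_enum _))|j _].
    by rewrite /= mulf_eq0 (negbTE ck) oppr_eq0 => /eqP.
  by have [c0 _] := wc; rewrite mulr_ge0// oppr_ge0.
have [eta Geta Heta] := Hb (tau - comb c xi).
have : dot (tau - comb c xi) (eta - comb c xi) <= 0.
  apply: closest_optimal => // s s01; rewrite -cc'.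
  exists (fun j => (1 - s) * c' j + s * (j == k0)%:R), (fun j => if j == k0 then eta else xi j).
  split; [exact: weights_mix|by move=> j; case: eqP|].
  by apply: comb_mix; right.
rewrite dotBr => H.
have : dot (tau - comb c xi) (tau - comb c xi) = 0.
  by apply/eqP; rewrite eq_le dot_ge0 andbT dotBr; lra.
by move=> /dot_eq0 /eqP; rewrite subr_eq0 (negbTE tq).
Qed.

End convex_hull.

(** * Extension of positive functionals *)

Section minimal_sublinear.
Context {R : realType} {V : lmodType R}.
Variable D : set V.
Hypotheses (D0 : D 0) (DL : forall a x y, D x -> D y -> D (a *: x + y)).

Let DD x y : D x -> D y -> D (x + y).
Proof. by move=> Dx Dy; rewrite -[x]scale1r; exact: DL. Qed.
Let DZ a x : D x -> D (a *: x).
Proof. by move=> Dx; rewrite -[_ *: _]addr0; exact: DL. Qed.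
Let DN x : D x -> D (- x).
Proof. by rewrite -scaleN1r; exact: DZ. Qed.

Definition sublin (p : V -> R) :=
  (forall x y, D x -> D y -> p (x + y) <= p x + p y) /\
  (forall a x, 0 < a -> D x -> p (a *: x) <= a * p x).

Lemma sublin0 p : sublin p -> p 0 = 0.
Proof.
move=> [_ pZ].
have h1 : p 0 <= 2 * p 0 by rewrite -{1}(scaler0 V 2); apply: pZ.
have h2 : p 0 <= 2^-1 * p 0 by rewrite -{1}(scaler0 V 2^-1); apply: pZ; rewrite ?invr_gt0.
lra.
Qed.

Lemma sublin_opp p x : sublin p -> D x -> - p (- x) <= p x.
Proof.
move=> sp Dx; have [pD _] := sp; have := pD x (- x) Dx (DN Dx).
by rewrite subrr (sublin0 sp); lra.
Qed.

Lemma sublinZ p a x : sublin p -> 0 < a -> D x -> p (a *: x) = a * p x.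
Proof.
move=> [pD pZ] a0 Dx; apply/eqP; rewrite eq_le pZ//=.
have := pZ a^-1 (a *: x); rewrite invr_gt0 a0 scalerA mulVf ?gt_eqF// scale1r.
move=> /(_ isT (DZ a Dx)); rewrite -(ler_pM2l a0) mulrA divff ?gt_eqF//.
by rewrite mul1r.
Qed.

Let infs (P : (V -> R) -> Prop) x := inf [set p x | p in P].

(** Zorn's lemma: the infimum of a chain is again sublinear. *)
Lemma minimal_sublin q : sublin q -> exists p, [/\ sublin p,
  forall x, D x -> p x <= q x &
  forall p', sublin p' -> (forall x, D x -> p' x <= p x) -> forall x, D x -> p x <= p' x].
Proof.
move=> sq.
pose T := {p | sublin p /\ forall x, D x -> p x <= q x}.
pose t0 : T := exist _ q (conj sq (fun x _ => lexx (q x))).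
pose S : rel T := fun p p' => `[< forall x, D x -> sval p' x <= sval p x >].
have [||A totA|[p [sp pq]] pmin] := @ZL_preorder T t0 S.
- by move=> p; apply/asboolP.
- move=> p1 p2 p3 /asboolP H1 /asboolP H2; apply/asboolP => x Dx.
  exact: le_trans (H2 _ Dx) (H1 _ Dx).
- have [[t At]|nA] := pselect (A !=set0); last first.
    by exists t0 => s As; exfalso; apply: nA; exists s.
  pose P p := exists2 s : T, A s & sval s = p.
  have Pt : P (sval t) by exists t.
  have Psub p : P p -> sublin p by move=> [[s [Hs1 Hs2]] _ <-].
  have Pq p x : P p -> D x -> p x <= q x by move=> [[s [Hs1 Hs2]] _ <-]; exact: Hs2.
  have Ptot p1 p2 : P p1 -> P p2 ->
      (forall x, D x -> p1 x <= p2 x) \/ (forall x, D x -> p2 x <= p1 x).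
    move=> [s1 As1 <-] [s2 As2 <-].
    by have [/asboolP H|/asboolP H] := totA _ _ As1 As2; [right|left].
  have lbP x : D x -> lbound [set p x | p in P] (- sval t (- x)).
    move=> Dx _ [p Pp <-]; have sp := Psub _ Pp.
    have [H|H] := Ptot _ _ Pp Pt.
      by apply: le_trans _ (sublin_opp sp Dx); rewrite lerN2; apply: H; exact: DN.
    by apply: le_trans (sublin_opp (Psub _ Pt) Dx) _; exact: H.
  have hasP x : D x -> has_inf [set p x | p in P].
    by move=> Dx; split; [exists (sval t x); exists (sval t)|exists (- sval t (- x)); exact: lbP].
  have infle x p : D x -> P p -> infs P x <= p x.
    move=> Dx Pp; apply: ge_inf; last by exists p.
    by exists (- sval t (- x)); exact: lbP.
  have leinf x a : D x -> (forall p, P p -> a <= p x) -> a <= infs P x.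
    move=> Dx Ha; apply: lb_le_inf; first by exists (sval t x); exists (sval t).
    by move=> _ [p Pp <-]; exact: Ha.
  have sinf : sublin (infs P).
    split=> [x y Dx Dy|a x a0 Dx].
      rewrite -lerBlDr; apply: (leinf _ _ _) => // p1 Pp1; rewrite lerBlDr -lerBlDl.
      apply: (leinf _ _ _) => // p2 Pp2; rewrite lerBlDl.
      have [H|H] := Ptot _ _ Pp1 Pp2.
        apply: le_trans (infle _ _ (DD Dx Dy) Pp1) _.
        have [pD _] := Psub _ Pp1; apply: le_trans (pD _ _ Dx Dy) _.
        by rewrite lerD2l H.
      apply: le_trans (infle _ _ (DD Dx Dy) Pp2) _.
      have [pD _] := Psub _ Pp2; apply: le_trans (pD _ _ Dx Dy) _.
      by rewrite lerD2r H.
    rewrite -ler_pdivrMl//; apply: (leinf _ _ _) => // p Pp; rewrite ler_pdivrMl//.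
    apply: le_trans (infle _ _ (DZ a Dx) Pp) _.
    by have [_ pZ] := Psub _ Pp; exact: pZ.
  have infq x : D x -> infs P x <= q x.
    by move=> Dx; apply: le_trans (infle _ _ Dx Pt) _; exact: Pq.
  exists (exist _ (infs P) (conj sinf infq)) => s As; apply/asboolP => x Dx /=.
  by apply: infle => //; exists s.
- exists p; split=> // p' sp' p'p x Dx.
  have p'q y : D y -> p' y <= q y by move=> Dy; exact: le_trans (p'p _ Dy) (pq _ Dy).
  pose s' : T := exist _ p' (conj sp' p'q).
  by have /asboolP := pmin s' (introT (asboolP _) p'p); apply.
Qed.

(** A minimal sublinear functional is linear: otherwise it could be lowered to
    [x |-> inf_(t >= 0) p (x + t v) - t p v]. *)
Theorem dominated_linear q : sublin q -> exists L : V -> R,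
  [/\ forall x, D x -> L x <= q x, forall x y, D x -> D y -> L (x + y) = L x + L y &
      forall a x, D x -> L (a *: x) = a * L x].
Proof.
move=> /minimal_sublin [p [sp pq pmin]]; exists p.
have [pD pZ] := sp.
have pN v : D v -> p (- v) = - p v.
  move=> Dv; apply/eqP; rewrite eq_le andbC; apply/andP; split.
    by have := sublin_opp sp Dv; lra.
  (* Its infimum is sublinear, lies below [p], and at [- v] is at most [- p v]. *)
  pose S x := [set p (x + t *: v) - t * p v | t in [set t : R | 0 <= t]].
  have lbS x : D x -> lbound (S x) (- p (- x)).
    move=> Dx _ [t /= t0 <-]; have [t0'|t0'] : 0 = t \/ 0 < t by move: t0; rewrite le_eqVlt => /orP[/eqP|]; [left|right].
      by rewrite -t0' scale0r addr0 mul0r subr0; exact: sublin_opp.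
    have := pD (x + t *: v) (- x) (DD Dx (DZ t Dv)) (DN Dx).
    by rewrite addrC addKr (sublinZ sp)//; lra.
  pose r x := inf (S x).
  have rle x (t : R) : D x -> 0 <= t -> r x <= p (x + t *: v) - t * p v.
    move=> Dx t0; apply: ge_inf; first by exists (- p (- x)); exact: lbS.
    by exists t.
  have ler x a : (forall t : R, 0 <= t -> a <= p (x + t *: v) - t * p v) -> a <= r x.
    move=> Ha; apply: lb_le_inf; first by exists (p (x + 0 *: v) - 0 * p v); exists 0 => /=.
    by move=> _ [t t0 <-]; exact: Ha.
  have sr : sublin r.
    split=> [x y Dx Dy|a x a0 Dx].
      rewrite -lerBlDr; apply: (ler _ _) => t t0; rewrite lerBlDr -lerBlDl.
      apply: (ler _ _) => s s0; rewrite lerBlDl.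
      apply: le_trans (rle _ (t + s) (DD Dx Dy) (addr_ge0 t0 s0)) _.
      have -> : x + y + (t + s) *: v = (x + t *: v) + (y + s *: v).
        by rewrite scalerDl addrACA.
      have := pD _ _ (DD Dx (DZ t Dv)) (DD Dy (DZ s Dv)).
      by rewrite mulrDl; lra.
    rewrite -ler_pdivrMl//; apply: (ler _ _) => t t0; rewrite ler_pdivrMl//.
    have at0 : 0 <= a * t by rewrite mulr_ge0// ltW.
    apply: le_trans (rle _ _ (DZ a Dx) at0) _.
    rewrite -scalerA -scalerDr (sublinZ sp)//; last exact: DD Dx (DZ t Dv).
    by rewrite mulrBr mulrA.
  have rp x : D x -> r x <= p x.
    by move=> Dx; have := rle x 0 Dx (lexx 0); rewrite scale0r addr0 mul0r subr0.
  apply: le_trans (pmin r sr rp _ (DN Dv)) _.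
  have := rle (- v) 1 (DN Dv) ler01.
  by rewrite scale1r addNr (sublin0 sp) mul1r sub0r.
split=> // [x y Dx Dy|a x Dx].
  apply/eqP; rewrite eq_le pD//=.
  have := pD (x + y) (- y) (DD Dx Dy) (DN Dy).
  by rewrite addrK pN//; lra.
have [a0|a0|->] := ltgtP a 0.
- rewrite -[a]opprK scaleNr pN; last exact: DZ.
  by rewrite (sublinZ sp) ?oppr_gt0// !mulNr.
- by rewrite (sublinZ sp).
- by rewrite scale0r mul0r (sublin0 sp).
Qed.

End minimal_sublinear.

Section positive_extension.
Context {R : realType} {C : lmodType R} {Z : Type}.
Variables (P : set C) (L : C -> Z -> R) (ell : C -> R) (S : set Z) (e : C).

(** Boundedness is only asked on the set [S] of points that the functional sees. *)
Definition bdd (F : Z -> R) := exists b, forall z, S z -> `|F z| <= b.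

Hypotheses (P0 : P 0) (PL : forall a f h, P f -> P h -> P (a *: f + h)).
Hypothesis LL : forall a f h z, P f -> P h -> S z -> L (a *: f + h) z = a * L f z + L h z.
Hypothesis ellL : forall a f h, P f -> P h -> ell (a *: f + h) = a * ell f + ell h.
Hypothesis Lbdd : forall f, P f -> bdd (L f).
Hypothesis pos : forall f, P f -> (forall z, S z -> 0 <= L f z) -> 0 <= ell f.
Hypotheses (Pe : P e) (e1 : forall z, S z -> 1 <= L e z).

Lemma bdd_lin (a : R) (F G : Z -> R) : bdd F -> bdd G -> bdd (fun z => a * F z + G z).
Proof.
move=> [b Hb] [c Hc]; exists (`|a| * b + c) => z Sz.
rewrite (le_trans (ler_normD _ _))// lerD ?Hc// normrM ler_wpM2l//; exact: Hb.
Qed.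

(** The infimum of [ell f] over the [f] with [L f] above [F] is sublinear, because
    the order unit [e] makes the set of such [f] nonempty and bounds the infimum
    from below; a linear functional below it is positive and extends [ell]. *)
Theorem positive_extension : exists La : (Z -> R) -> R,
  [/\ forall a F G, bdd F -> bdd G -> La (fun z => a * F z + G z) = a * La F + La G,
      forall F, bdd F -> (forall z, S z -> 0 <= F z) -> 0 <= La F &
      forall f, P f -> La (L f) = ell f].
Proof.
have L0 z : S z -> L 0 z = 0.
  by move=> Sz; have := LL (- 1) P0 P0 Sz; rewrite scaler0 addr0; lra.
have ell0 : ell 0 = 0 by have := ellL (- 1) P0 P0; rewrite scaler0 addr0; lra.
have ellZ a f : P f -> ell (a *: f) = a * ell f.
  by move=> Pf; have := ellL a Pf P0; rewrite !addr0 ell0 addr0.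
have LZ a f z : P f -> S z -> L (a *: f) z = a * L f z.
  by move=> Pf Sz; have := LL a Pf P0 Sz; rewrite !addr0 L0// addr0.
have PZ a f : P f -> P (a *: f) by move=> Pf; rewrite -[_ *: _]addr0; exact: PL.
pose U F := [set ell f | f in [set f | P f /\ forall z, S z -> F z <= L f z]].
have lbU F b : (forall z, S z -> `|F z| <= b) -> 0 <= b -> lbound (U F) (- (b * ell e)).
  move=> Hb b0 _ [f [Pf fF] <-].
  have : 0 <= ell (b *: e + f).
    apply: pos => [|z Sz]; first exact: PL.
    rewrite LL//; have := fF z Sz; have := Hb z Sz; rewrite ler_norml => /andP[h1 h2] h3.
    by have := ler_wpM2l b0 (e1 Sz); lra.
  by rewrite ellL//; lra.
have bdd0 F : bdd F -> exists2 b, 0 <= b & forall z, S z -> `|F z| <= b.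
  move=> [b Hb]; exists `|b| => // z Sz; exact: le_trans (Hb z Sz) (ler_norm b).
have neU F : bdd F -> U F !=set0.
  move=> /bdd0 [b b0 Hb]; exists (ell (b *: e)); exists (b *: e) => //; split; first exact: PZ.
  move=> z Sz; rewrite LZ//; apply: le_trans (ler_norm _) _; apply: le_trans (Hb z Sz) _.
  by have := ler_wpM2l b0 (e1 Sz); rewrite mulr1.
pose q F := inf (U F).
have qle F f : bdd F -> P f -> (forall z, S z -> F z <= L f z) -> q F <= ell f.
  move=> /bdd0 [b b0 Hb] Pf fF; apply: ge_inf; last by exists f.
  by exists (- (b * ell e)); exact: lbU.
have leq F a : bdd F -> (forall f, P f -> (forall z, S z -> F z <= L f z) -> a <= ell f) -> a <= q F.
  move=> bF Ha; apply: lb_le_inf; first exact: neU.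
  by move=> _ [f [Pf fF] <-]; exact: Ha.
pose D : set (Z -> R^o) := [set F | bdd F].
have D0 : D 0 by exists 0 => z _; rewrite normr0.
have DL a F G : D F -> D G -> D (a *: F + G) by exact: bdd_lin.
have sq : sublin D q.
  split=> [F G DF DG|a F a0 DF].
    have DFG : bdd (F + G) by have := DL 1 F G DF DG; rewrite scale1r.
    rewrite -lerBlDr; apply: (leq _ _ _) => // f Pf fF; rewrite lerBlDr -lerBlDl.
    apply: (leq _ _ _) => // h Ph hG; rewrite lerBlDl.
    have := ellL 1 Pf Ph; rewrite scale1r mul1r => <-.
    apply: qle => //; first by rewrite -[f]scale1r; exact: PL.
    move=> z Sz; have := LL 1 Pf Ph Sz; rewrite scale1r mul1r => ->.
    by apply: lerD; [exact: fF|exact: hG].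
  have DaF : bdd (a *: F) by have := DL a F 0 DF D0; rewrite addr0.
  rewrite -ler_pdivrMl//; apply: (leq _ _ _) => // f Pf fF; rewrite ler_pdivrMl//.
  rewrite -ellZ//; apply: qle => //; first exact: PZ.
  by move=> z Sz; rewrite LZ// ler_wpM2l ?(ltW a0)//; exact: fF.
have [La [Laq LaD LaZ]] := dominated_linear D0 DL sq.
have LaL a F G : bdd F -> bdd G -> La (fun z => a * F z + G z) = a * La F + La G.
  move=> bF bG; have DaF : D (a *: F) by have := DL a F 0 bF D0; rewrite addr0.
  by rewrite -LaZ// -LaD.
exists La; split=> // [F bF F0|f Pf].
  have bN : bdd (- F) by have := DL (- 1) F 0 bF D0; rewrite addr0 scaleN1r.
  have : La (- F) <= 0.
    rewrite -ell0; apply: le_trans (Laq _ bN) _; apply: qle => // z Sz.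
    by rewrite L0//= oppr_le0; exact: F0.
  by have := LaZ (- 1) F bF; rewrite scaleN1r; lra.
have H f' : P f' -> La (L f') <= ell f'.
  by move=> Pf'; apply: le_trans (Laq _ (Lbdd Pf')) _; apply: qle => //; exact: Lbdd.
apply/eqP; rewrite eq_le H//=.
have bLf := Lbdd Pf.
have : La ((- 1) *: (L f : Z -> R^o)) <= - ell f.
  have bN : bdd ((- 1) *: (L f : Z -> R^o)) by have := DL (- 1) _ 0 bLf D0; rewrite addr0.
  apply: le_trans (Laq _ bN) _.
  have <- : ell ((- 1) *: f) = - ell f by rewrite ellZ// mulN1r.
  apply: qle => //; first exact: PZ.
  by move=> z Sz; rewrite LZ.
by rewrite LaZ//; lra.
Qed.

End positive_extension.

(** * Measures on the Cantor space *)

(** Carries the algebra of clopen sets as its measurable sets. *)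
Definition clopen_algebra (T : Type) := T.

Section clopen_algebra.
Variable T : ptopologicalType.
HB.instance Definition _ := Pointed.copy (clopen_algebra T) T.
Let clopen_setC : setC_closed (@clopen T).
Proof. by move=> A; exact: (clopenC A). Qed.
HB.instance Definition _ := isAlgebraOfSets.Build default_measure_display
  (clopen_algebra T) (@clopen0 T) (@clopenU T) clopen_setC.
End clopen_algebra.

Local Notation clopen_space T := (g_sigma_algebraType (@measurable _ (clopen_algebra T))).

Section clopen.
Context {R : realType} {T : ptopologicalType}.
Hypotheses (cT : compact [set: T]) (hT : hausdorff_space T) (zT : zero_dimensional T).

(** Cover the compact set [C] by finitely many clopen subsets of [O]. *)
Lemma clopen_between (C O : set T) : closed C -> open O -> C `<=` O ->
  exists D, [/\ clopen D, C `<=` D & D `<=` O].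
Proof.
move=> cC oO CO.
have /choice [f Hf] t : exists D, clopen D /\ (C t -> D t /\ D `<=` O).
  have [Ct|nCt] := pselect (C t); last by exists set0; split=> //; exact: clopen0.
  have [D [Dt cD] DO] := zero_dimensional_cvg hT zT cT (open_nbhs_nbhs (conj oO (CO _ Ct))).
  by exists D.
have := subclosed_compact cC cT (@subsetT _ C); rewrite compact_cover.
move=> /(_ _ C f)[i Ci|t Ct|E EC CE]; first by have [[]] := Hf i.
  by exists t => //; have [_ /(_ Ct)[]] := Hf t.
exists (cover [set` finmap.enum_fset E] f); split=> //.
  split; first by apply: bigcup_open => i _; have [[]] := Hf i.
  by apply: closed_bigcup => // i _; have [[]] := Hf i.
move=> t [i Ei]; have [_ H] := Hf i; have /set_mem Ci := EC i Ei.
by have [_] := H Ci; apply.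
Qed.

Lemma clopen_measurable_fun (F : T -> R) : continuous F ->
  measurable_fun setT (F : clopen_space T -> R).
Proof.
move=> cF; apply: (measurability _ (RGenOInfty.measurableE R)) => // _ [_ [a ->] <-]; rewrite setTI.
have /choice [D HD] n : exists D, [/\ clopen D, F @^-1` `[a + n.+1%:R^-1, +oo[ `<=` D & D `<=` F @^-1` `]a, +oo[].
  apply: clopen_between; last by move=> t; rewrite /= !in_itv/= !andbT; apply: lt_le_trans; rewrite ltrDl invr_gt0 ltr0n.
  - by move: cF => /continuous_closedP; apply; exact: interval_closed.
  - by move: cF => /continuousP; apply; exact: interval_open.
have -> : F @^-1` `]a, +oo[ = \bigcup_n D n.
  apply/seteqP; split=> [t|t [n _] Dt]; last by have [_ _] := HD n; apply.
  rewrite /= in_itv/= andbT => at0; have at1 : 0 < F t - a by rewrite subr_gt0.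
  have [n] := ltr_add_invr at1; rewrite add0r => Hn; exists n => //.
  by have [_ H _] := HD n; apply: H; rewrite /= in_itv/= andbT -lerBrDl ltW.
by apply: bigcup_measurable => n _; apply: sub_sigma_algebra; have [] := HD n.
Qed.

(** Regularity lets a clopen set be squeezed between the preimages of a basic
    open set and of the given one. *)
Lemma clopen_borel (X : ptopologicalType) (y : T -> X) :
  @second_countable X ->
  (forall (x : X) (U : set X), open U -> U x ->
     exists N C : set X, [/\ open N, N x, N `<=` C, closed C & C `<=` U]) ->
  continuous y -> measurable_fun setT (y : clopen_space T -> Borel X).
Proof.
move=> [B cB [oB bB]] rX cy; apply: (@measurability _ _ (clopen_space T) (Borel X) setT y (@open X)) => //; move=> _ [U oU <-]; rewrite setTI.
have /choice [D HD] (V : set X) : exists D : set T, clopen D /\ D `<=` y @^-1` U /\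
    ((exists2 C : set X, closed C & V `<=` C /\ C `<=` U) -> y @^-1` V `<=` D).
  have [[C cC [VC CU]]|nC] := pselect (exists2 C : set X, closed C & V `<=` C /\ C `<=` U); last first.
    by exists set0; split; [exact: clopen0|split].
  have [||t|D [cD CD DU]] := @clopen_between (y @^-1` C) (y @^-1` U).
  - by move: cy => /continuous_closedP; apply.
  - by move: cy => /continuousP; apply.
  - by move=> /CU.
  by exists D; split=> //; split=> // _ t Vt; apply: CD; exact: VC.
have -> : y @^-1` U = \bigcup_(V in B) D V.
  apply/seteqP; split=> [t Ut|t [V _]]; last by have [_ [+ _]] := HD V; apply.
  have [N [C [oN Nt NC cC CU]]] := rX _ _ oU Ut.
  have [V [BV Vt VN]] := bB (y t) N (open_nbhs_nbhs (conj oN Nt)).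
  exists V => //; have [_ [_ H]] := HD V; apply: H => //; exists C => //; split=> //.
  exact: subset_trans VN NC.
rewrite bigcup_set_type; apply: countable_bigcupT_measurable.
  by rewrite /countable (card_le_eql (card_setT B)).
by move=> V; apply: sub_sigma_algebra; have [] := HD (\val V).
Qed.

(** Staircase approximation: with [A_k] clopen between the superlevel sets of
    [F + B] at [(k + 1) e] and [k e], the sum of the [e \1_(A_k)] follows [F + B]
    up to [e]. *)
Lemma clopen_step (F : T -> R) e : continuous F -> 0 < e ->
  exists N (c : nat -> R) (D : nat -> set T), (forall k, clopen (D k)) /\
    forall t, F t <= \sum_(k < N) c k * \1_(D k) t <= F t + 2 * e.
Proof.
move=> cF e0; have [B B0 HB] := compact_bounded_fun cT cF.
have /choice [A HA] k : exists D, [/\ clopen D, F @^-1` `[k.+1%:R * e - B, +oo[ `<=` D & D `<=` F @^-1` `]k%:R * e - B, +oo[].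
  apply: clopen_between.
  - by move: cF => /continuous_closedP; apply; exact: interval_closed.
  - by move: cF => /continuousP; apply; exact: interval_open.
  - move=> t; rewrite /= !in_itv/= !andbT; apply: lt_le_trans.
    by rewrite ltrBlDr subrK ltr_pM2r// ltr_nat.
pose S n t : R := \sum_(k < n) e * \1_(A k) t.
have AT k t : k.+1%:R * e <= F t + B -> \1_(A k) t = 1 :> R.
  move=> H; have [_ H1 _] := HA k; rewrite indicE mem_set//; apply: H1.
  by rewrite /= in_itv/= andbT lerBlDr.
have AF k t : F t + B <= k%:R * e -> \1_(A k) t = 0 :> R.
  move=> H; have [_ _ H1] := HA k; rewrite indicE memNset// => /H1.
  by rewrite /= in_itv/= andbT ltrBlDr ltNge H.
have A01 k t : (\1_(A k) t = 1 :> R /\ k%:R * e < F t + B) \/ \1_(A k) t = 0 :> R.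
  rewrite indicE; case: (boolP (t \in A k)) => [/set_mem Akt|_]; last by right.
  by left; split=> //; have [_ _ /(_ t Akt)] := HA k; rewrite /= in_itv/= andbT ltrBlDr.
have SS n t : S n.+1 t = S n t + e * \1_(A n) t by rewrite /S big_ord_recr.
have S0 t : S 0%N t = 0 by rewrite /S big_ord0.
have F0 t : 0 <= F t + B by have := HB t Logic.I; rewrite ler_norml => /andP[]; lra.
have Sup n t : S n t <= F t + B + e /\ S n t <= n%:R * e.
  elim: n => [|n [IH1 IH2]]; first by rewrite S0 mul0r; split=> //; have := F0 t; lra.
  rewrite SS -natr1 mulrDl mul1r; case: (A01 n t) => [[-> H]|->]; split; lra.
have Sfull n t : n%:R * e <= F t + B -> S n t = n%:R * e.
  elim: n => [|n IHn] H; first by rewrite S0 mul0r.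
  rewrite SS AT// IHn; first by rewrite -natr1 mulrDl mul1r mulr1.
  by apply: le_trans H; rewrite ler_pM2r// ler_nat.
have Slow n t : F t + B <= n%:R * e -> F t + B - e <= S n t.
  elim: n => [|n IHn] H; first by rewrite S0; move: H; rewrite mul0r; lra.
  have [h|h] := leP (F t + B) (n%:R * e).
    by rewrite SS (AF n t h) mulr0 addr0; exact: IHn.
  rewrite SS (Sfull _ _ (ltW h)); move: H; rewrite -natr1 mulrDl mul1r => H.
  by have [[-> _]|->] := A01 n t; lra.
have [N HN] : exists N : nat, 2 * B <= N%:R * e.
  exists (Num.truncn (2 * B / e)).+1; rewrite -ler_pdivrMr//.
  by apply: ltW; exact: truncnS_gt.
exists N.+1, (fun k => if k is 0%N then e - B else e), (fun k => if k is k'.+1 then A k' else setT).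
split=> [[|k]|t]; [exact: clopenT|by have [] := HA k|].
rewrite big_ord_recl /= indicT mulr1.
have -> : \sum_(i < N) e * \1_(A i) t = S N t by [].
have FN : F t + B <= N%:R * e by have := HB t Logic.I; rewrite ler_norml => /andP[]; lra.
have := Slow N t FN; have [] := Sup N t.
by move=> ? ? ?; apply/andP; split; lra.
Qed.

End clopen.

Section clopen_measure.
Context {R : realType} {T : ptopologicalType} {Z : Type}.
Variables (S : set Z) (La : (Z -> R) -> R) (sg : Z -> T).
Hypotheses (cT : compact [set: T]) (hT : hausdorff_space T) (zT : zero_dimensional T).
Hypothesis LaL : forall a F G, bdd S F -> bdd S G ->
  La (fun z => a * F z + G z) = a * La F + La G.
Hypothesis La0 : forall F, bdd S F -> (forall z, S z -> 0 <= F z) -> 0 <= La F.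

Let ind (A : set T) (z : Z) : R := \1_A (sg z).

Let bI A : bdd S (ind A).
Proof. by exists 1 => z _; rewrite /ind indicE ger0_norm ?ler0n// lern1 leq_b1. Qed.

Let La_ext F G : F =1 G -> La F = La G.
Proof. by move=> /funext->. Qed.

Let bF0 : bdd S (fun=> 0 : R).
Proof. by exists 0 => z _; rewrite normr0. Qed.

Let La_cst0 : La (fun=> 0) = 0.
Proof.
have := LaL (- 1) bF0 bF0; under La_ext do rewrite mulr0 addr0.
by move=> h; lra.
Qed.

Let bZ a (F : Z -> R) : bdd S F -> bdd S (fun z => a * F z).
Proof.
move=> bF; have [b Hb] := bdd_lin a bF bF0; exists b => z Sz.
by have := Hb z Sz; rewrite addr0.
Qed.

Let LaZ a (F : Z -> R) : bdd S F -> La (fun z => a * F z) = a * La F.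
Proof.
move=> bF; have := LaL a bF bF0; rewrite La_cst0 addr0 => <-.
by apply: La_ext => z; rewrite addr0.
Qed.

Let cont (A : set (clopen_algebra T)) : \bar R := (La (ind A))%:E.

Let cont0 : cont set0 = 0%E.
Proof. by rewrite /cont (La_ext (G := fun=> 0)) ?La_cst0// => z; rewrite /ind indic0. Qed.

Let cont_ge0 A : (0 <= cont A)%E.
Proof. by rewrite lee_fin; apply: La0 => // z _; rewrite /ind indicE ler0n. Qed.

Let bdd_sum n (F : 'I_n -> Z -> R) : (forall k, bdd S (F k)) ->
  bdd S (fun z => \sum_k F k z) /\ La (fun z => \sum_k F k z) = \sum_k La (F k).
Proof.
elim: n F => [|n IHn] F bF.
  split; first by exists 0 => z _; rewrite big_ord0 normr0.
  by under La_ext do rewrite big_ord0; rewrite big_ord0 La_cst0.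
have [b1 e1] := IHn (fun k => F (lift ord0 k)) (fun k => bF _).
have E z : \sum_k F k z = 1 * F ord0 z + \sum_(k < n) F (lift ord0 k) z.
  by rewrite big_ord_recl mul1r.
split; last by under La_ext do rewrite E; rewrite LaL// mul1r e1 big_ord_recl.
have [b Hb] := bdd_lin 1 (bF ord0) b1.
by exists b => z /Hb; rewrite E.
Qed.

Let cont_additive : semi_sigma_additive cont.
Proof.
move=> F mF tF mUF; have [oU cU] : clopen (\bigcup_n F n) by [].
have := subclosed_compact cU cT (@subsetT _ _); rewrite compact_cover.
move=> /(_ nat setT F)[n _|//|E _ CE]; first by have [] : clopen (F n) by exact: mF.
pose N := (\max_(k <- finmap.enum_fset E) k).+1.
have F0 n : (N <= n)%N -> F n = set0.
  move=> Nn; rewrite -subset0 => t Fnt.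
  have [k Ek Fkt] := CE t (ex_intro2 _ _ n Logic.I Fnt).
  have kN : (k < N)%N by rewrite ltnS; exact: (@leq_bigmax_seq _ _ xpredT id k).
  suff kn : k = n by move: kN; rewrite kn ltnNge Nn.
  by apply: tF => //; exists t.
apply: cvg_near_cst; exists N => // n /= Nn; rewrite big_mkord.
under eq_bigr do rewrite /cont.
rewrite sumEFin /cont; congr (_%:E).
have [_ <-] := bdd_sum (F := fun k : 'I_n => ind (F k)) (fun k => bI _).
apply: La_ext => z; rewrite /ind indicE.
have [/set_mem[k _ Fk]|/negP nU] := boolP (sg z \in \bigcup_n F n).
  have kn : (k < n)%N.
    by rewrite ltnNge; apply/negP => nk; move: Fk; rewrite F0// (leq_trans Nn).
  rewrite (bigD1 (Ordinal kn))//= indicE mem_set// big1 ?addr0// => i ik.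
  rewrite indicE memNset// => Fi; move/eqP: ik; apply; apply: val_inj => /=.
  by apply: tF => //; exists (sg z).
by rewrite big1// => i _; rewrite indicE memNset// => Fi; apply: nU; apply/mem_set; exists i.
Qed.

(** A positive linear functional on all bounded functions is a finitely additive
    measure; read on the clopen sets of a compact space, where a disjoint cover is
    finite, it is countably additive for free. *)
Theorem clopen_representation : exists m : {measure set (clopen_space T) -> \bar R},
  (m setT < +oo)%E /\ forall F : T -> R, continuous F ->
    m.-integrable setT (EFin \o (F : clopen_space T -> R)) /\
    \int[m]_t F t = La (F \o sg).
Proof.
have key (e I J L l m : R) : I <= J -> J <= I + e * m -> L <= J ->
    J <= e * l + L -> 0 <= e * l -> 0 <= e * m -> 0 < e ->
    - (e * l + e * m + e) <= I - L <= e * l + e * m + e.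
  by move=> *; apply/andP; split; lra.
pose c : {measure set (clopen_algebra T) -> \bar R} :=
  HB.pack cont (isMeasure.Build _ _ _ cont cont0 cont_ge0 cont_additive).
exists (measure_extension c).
have mE (A : set T) : clopen A -> measure_extension c A = (La (ind A))%:E.
  by move=> cA; exact: (measurable_mu_extE c).
have mfin : (measure_extension c setT < +oo)%E by rewrite mE ?ltry//; exact: clopenT.
split=> //.
have bT (F : T -> R) : continuous F -> exists2 B, 0 <= B & forall t, `|F t| <= B.
  by move=> /(compact_bounded_fun cT) [B B0 HB]; exists B => // t; exact: HB.
have intF (F : T -> R) B : measurable_fun setT (F : clopen_space T -> R) ->
    (forall t, `|F t| <= B) -> (measure_extension c).-integrable setT (EFin \o F).
  move=> mF HB; apply: measurable_bounded_integrable => //.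
  exists B; split; first exact: num_real.
  by move=> x Bx t _; exact: le_trans (HB t) (ltW Bx).
have cintF (F : T -> R) : continuous F -> (measure_extension c).-integrable setT (EFin \o F).
  by move=> cF; have [B _ HB] := bT F cF; apply: intF HB; exact: clopen_measurable_fun.
have indE (A : set T) : clopen A ->
    (measure_extension c).-integrable setT (EFin \o (\1_A : clopen_space T -> R)) /\
    \int[measure_extension c]_t (\1_A t : R) = La (ind A).
  move=> cA; have mA : measurable (A : set (clopen_space T)) by exact: sub_sigma_algebra.
  split; last by rewrite /Rintegral integral_indic// setIT; exact: (congr1 fine (mE A cA)).
  by apply: (intF _ 1) => [|t]; [exact: measurable_indic|rewrite indicE ger0_norm ?ler0n// lern1 leq_b1].
have stepE N (k : nat -> R) (D : nat -> set T) : (forall i, clopen (D i)) ->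
    [/\ (measure_extension c).-integrable setT (EFin \o (fun t : clopen_space T => \sum_(i < N) k i * \1_(D i) t)),
     bdd S (fun z => \sum_(i < N) k i * \1_(D i) (sg z)) &
    \int[measure_extension c]_t (\sum_(i < N) k i * \1_(D i) t) =
    La (fun z => \sum_(i < N) k i * \1_(D i) (sg z))].
  move=> cD.
  have i1 i : (measure_extension c).-integrable setT (EFin \o (fun t : clopen_space T => k i * \1_(D i) t)).
    have mD : measurable (D i : set (clopen_space T)) by apply: sub_sigma_algebra; exact: cD.
    apply: (intF _ `|k i|) => [|t]; first by apply: measurable_funM => //; exact: measurable_indic.
    by rewrite normrM ler_piMr// indicE ger0_norm ?ler0n// lern1 leq_b1.
  have [i2 e2] := Rintegral_sum (index_enum 'I_N) measurableT (fun i : 'I_N => i1 i).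
  have [b3 e3] := bdd_sum (F := fun (i : 'I_N) z => k i * \1_(D i) (sg z)) (fun i => bZ _ (bI _)).
  split=> //; rewrite e2 e3; apply: eq_bigr => i _.
  have [i4 e4] := indE _ (cD i).
  by rewrite RintegralZl// e4; exact: (esym (LaZ _ (bI _))).
have upper (F : T -> R) e : continuous F -> 0 < e -> exists G : T -> R,
    [/\ forall t, F t <= G t <= F t + e,
       (measure_extension c).-integrable setT (EFin \o (G : clopen_space T -> R)),
       bdd S (G \o sg) & \int[measure_extension c]_t G t = La (G \o sg)].
  move=> cF e0; have e20 : 0 < e / 2 by rewrite divr_gt0.
  have [N [k [D [cD H]]]] := clopen_step cT hT zT cF e20.
  have [? ? ?] := stepE N k D cD.
  by exists (fun t => \sum_(i < N) k i * \1_(D i) t); split=> // t; have := H t; rewrite mulrC divfK.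
move=> F cF; split; first exact: cintF.
pose M := La (fun=> 1) + fine (measure_extension c setT) + 1.
have L1 : 0 <= La (fun=> 1) by apply: La0 => //; exists 1 => z _; rewrite normr1.
have m0 : 0 <= fine (measure_extension c setT) by rewrite fine_ge0.
have bF : bdd S (F \o sg) by have [B _ HB] := bT F cF; exists B => z _; exact: HB.
have b1 : bdd S (fun=> 1 : R) by exists 1 => z _; rewrite normr1.
have Lmono G H : bdd S G -> bdd S H -> (forall z, G z <= H z) -> La G <= La H.
  move=> bG bH GH; have bHG := bdd_lin (- 1) bG bH.
  have : 0 <= La (fun z => - 1 * G z + H z) by apply: La0 => // z _; have := GH z; lra.
  by rewrite LaL//; lra.
have near e : 0 < e -> `|\int[measure_extension c]_t F t - La (F \o sg)| <= e * M.
  move=> e0; have [G [FG iG bG eG]] := upper F e cF e0.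
  have h1 : \int[measure_extension c]_t F t <= \int[measure_extension c]_t G t.
    by apply: le_Rintegral => //; [exact: cintF|move=> t _; have /andP[] := FG t].
  have i1 : (measure_extension c).-integrable setT (EFin \o (fun _ : clopen_space T => e)).
    by apply: (intF _ `|e|) => //; exact: measurable_cst.
  have h2 : \int[measure_extension c]_t G t <= \int[measure_extension c]_t F t + e * fine (measure_extension c setT).
    rewrite -Rintegral_cst// -RintegralD//; last exact: cintF.
    by apply: le_Rintegral => //; [exact: (integrableD measurableT (cintF F cF) i1)|move=> t _; have /andP[] := FG t].
  have h3 : La (F \o sg) <= La (G \o sg) by apply: Lmono => // z; have /andP[] := FG (sg z).
  have h4 : La (G \o sg) <= e * La (fun=> 1) + La (F \o sg).
    rewrite -LaL//; apply: Lmono => //; first exact: bdd_lin.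
    by move=> z; have /andP[_] := FG (sg z); rewrite /= mulr1 addrC.
  rewrite ler_norml /M !mulrDr mulr1; rewrite eG in h1 h2.
  have e1 : 0 <= e * La (fun=> 1) by rewrite mulr_ge0// ltW.
  have e2 : 0 <= e * fine (measure_extension c setT) by rewrite mulr_ge0// ltW.
  exact: key h1 h2 h3 h4 e1 e2 e0.
have M0 : 0 < M by rewrite /M ltr_wpDl// addr_ge0.
apply/eqP; rewrite -subr_eq0 -normr_le0; apply/ler_addgt0Pr => e e0; rewrite add0r.
by have := near (e / M); rewrite divfK ?gt_eqF//; apply; rewrite divr_gt0.
Qed.

End clopen_measure.

(** The Alexandroff-Hausdorff theorem, applied to the subset with its induced metric. *)
Lemma cantor_onto_compact (R : realType) (T : pseudoMetricType R) (Y : set T) :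
  hausdorff_space T -> compact Y -> Y !=set0 ->
  exists h : cantor_space -> T, continuous h /\ range h = Y.
Proof.
move=> hT cY [y0 /mem_set Yy0].
pose YT : pseudoPMetricType R := HB.pack (set_type Y) (isPointed.Build (set_type Y) (exist _ y0 Yy0)).
have cv : continuous (set_val : YT -> T) by exact: initial_continuous.
have hYT : hausdorff_space YT.
  move=> p q pq; apply: val_inj; apply: hT => A B nA nB.
  have [z [Az Bz]] := pq _ _ (cv p A nA) (cv q B nB).
  by exists (set_val z).
have cYT : compact [set: YT].
  rewrite compact_cover => I D f oF cvr.
  have /choice [g Hg] i : exists g, D i -> open g /\ f i = set_val @^-1` g.
    have [Di|nDi] := pselect (D i); last by exists set0.
    by have [g og gf] := oF i Di; exists g.
  pose PT : ptopologicalType := HB.pack (PseudoMetric.sort T) (isPointed.Build T y0).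
  have cY' : @compact PT Y := cY.
  move: cY'; rewrite compact_cover => /(_ I D g)[i Di|y Yy|E ED YE].
  - by have [] := Hg i Di.
  - have [i Di fi] := cvr (exist _ y (mem_set Yy)) Logic.I.
    by exists i => //; have [_ Ef] := Hg i Di; move: fi; rewrite Ef.
  - exists E => // z _; have [i Ei gz] := YE (set_val z) (set_valP z).
    by exists i => //; have [_ ->] := Hg i (set_mem (ED i Ei)).
have [f cf] := cantor_surj cYT hYT.
exists (set_val \o f); split.
  by move=> t; apply: continuous_comp; [exact: cf|exact: cv].
apply/seteqP; split=> [_ [t _ <-]|y Yy]; first exact: set_valP.
have [t _ ft] := @surj _ _ _ _ f (exist _ y (mem_set Yy) : YT) Logic.I.
by exists t => //=; rewrite ft.
Qed.

(** * Conditioning on the base point *)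

Section conditioning.
Context d d' (T : measurableType d) (X : measurableType d') (R : realType).
Variables (m : {measure set T -> \bar R}) (pi : T -> X).
Hypotheses (mfin : (m setT < +oo)%E) (mpi : measurable_fun setT pi).

Lemma image_measure : exists mu : {measure set X -> \bar R},
  forall B, mu B = m (pi @^-1` B).
Proof.
by unshelve (eexists (pushforward m pi : {measure set X -> \bar R})).
Qed.

Variable mu : {measure set X -> \bar R}.
Hypothesis muE : forall B, mu B = m (pi @^-1` B).

Let mpre B : measurable B -> measurable (pi @^-1` B).
Proof. by move=> mB; rewrite -[X in measurable X]setTI; exact: mpi. Qed.

(** [tau] is a density on [X] of the image under [pi] of the charge [f dm]. *)
Definition conditional (f : T -> R) (tau : X -> R) :=
  [/\ m.-integrable setT (EFin \o f), mu.-integrable setT (EFin \o tau) &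
  forall B, measurable B -> \int[mu]_(y in B) tau y = \int[m]_(t in pi @^-1` B) f t].

(** Radon-Nikodym: a set that is null for the image of [m] has a null preimage. *)
Lemma conditional_exists f : m.-integrable setT (EFin \o f) -> exists tau, conditional f tau.
Proof.
move=> intf.
have mufin : (mu setT < +oo)%E by rewrite muE preimage_setT.
pose mu' := mfrestr measurableT mufin.
have mu'E A : measurable A -> mu' A = mu A by move=> _; rewrite /mu' /mfrestr /mrestr setIT.
have intE D (F : X -> \bar R) : (\int[mu']_(x in D) F x = \int[mu]_(x in D) F x)%E.
  by apply: eq_measure_integral => A mA _; exact: mu'E.
have [tau [t1 t2 t3]] : exists tau : X -> \bar R,
    [/\ forall y, tau y \is a fin_num, mu.-integrable setT tau &
      forall B, measurable B -> (\int[m]_(t in pi @^-1` B) (f t)%:E = \int[mu]_(y in B) tau y)%E].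
  pose nu0 : {charge set X -> \bar R} := pushforward (induced_charge intf) pi.
  pose nu := nu0 mpi.
  have dom : nu `<< mu'.
    apply/null_content_dominatesP => A mA A0.
    have mA0 : m (pi @^-1` A) = 0%E := etrans (esym (muE A)) (etrans (esym (mu'E A mA)) A0).
    rewrite /nu /nu0 /= /pushforward /induced_charge.
    apply: null_set_integral => //; first exact: mpre.
    by apply: measurable_funTS; exact: measurable_int intf.
  exists (Radon_Nikodym nu mu'); split.
  - by move=> y; exact: Radon_Nikodym_fin_num.
  - have /integrableP[? h] := Radon_Nikodym_integrable dom.
    by apply/integrableP; split; rewrite -?intE.
  - by move=> B mB; rewrite -intE -(Radon_Nikodym_integral dom mB).
exists (fine \o tau); have E : EFin \o (fine \o tau) = tau.
  by apply/funext => y /=; rewrite fineK.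
split=> //; first by rewrite E.
move=> B mB; rewrite /Rintegral t3//; congr fine.
by apply: eq_integral => y _; rewrite /= fineK.
Qed.

Lemma conditional_lin a f f' tau tau' : conditional f tau -> conditional f' tau' ->
  conditional (fun t => a * f t + f' t) (fun y => a * tau y + tau' y).
Proof.
move=> [if1 it1 E1] [if2 it2 E2].
have ZD d0 (U : measurableType d0) (nu : {measure set U -> \bar R}) (u v : U -> R) :
    nu.-integrable setT (EFin \o u) -> nu.-integrable setT (EFin \o v) ->
    nu.-integrable setT (EFin \o (fun z => a * u z + v z)).
  by move=> iu iv; exact: (integrableD measurableT (integrableZl measurableT a iu) iv).
have ZE d0 (U : measurableType d0) (nu : {measure set U -> \bar R}) (u v : U -> R) B :
    nu.-integrable setT (EFin \o u) -> nu.-integrable setT (EFin \o v) -> measurable B ->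
    \int[nu]_(z in B) (a * u z + v z) = a * \int[nu]_(z in B) u z + \int[nu]_(z in B) v z.
  move=> iu iv mB; have iuB := integrableS measurableT mB (@subsetT _ _) iu.
  have ivB := integrableS measurableT mB (@subsetT _ _) iv.
  by rewrite RintegralD// ?RintegralZl//; exact: (integrableZl mB a iuB).
split; [exact: ZD|exact: ZD|move=> B mB].
by rewrite !ZE// ?E1 ?E2//; exact: mpre.
Qed.

Lemma conditional_cst c : conditional (fun=> c) (fun=> c).
Proof.
have icst d0 (U : measurableType d0) (nu : {measure set U -> \bar R}) :
    (nu setT < +oo)%E -> nu.-integrable setT (EFin \o (fun=> c)).
  move=> fin; apply: measurable_bounded_integrable => //.
  by exists `|c|; split; [exact: num_real|move=> x cx t _; exact: ltW].
split; [exact: icst|by apply: icst; rewrite muE preimage_setT|move=> B mB].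
by rewrite !Rintegral_cst//; [rewrite muE|exact: mpre].
Qed.

Lemma conditional_sum d0 (b : 'I_d0 -> R) (s : 'I_d0 -> T -> R) (tau : 'I_d0 -> X -> R) :
  (forall j, conditional (s j) (tau j)) ->
  conditional (fun t => \sum_j b j * s j t) (fun y => \sum_j b j * tau j y).
Proof.
elim: d0 b s tau => [|d0 IH] b s tau Hs.
  have E (U : Type) (u : 'I_0 -> U -> R) : (fun z => \sum_j b j * u j z) = (fun=> 0).
    by apply/funext => z; rewrite big_ord0.
  by rewrite !E; exact: conditional_cst.
have E (U : Type) (u : 'I_d0.+1 -> U -> R) : (fun z => \sum_j b j * u j z) =
    (fun z => b ord0 * u ord0 z + \sum_j b (lift ord0 j) * u (lift ord0 j) z).
  by apply/funext => z; rewrite big_ord_recl.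
by rewrite !E; apply: conditional_lin => //; exact: IH.
Qed.

(** If [f] is nonpositive over [N], so is the integral of [tau] on [N], where [tau] is
    positive. *)
Lemma conditional_null f tau N : conditional f tau -> measurable N ->
  (forall t, N (pi t) -> f t <= 0) -> (forall y, N y -> 0 < tau y) -> mu N = 0%E.
Proof.
move=> [if1 it1 E1] mN f0 tau0.
have iN := integrableS measurableT mN (@subsetT _ _) it1.
have le0 : \int[mu]_(y in N) tau y <= 0.
  rewrite E1//; have := Rintegral_ge0 m (D := pi @^-1` N) (f := fun t => - 1 * f t).
  rewrite RintegralZl//; [|exact: mpre|]; last first.
    by apply: integrableS if1 => //; exact: mpre.
  by rewrite mulN1r oppr_ge0; apply=> t Nt; rewrite mulN1r oppr_ge0; exact: f0.
have ge0 : 0 <= \int[mu]_(y in N) tau y.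
  by apply: Rintegral_ge0 => y Ny; exact/ltW/tau0.
have int0 : (\int[mu]_(y in N) `|(EFin \o tau) y| = 0)%E.
  rewrite (eq_integral (EFin \o tau)); last first.
    by move=> y /set_mem Ny; rewrite /= ger0_norm ?ltW ?tau0.
  have eq0 : \int[mu]_(y in N) tau y = 0 by apply/eqP; rewrite eq_le le0.
  by rewrite -[LHS]fineK ?integrable_fin_num// -[fine _]/(\int[mu]_(y in N) tau y) eq0.
have /(ae_eq_integral_abs mu mN) aeN : measurable_fun N (EFin \o tau).
  exact: measurable_int iN.
have /aeN [A [mA mA0 NA]] := int0.
apply: (subset_measure0 mN mA _ mA0) => y Ny; apply: NA => /= H.
by have [] := H Ny; have := tau0 _ Ny => /[swap] ->; rewrite ltxx.
Qed.

End conditioning.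

Lemma row_continuous {R : realType} {T : topologicalType} d (s : 'I_d -> T -> R) :
  (forall j, continuous (s j)) -> continuous (fun t => \row_j s j t).
Proof.
move=> cs t; apply/cvgrPdist_le => e e0.
have := filter_forall (nbhs_filter t) (f := fun j u => `|s j t - s j u| <= e).
have Hj j : \forall u \near t, `|s j t - s j u| <= e.
  by have /cvgrPdist_le := cs j t; apply.
move=> /(_ Hj); apply: filterS => u Hu; apply: rV_norm_le; first exact: ltW.
by move=> j; rewrite !mxE.
Qed.

Lemma borel_continuous {R : realType} {X : ptopologicalType} (a : X -> R) :
  continuous a -> measurable_fun setT (a : Borel X -> R).
Proof.
move=> ca; apply: (measurability _ (RGenOInfty.measurableE R)) => // _ [_ [x ->] <-].
rewrite setTI; apply: sub_sigma_algebra; move: ca => /continuousP; apply.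
exact: interval_open.
Qed.

Section fiber_hull.
Context {R : realType} {T X : ptopologicalType}.
Hypotheses (cT : compact [set: T]) (hX : hausdorff_space X).
Variables (m : {measure set (clopen_space T) -> \bar R}) (pi : T -> X).
Hypotheses (mfin : (m setT < +oo)%E) (cpi : continuous pi).
Hypothesis mpi : measurable_fun setT (pi : clopen_space T -> Borel X).
Variable mu : {measure set (Borel X) -> \bar R}.
Hypothesis muE : forall B, mu B = m (pi @^-1` B).

(** Almost every value of the conditional expectation lies in the hull of the
    fibre: a half-space with rational data that misses the fibres over a Borel
    set also misses the conditional expectation almost everywhere on that set,
    and there are countably many such half-spaces. *)
Lemma conditional_hull d (s : 'I_d -> T -> R) (tau : 'I_d -> Borel X -> R) :
  (forall j, continuous (s j)) ->
  (forall j, conditional m (pi : clopen_space T -> Borel X) mu (s j) (tau j)) ->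
  {ae mu, forall y : Borel X,
    hull [set \row_j s j t | t in [set t | pi t = y]] (\row_j tau j y)}.
Proof.
move=> cs Hs.
pose rd (q : 'rV[rat]_d * rat) (j : 'I_d) : R := ratr (q.1 ord0 j).
(* [B q] is the set of points whose fibre meets the half-space [q]; it is closed
   because [T] is compact. *)
pose B q := pi @` [set t : T | ratr q.2 <= \sum_j rd q j * s j t].
pose N q : set (Borel X) := ~` B q `&` [set y | ratr q.2 < \sum_j rd q j * tau j y].
have cB q : closed (B q).
  apply: compact_closed => //; apply: continuous_compact; first exact: continuous_subspaceT.
  apply: (subclosed_compact _ cT) => //.
  apply: (@closed_comp _ _ (fun t => \sum_j rd q j * s j t) [set z | ratr q.2 <= z]); last exact: closed_ge.
  move=> t _; apply: continuous_sum => j u.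
  by apply: cvgM; [exact: cvg_cst|exact: cs].
have N0 q : measurable (N q) /\ mu (N q) = 0%E.
  have cond : conditional m (pi : clopen_space T -> Borel X) mu
      (fun t => 1 * (\sum_j rd q j * s j t) + (- ratr q.2))
      (fun y => 1 * (\sum_j rd q j * tau j y) + (- ratr q.2)).
    apply: conditional_lin => //; last exact: conditional_cst.
    exact: conditional_sum.
  have mN : measurable (N q).
    apply: measurableI.
      by apply: sub_sigma_algebra; exact: closed_openC.
    have [_ it _] := cond.
    have /measurable_EFinP mt := measurable_int _ it.
    have := mt measurableT _ (measurable_itv `]0, +oo[); rewrite setTI.
    congr measurable; apply/seteqP; split=> y /=; rewrite in_itv/= andbT mul1r; lra.
  split=> //; apply: (conditional_null mpi cond) => //.
    move=> t [nB _]; rewrite mul1r; rewrite leNgt; apply/negP => H.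
    by apply: nB; exists t => //=; lra.
  by move=> y [_] /=; rewrite mul1r; lra.
have NE : mu.-negligible (\bigcup_n (if (choice.unpickle n : option ('rV[rat]_d * rat)) is Some q then N q else set0)).
  apply: negligible_bigcup => n; case: (choice.unpickle n) => [q|]; last exact: negligible_set0.
  by have [? ?] := N0 q; exists (N q); split.
apply: negligibleS NE => y /= nh; apply: contrapT => nE; apply: nh.
have {}nE q : ~ N q y by move=> Nq; apply: nE; exists (choice.pickle q) => //; rewrite choice.pickleK.
set G := [set _ | _ in _]; pose ta := \row_j tau j y.
have cG : compact G.
  apply: continuous_compact; first exact: continuous_subspaceT (row_continuous cs).
  apply: (subclosed_compact _ cT) => //.
  apply: (@closed_comp _ _ pi [set y]) => [t _|]; first exact: cpi.
  by have := @accessible_closed_set1 X (hausdorff_accessible hX) y.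
apply: hull_of_support => // b; apply: contrapT => nG.
have [de de0 Hde] : exists2 de, 0 < de & forall xi, G xi -> dot b xi <= dot b ta - de.
  have [neG|emG] := pselect (G !=set0); last first.
    by exists 1 => // xi Gxi; exfalso; apply: emG; exists xi.
  have [c Gc Hc] : exists2 c, c \in G & forall v, v \in G -> dot b v <= dot b c.
    apply: EVT_max_rV => //; apply: continuous_subspaceT => v.
    have -> : dot b = (fun z => \sum_j b 0 j * z 0 j) by apply/funext => z; rewrite dotE.
    apply: continuous_sum => j u.
    apply: (@continuousM R _ (fun=> b 0 j) (fun z : 'rV[R]_d => z 0 j)); last exact: coord_continuous.
    exact: cst_continuous.
  exists (dot b ta - dot b c); last by move=> v Gv; rewrite subKr; apply: Hc; exact/mem_set.
  rewrite subr_gt0 ltNge; apply/negP => H; apply: nG; exists c => //; exact: set_mem.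
have [C C0 HC] : exists2 C, 0 <= C & forall xi, G xi \/ xi = ta -> forall j, `|xi 0 j| <= C.
  have [C [_ HC]] := compact_bounded cG.
  exists (`|C| + 1 + `|ta|) => [|xi Gxi j]; first by rewrite !addr_ge0.
  apply: le_trans (coord_le_norm _ _) _; case: Gxi => [Gxi| ->]; last by rewrite lerDr addr_ge0.
  rewrite (le_trans (HC (`|C| + 1) _ _ Gxi)) ?lerDl//.
  by rewrite (le_lt_trans (ler_norm C))// ltrDl.
pose eta := de / (4 * (d%:R * C + 1)).
have den : 0 < 4 * (d%:R * C + 1) :> R by rewrite mulr_gt0// ltr_wpDl// mulr_ge0.
have eta0 : 0 < eta by rewrite divr_gt0.
have /choice [be Hbe] (j : 'I_d) : exists be : rat, `|ratr be - b 0 j| <= eta.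
  have [be] := @rat_in_itvoo R (b 0 j - eta) (b 0 j + eta) ltac:(lra).
  by rewrite in_itv/= => /andP[h1 h2]; exists be; rewrite ler_norml; apply/andP; split; lra.
have [r] := @rat_in_itvoo R (dot b ta - 3 / 4 * de) (dot b ta - de / 4) ltac:(lra).
rewrite in_itv/= => /andP[r1 r2].
pose q : 'rV[rat]_d * rat := (\row_j be j, r).
have close xi : (G xi \/ xi = ta) -> `|\sum_j rd q j * xi 0 j - dot b xi| <= de / 4.
  move=> Gxi; rewrite dotE -sumrB; apply: le_trans (ler_norm_sum _ _ _) _.
  have : \sum_(j < d) `|rd q j * xi 0 j - b 0 j * xi 0 j| <= \sum_(j < d) eta * C.
    apply: ler_sum => j _; rewrite -mulrBl normrM ler_pM//; last exact: HC.
    by rewrite /rd /q mxE; exact: Hbe.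
  have -> : de / 4 = eta * (d%:R * C + 1).
    by rewrite /eta invfM mulrA -[RHS]mulrA mulVf ?mulr1// gt_eqF// ltr_wpDl// mulr_ge0.
  move/le_trans; apply; rewrite sumr_const card_ord -[X in X <= _]mulr_natl.
  by rewrite mulrCA ler_pM2l// lerDl.
apply: (nE q); split=> [[t /= rt pt]|/=].
  have Gt : G (\row_j s j t) by exists t.
  have := close _ (or_introl Gt); have := Hde _ Gt.
  rewrite (eq_bigr (fun j => rd q j * s j t)); last by move=> j _; rewrite mxE.
  by rewrite ler_norml => h1 /andP[h2 h3]; lra.
have := close ta (or_intror erefl).
rewrite (eq_bigr (fun j => rd q j * tau j y)); last by move=> j _; rewrite mxE.
by rewrite ler_norml => /andP[h2 h3]; lra.
Qed.

(** Pulling a function of the base point out of a conditional expectation: on the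
    fibre over [y] the function [a \o pi * f] is [a y] times [f], and the hull
    inherits this linear relation. *)
Lemma conditional_pull (f : T -> R) (tau : Borel X -> R) (a : X -> R) :
  continuous a -> continuous f ->
  conditional m (pi : clopen_space T -> Borel X) mu f tau ->
  m.-integrable setT (EFin \o (fun t : clopen_space T => a (pi t) * f t)) ->
  mu.-integrable setT (EFin \o (fun y => a y * tau y)) /\
  \int[mu]_y (a y * tau y) = \int[m]_t (a (pi t) * f t).
Proof.
move=> ca cf Hf iaf; have [tau' Htau'] := conditional_exists mfin mpi muE iaf.
(* Condition both functions at once, so that their values come from the same points
   of the fibre. *)
pose s (j : 'I_2) t := if j == 0 then f t else a (pi t) * f t.
pose ta (j : 'I_2) y := if j == 0 then tau y else tau' y.
have cs j : continuous (s j).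
  rewrite /s; case: (j == 0); first exact: cf.
  by move=> t; apply: cvgM; [apply: continuous_comp; [exact: cpi|exact: ca]|exact: cf].
have Hs j : conditional m (pi : clopen_space T -> Borel X) mu (s j) (ta j).
  by rewrite /s /ta; case: (j == 0).
have ae : {ae mu, forall y : Borel X, a y * tau y = tau' y}.
  have := conditional_hull cs Hs; apply: filterS => y [c [xi [_ Hxi E]]].
  have E0 j : ta j y = \sum_k c k * xi k 0 j.
    have := congr1 (fun v : 'rV[R]_2 => v 0 j) E; rewrite summxE mxE => <-.
    by apply: eq_bigr => k _; rewrite mxE.
  rewrite -[tau y]/(ta 0 y) -[tau' y]/(ta 1 y) !E0 mulr_sumr; apply: eq_bigr => k _.
  by have [t pt <-] := Hxi k; rewrite !mxE /s/= -pt mulrCA.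
have [_ it Et] := Hf; have [_ it' Et'] := Htau'.
have mt := measurable_int _ it; have mt' := measurable_int _ it'.
have mat : measurable_fun setT (EFin \o (fun y : Borel X => a y * tau y)).
  apply/measurable_EFinP; apply: measurable_funM; first exact: borel_continuous.
  exact/measurable_EFinP.
have aeq : ae_eq mu setT (EFin \o (fun y : Borel X => a y * tau y)) (EFin \o tau').
  by move: ae; apply: filterS => y + _ /= => ->.
split.
  apply/integrableP; split=> //.
  have /integrableP[_] := it'; apply: le_lt_trans.
  rewrite le_eqVlt; apply/orP; left; apply/eqP; apply: ae_eq_integral => //.
  - exact: measurableT_comp.
  - exact: measurableT_comp.
  - by move: ae; apply: filterS => y + _ /= => ->.
rewrite /Rintegral (ae_eq_integral _ _ measurableT mat mt' aeq).
by have := Et' _ measurableT; rewrite preimage_setT /Rintegral.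
Qed.

End fiber_hull.

(** * Positive functionals on planes are currents *)

(** On a compact set a continuous injection into a Hausdorff space is closed, so the
    preimages of closed sets under [q] are preimages of closed sets under the
    composite. *)
Lemma lift_continuous (T Q W : topologicalType) (S : set Q) (emb : Q -> W) (q : T -> Q) :
  hausdorff_space W -> compact S -> continuous emb ->
  (forall a b, S a -> S b -> emb a = emb b -> a = b) -> (forall t, S (q t)) ->
  continuous (emb \o q) -> continuous q.
Proof.
move=> hW cS cemb inj Sq ceq; apply/continuous_closedP => F cF.
have -> : q @^-1` F = (emb \o q) @^-1` (emb @` (S `&` F)).
  apply/seteqP; split=> [t Ft|t [a [Sa Fa] /= /inj eq_a]]; first by exists (q t).
  by rewrite -eq_a//.
move: ceq => /continuous_closedP; apply; apply: compact_closed => //.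
apply: continuous_compact; first exact: continuous_subspaceT.
exact: compact_closedI.
Qed.

Section plane_measure.
Context {R : realType} {X : ptopologicalType} {n p : nat}.
Variable M : smooth_manifold R X n.
Variable g : riemannian_metric M.
Local Notation C := (smoothfun M).
Local Notation VF := (vfield M).
Variables (phi : cochain M p) (A : set X).
Hypotheses (fphi : is_form phi) (cA : compact A).

Definition planes : set (X * ('I_p -> VF)) := [set z | A z.1 /\ oplane g phi z.1 z.2].

Variable La : (X * ('I_p -> VF) -> R) -> R.
Hypothesis LaL : forall a F G, bdd planes F -> bdd planes G ->
  La (fun z => a * F z + G z) = a * La F + La G.
Hypothesis La0 : forall F, bdd planes F -> (forall z, planes z -> 0 <= F z) -> 0 <= La F.

Lemma functional_congr F G : bdd planes F -> bdd planes G ->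
  (forall z, planes z -> F z = G z) -> La F = La G.
Proof.
move=> bF bG FG.
have H F' G' : bdd planes F' -> bdd planes G' -> (forall z, planes z -> F' z = G' z) -> La F' <= La G'.
  move=> bF' bG' FG'; have : 0 <= La (fun z => - 1 * F' z + G' z).
    by apply: La0 => [|z pz]; [exact: bdd_lin|rewrite FG'//; lra].
  by rewrite LaL//; lra.
by apply/eqP; rewrite eq_le !H// => z pz; rewrite FG.
Qed.

(** Compact neighbourhoods are closed. *)
Lemma manifold_regular (x : X) (U : set X) : open U -> U x ->
  exists N F : set X, [/\ open N, N x, N `<=` F, closed F & F `<=` U].
Proof.
move=> oU Ux; have [b [N [F [oN Nx NF [FU cF] _]]]] := sf_bump M oU Ux.
exists N, F; split=> //; apply: compact_closed => //; exact: (manifold_hausdorff M).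
Qed.

Lemma frame_eval (B : set X) K (E : 'I_K -> VF) (u : 'I_K -> C) (b : C) :
  (forall (V : VF) f, b * V f = \sum_l V (u l) * E l f) -> (forall y, B y -> b y = 1) ->
  forall y (V : VF) f, B y -> V f y = \sum_l V (u l) y * E l f y.
Proof.
move=> H1 b1 y V f By; have := congr1 (fun h : C => h y) (H1 V f).
by rewrite sfM b1// mul1r sf_sum => ->; apply: eq_bigr => l _; rewrite sfM.
Qed.

Lemma bdd_form w : is_form w -> bdd planes (fun z => w z.2 z.1).
Proof.
move=> fw; have [K [N [E [u [b [s [H1 b1 sep]]]]]]] := compact_framed M cA.
have EV := frame_eval H1 b1.
have [c c0 Hc] := planes_bounded g cA EV fphi fw.
by exists c => -[y V] /= [Ay oV]; exact: Hc.
Qed.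

(** The planes embed into a Euclidean space as a compact set, hence are a continuous
    image of the Cantor space, where the functional is a measure. Conditioning this
    measure on the base point averages the planes over each point, and a form, being
    a polynomial in the encoding with coefficients on the base, can be integrated
    after conditioning. *)
Theorem plane_representation : exists (mu : {measure set (Borel X) -> \bar R})
    (tau : Borel X -> cochain M p -> R),
  [/\ (mu setT < +oo)%E /\ mu (~` A) = 0%E,
      forall w, is_form w -> measurable_fun setT (tau^~ w),
      {ae mu, forall y, plane_hull g phi y (tau y)} &
      forall w, is_form w -> ((La (fun z => w z.2 z.1))%:E = \int[mu]_y (tau y w)%:E)%E].
Proof.
have [[z0 pz0]|noz] := pselect (planes !=set0); last first.
  have b0 (F : _ -> R) : bdd planes F by exists 0 => z pz; exfalso; apply: noz; exists z.
  exists mzero, (fun _ _ => 0); split=> //; first by rewrite /mzero ltry.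
    by exists setT; split=> //.
  move=> w fw; rewrite integral0; congr (_%:E).
  rewrite (@functional_congr _ (fun z => - 1 * 0 + 0))//.
    by rewrite (LaL _ (b0 _) (b0 _)); lra.
  by move=> z pz; exfalso; apply: noz; exists z.
have hX := manifold_hausdorff M.
have [K [N [E [u [b [s [H1 b1 sep]]]]]]] := compact_framed M cA.
have EV := frame_eval H1 b1.
pose S : set (X * 'rV[R]_(p * K)) := enc_planes g A u phi.
have cS : compact S by exact: (enc_planes_compact cA EV fphi).
pose emb (q : X * 'rV[R]_(p * K)) : 'rV[R]_(N + p * K) := row_mx (\row_l s l q.1) q.2.
have cemb : continuous emb.
  have -> : emb = (fun q => \row_j (match fintype.split j with inl l => s l q.1 | inr k => q.2 0 k end)).
    by apply/funext => q; apply/rowP => j; rewrite [RHS]mxE /emb mxE; case: fintype.split => k; rewrite ?mxE.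
  apply: row_continuous => j; case: fintype.split => k q.
    exact: base_continuous.
  apply: (@continuous_comp _ _ _ snd (fun v : 'rV[R]_(p * K) => v 0 k)); first exact: cvg_snd.
  exact: coord_continuous.
have injemb q q' : S q -> S q' -> emb q = emb q' -> q = q'.
  move: q q' => [y v] [y' v'] [/= Ay _] _ /eq_row_mx[/= ss ->]; congr pair.
  by apply: sep => // l; have := congr1 (fun r : 'rV[R]_N => r 0 l) ss; rewrite !mxE.
have nS : emb @` S !=set0.
  by exists (emb (z0.1, encode u z0.2 z0.1)); exists (z0.1, encode u z0.2 z0.1) => //; case: pz0 => ? ?; split=> //; exists z0.2.
have cY : compact (emb @` S) by apply: continuous_compact => //; exact: continuous_subspaceT.
have [theta [cth rth]] := cantor_onto_compact (@norm_hausdorff _ _) cY nS.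
have /choice [q Hq] t : exists q, S q /\ emb q = theta t.
  have [q Sq qt] : (emb @` S) (theta t) by rewrite -rth; exists t.
  by exists q.
have Sq t : S (q t) by have [] := Hq t.
have embq : emb \o q = theta by apply/funext => t; have [_] := Hq t.
have cq : continuous q.
  apply: (lift_continuous (@norm_hausdorff _ _) cS cemb injemb Sq).
  by rewrite embq.
have /choice [sg Hsg] z : exists t, planes z -> q t = (z.1, encode u z.2 z.1).
  have [[Az oz]|nz] := pselect (planes z); last by exists point.
  have Se : S (z.1, encode u z.2 z.1) by split=> //; exists z.2.
  have : (emb @` S) (emb (z.1, encode u z.2 z.1)) by exists (z.1, encode u z.2 z.1).
  rewrite -rth => -[t _ et]; exists t => _; apply: (injemb _ _ (Sq t) Se).
  by rewrite -et; have [] := Hq t.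
have [m [mfin mE]] := clopen_representation sg cantor_space_compact
  cantor_space_hausdorff cantor_zero_dimensional LaL La0.
pose pi t := (q t).1; pose sI (I : {ffun 'I_p -> 'I_K}) t := monom (q t).2 I.
have cpi : continuous pi.
  by move=> t; apply: (@continuous_comp _ _ _ q fst); [exact: cq|exact: cvg_fst].
have csI I : continuous (sI I).
  move=> t; apply: (@continuous_comp _ _ _ q (fun z => monom z.2 I)); first exact: cq.
  exact: monom_continuous.
have ceval w : continuous (eval_form E w \o q).
  by move=> t; apply: continuous_comp; [exact: cq|exact: eval_form_continuous].
have mpi : measurable_fun setT (pi : clopen_space cantor_space -> Borel X).
  apply: (clopen_borel cantor_space_compact cantor_space_hausdorff cantor_zero_dimensional) => //.
    exact: (manifold_second_countable M).
  exact: manifold_regular.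
have [mu muE] := image_measure m mpi.
have /choice [tau Htau] I := conditional_exists mfin mpi muE (mE _ (csI I)).1.
have cterm (w : cochain M p) (I : {ffun 'I_p -> 'I_K}) :
    continuous (fun t => w (fun k => E (I k)) (pi t) * sI I t).
  apply: continuous_mul (csI I) => t.
  by apply: (@continuous_comp _ _ _ pi); [exact: cpi|exact: smooth_continuous].
have pull (w : cochain M p) (I : {ffun 'I_p -> 'I_K}) :=
  conditional_pull cantor_space_compact hX mfin cpi mpi muE
  (@smooth_continuous _ _ _ M (w (fun k => E (I k)))) (csI I) (Htau I) (mE _ (cterm w I)).1.
pose tw (y : X) (w : cochain M p) := \sum_(I : {ffun 'I_p -> 'I_K}) w (fun k => E (I k)) y * tau I y.
have tw_int w : mu.-integrable setT (EFin \o (fun y => tw y w)) /\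
    \int[mu]_y tw y w = \sum_(I : {ffun 'I_p -> 'I_K}) \int[mu]_y (w (fun k => E (I k)) y * tau I y).
  by apply: Rintegral_sum => // I; have [] := pull w I.
exists mu, tw; split.
- split; first by rewrite muE preimage_setT.
  rewrite muE (_ : pi @^-1` _ = set0) ?measure0//.
  by rewrite -subset0 => t; have [] := Sq t.
- by move=> w _; apply/measurable_EFinP; have [/measurable_int] := tw_int w.
- pose e (j : 'I_#|{ffun 'I_p -> 'I_K}|) := enum_val j.
  have := conditional_hull cantor_space_compact hX mfin cpi mpi muE
    (fun j => csI (e j)) (fun j => Htau (e j)).
  apply: filterS => y [c [xi [[c0 c1] Hxi cxi]]].
  have tauE I : tau I y = \sum_k c k * xi k 0 (enum_rank I).
    have := congr1 (fun v : 'rV[R]_#|{ffun 'I_p -> 'I_K}| => v 0 (enum_rank I)) cxi.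
    rewrite summxE mxE /e enum_rankK => <-.
    by apply: eq_bigr => k _; rewrite mxE.
  have /choice [V HV] k : exists V, [/\ A y, oplane g phi y V &
      forall I, xi k 0 (enum_rank I) = monom (encode u V y) I].
    have [t pt <-] := Hxi k; have [At [V [oV qV]]] := Sq t.
    rewrite -[(q t).1]/(pi t) pt in At oV qV; exists V; split=> // I.
    by rewrite mxE /e enum_rankK /sI qV.
  exists _, c, V; split=> // [k|w fw].
    have [_ [oV phiV] _] := HV k; split=> //; exact: orthonormal_unit.
  rewrite /tw; under eq_bigr do rewrite tauE mulr_sumr.
  rewrite exchange_big /=; apply: eq_bigr => k _.
  have [Ay _ Hk] := HV k; rewrite -(eval_formE EV _ fw Ay) /eval_form mulr_sumr.
  by apply: eq_bigr => I _; rewrite Hk /= mulrCA [X in _ * X]mulrC.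
- move=> w fw; have [iw ew] := tw_int w.
  rewrite -[RHS]fineK; last exact: integrable_fin_num.
  congr (_%:E); rewrite -[RHS]/(\int[mu]_y tw y w) ew.
  have [iF eF] := mE _ (ceval w).
  rewrite (@functional_congr _ ((eval_form E w \o q) \o sg)); last first.
  + by move=> z pz /=; rewrite Hsg// (eval_formE EV _ fw)//; case: pz.
  + have [c c0 Hc] := compact_bounded_fun cantor_space_compact (ceval w).
    by exists c => z _; exact: Hc.
  + exact: bdd_form.
  rewrite -eF; have := Rintegral_sum (mu := m) (index_enum {ffun 'I_p -> 'I_K}) measurableT
    (f := fun I t => w (fun k => E (I k)) (pi t) * sI I t).
  move=> /(_ (fun I => (mE _ (cterm w I)).1))[_ e2].
  rewrite (_ : Rintegral m setT (eval_form E w \o q) =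
     \int[m]_t \sum_(I : {ffun 'I_p -> 'I_K}) w (fun k => E (I k)) (pi t) * sI I t).
    by rewrite e2; apply: eq_bigr => I _; have [_ ->] := pull w I.
  by congr Rintegral; apply/funext => t; apply: eq_bigr => I _; rewrite mulrC.
Qed.

End plane_measure.

(** * The functional attached to a point of the hull *)

Section cutoff.
Context {R : realType} {X : topologicalType} {n : nat}.
Variable M : smooth_manifold R X n.
Local Notation C := (smoothfun M).

Lemma plateau_smooth s (h : C) : plateau s \o h \in smooth M.
Proof.
apply/smoothP => c Mc k; rewrite -compA; apply: Ck_plateau; first exact: open_codom Mc.
by move=> k'; have /smoothP := valP h; apply.
Qed.

Lemma cutoff (h : C) (c : R) : exists eta : C,
  (forall y, h y <= c -> eta y = 1) /\ (forall y, c + 1 <= h y -> eta y = 0).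
Proof.
have s := plateau_smooth 1 (h - c *: (1 : C)).
exists (SmoothFun s); have E y : (h - c *: (1 : C)) y = h y - c by rewrite sfB sfZ sf1 mulr1.
split=> y hy.
  change (plateau 1 ((h - c *: (1 : C)) y) = 1).
  by rewrite E; apply: plateau1 => //; lra.
change (plateau 1 ((h - c *: (1 : C)) y) = 0).
by rewrite E; apply: plateau0; lra.
Qed.

End cutoff.

Section green_construction.
Context {R : realType} {X : ptopologicalType} {n p : nat}.
Variable M : smooth_manifold R X n.
Variable g : riemannian_metric M.
Local Notation C := (smoothfun M).
Local Notation VF := (vfield M).
Variable phi : cochain M p.+1.
Hypotheses (cal : calibration g phi) (par : parallel g phi).

(** From here on the connection is hidden in the hypothesis that [phi] is parallel. *)
Lemma dd_form f : is_form (ddphi g phi f).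
Proof. by have [fphi _ _] := cal; have [nabla LC pa] := par; exact: ddphi_form fphi LC pa f. Qed.

Lemma dd_lin a f h V y :
  ddphi g phi (a *: f + h) V y = a * ddphi g phi f V y + ddphi g phi h V y.
Proof.
have [fphi _ _] := cal; have [nabla LC pa] := par.
by rewrite (ddphi_lin fphi LC pa) sfD sfZ.
Qed.

Lemma dd_cst a V y : ddphi g phi (a *: (1 : C)) V y = 0.
Proof. by have [fphi _ _] := cal; have [nabla LC pa] := par; rewrite (ddphi_cst fphi LC pa). Qed.

Lemma dd_affine a b f V y :
  ddphi g phi (a *: f + b *: (1 : C)) V y = a * ddphi g phi f V y.
Proof. by rewrite dd_lin dd_cst; exact: addr0. Qed.

Lemma dd_loc (f h : C) (U : set X) y V : open U -> U y ->
  (forall z, U z -> f z = h z) -> ddphi g phi f V y = ddphi g phi h V y.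
Proof.
have [fphi _ _] := cal; have [nabla LC pa] := par => oU Uy fh.
exact: (ddphi_loc fphi LC pa V oU Uy fh).
Qed.

Lemma dd_expn (f : C) k V y : oplane g phi y V -> 0 <= f y ->
  k.+2%:R * f y ^+ k.+1 * ddphi g phi f V y <= ddphi g phi (f ^+ k.+2) V y.
Proof.
have [fphi _ _] := cal; have [nabla LC pa] := par.
by move=> [oV phiV] fy; exact: ddphi_expn fphi LC pa f k V y cal oV phiV fy.
Qed.

Lemma oplane_plane y V : oplane g phi y V -> phi_plane g phi y V.
Proof. by move=> [oV phiV]; split=> //; exact: orthonormal_unit. Qed.

(** Positivity need only be tested on orthonormal frames, which carry all values of
    forms at unit simple vectors. *)
Lemma oplane_psh f : (forall y V, oplane g phi y V -> 0 <= ddphi g phi f V y) -> psh g phi f.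
Proof.
move=> H y V [uV phiV]; have [V' [oV' E]] := orthonormalize uV.
rewrite -(E _ (dd_form f)); apply: H; split=> //.
by rewrite E//; case: cal.
Qed.

(** Adding a constant to the exhaustion function only relabels its sublevel sets and
    does not change [dd^phi]; a function at least 1 has plurisubharmonic powers. *)
Lemma exhaustion : strictly_convex g phi -> exists h : C,
  [/\ forall y V, oplane g phi y V -> 0 < ddphi g phi h V y,
      forall c, compact [set y | h y <= c] & forall y, 1 <= h y].
Proof.
move=> [h sh ch]; pose x0 : X := point.
have [B B0 HB] := compact_bounded_fun (ch (h x0)) (@smooth_continuous _ _ _ _ h).
have hB y : - B <= h y.
  have [hy|hy] := leP (h y) (h x0); first by have := HB y hy; rewrite ler_norml => /andP[].
  by have := HB x0 (lexx _); rewrite ler_norml => /andP[]; lra.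
have E y : (1 *: h + (B + 1) *: (1 : C)) y = h y + (B + 1).
  by rewrite sfD !sfZ sf1 mul1r mulr1.
exists (1 *: h + (B + 1) *: (1 : C)); split.
- by move=> y V /oplane_plane pV; rewrite dd_affine mulr_gt0//; exact: sh.
- move=> c; have := ch (c - (B + 1)); congr compact; apply/seteqP.
  by split=> y; rewrite /mkset E; lra.
- by move=> y; rewrite E; have := hB y; lra.
Qed.

Variables (h : C) (K : set X) (x : X) (c0 : R).
Hypotheses (hpos : forall y V, oplane g phi y V -> 0 < ddphi g phi h V y).
Hypotheses (ch : forall c, compact [set y | h y <= c]) (h1 : forall y, 1 <= h y).
Hypotheses (hK : forall y, K y -> h y <= c0) (hx : h x <= c0) (c01 : 1 <= c0).

Let A := [set y | h y <= c0 + 2].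

(** A function that is plurisubharmonic over a sublevel set of [h] becomes globally
    plurisubharmonic when it is cut off and a high power of a multiple of [h] is
    added, which is small on [K] and very plurisubharmonic where the cutoff acts. If
    [f] were positive at [x], this function would be larger at [x] than on [K]. *)
Lemma hull_functional (f : C) : psh_hull g phi K x ->
  (forall y V, A y -> oplane g phi y V -> 0 <= ddphi g phi f V y) ->
  (forall y, K y -> f y <= 0) -> f x <= 0.
Proof.
have [c1 hx'] := (c01, hx).
move=> Kx fpos fK; rewrite leNgt; apply/negP => fx0.
have fphi : is_form phi by case: cal.
have [K' [N [E [u [b [s [H1 b1 sep]]]]]]] := compact_framed M (@ch (c0 + 2)).
have EV := frame_eval H1 b1.
have [eta [eta1 eta0]] := cutoff h (c0 + 1).
(* Dividing [h] by [q] makes its powers small on [K], where [h <= c0 < q], and large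
   where [h >= c0 + 1 > q]. *)
have [q [q1 q2]] : exists q, c0 < q /\ q < c0 + 1 by exists (c0 + 1 / 2); split; lra.
have q0 : 0 < q by apply: lt_trans q1; apply: lt_le_trans c01.
pose r := q^-1; have r0 : 0 < r by rewrite invr_gt0.
pose k : C := r *: h + 0 *: (1 : C).
have kE y : k y = r * h y by rewrite /k sfD !sfZ mul0r addr0.
have ddk y V : ddphi g phi k V y = r * ddphi g phi h V y by exact: dd_affine.
have [d d0 Hd] := planes_positive (@ch (c0 + 2)) EV fphi (dd_form k)
  (fun y V _ oV => eq_ind_r (fun t => 0 < t) (mulr_gt0 r0 (hpos oV)) (ddk y V)).
have [B B0 HB] := planes_bounded g (@ch (c0 + 2)) EV fphi (dd_form (eta * f)).
pose rho := r * c0.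
have rho01 : 0 <= rho < 1.
  rewrite /rho mulr_ge0 ?(ltW r0)//=; last by lra.
  by rewrite mulrC ltr_pdivrMr ?mul1r.
have [N1 HN1] : exists N1 : nat, B <= N1%:R * d.
  exists (Num.truncn (B / d)).+1; rewrite -ler_pdivrMr//.
  by apply: ltW; exact: truncnS_gt.
have [N2 HN2] : exists N2 : nat, forall m, (N2 <= m)%N -> rho ^+ m < f x.
  have /cvgrPdist_lt /(_ _ fx0) [N2 _ H] : (GRing.exp rho : nat -> R) x @[x --> \oo] --> 0.
    by apply: cvg_expr; rewrite ger0_norm; case/andP: rho01.
  by exists N2 => m /H /=; rewrite sub0r normrN; apply: le_lt_trans; exact: ler_norm.
pose m := (N1 + N2)%N.
pose F : C := 1 *: (eta * f) + k ^+ m.+2.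
have ddF y V : ddphi g phi F V y = ddphi g phi (eta * f) V y + ddphi g phi (k ^+ m.+2) V y.
  by rewrite /F dd_lin mul1r.
have k0 y : 0 <= k y by rewrite kE mulr_ge0 ?(ltW r0)//; have := h1 y; lra.
have ddk0 y V : oplane g phi y V -> 0 <= ddphi g phi (k ^+ m.+2) V y.
  move=> oV; apply: le_trans (dd_expn m oV (k0 y)).
  by rewrite !mulr_ge0 ?exprn_ge0// ddk mulr_ge0 ?(ltW r0)// ltW// hpos.
have oh (D : set R) : open D -> open (h @^-1` D).
  by move=> oD; have /continuousP := @smooth_continuous _ _ _ _ h; apply.
have pF : psh g phi F.
  apply: oplane_psh => y V oV; rewrite ddF.
  have [hy|hy] := ltP (h y) (c0 + 1).
    apply: addr_ge0; last exact: ddk0.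
    rewrite (@dd_loc _ f (h @^-1` `]-oo, c0 + 1[))//.
    - by apply: fpos => //; rewrite /A /=; lra.
    - exact/oh/interval_open.
    - move=> z hz; rewrite sfM eta1 ?mul1r//.
      by move: hz; rewrite /= in_itv/=; exact: ltW.
  have [hy2|hy2] := leP (h y) (c0 + 2).
    have := HB y V hy2 oV; rewrite ler_norml => /andP[HB1 _].
    have := dd_expn m oV (k0 y); have := Hd y V hy2 oV => Hd1 Hex.
    have k1 : 1 <= k y ^+ m.+1.
      by rewrite exprn_ege1// kE mulrC ler_pdivlMr ?mul1r//; lra.
    have : B <= m.+2%:R * k y ^+ m.+1 * ddphi g phi k V y.
      apply: le_trans HN1 _; rewrite ler_pM//; first exact: ltW.
      rewrite -[N1%:R]mulr1 ler_pM// ler_nat.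
      by rewrite /m -addn2 -addnA leq_addr.
    by lra.
  rewrite (@dd_loc _ (0 *: (1 : C)) (h @^-1` `]c0 + 2, +oo[))//.
  - by rewrite dd_cst add0r; exact: ddk0.
  - exact/oh/interval_open.
  - by rewrite /= in_itv/= andbT.
  - move=> z hz; rewrite sfM eta0 ?mul0r ?sfZ ?mul0r//.
    by move: hz; rewrite /= in_itv/= andbT; lra.
have := Kx F pF; apply/negP; rewrite -ltNge.
apply: (@le_lt_trans _ _ (rho ^+ m.+2)%:E).
  apply: ge_ereal_sup => _ [y Ky <-]; rewrite lee_fin /F sfD sfZ mul1r sfM sfX.
  rewrite eta1; last by have := hK Ky; lra.
  rewrite mul1r -[X in _ <= X]add0r lerD ?fK//.
  rewrite lerXn2r ?nnegrE//; first by case/andP: rho01.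
  by rewrite kE /rho ler_pM2l// hK.
rewrite lte_fin; apply: lt_le_trans (HN2 m.+2 _) _; first by rewrite /m -addn2 addnAC leq_addl.
rewrite /F sfD sfZ mul1r sfM sfX eta1; last by lra.
by rewrite mul1r lerDl exprn_ge0.
Qed.

End green_construction.

(** * Construction of the Green current *)

Section green_exists.
Context {R : realType} {X : ptopologicalType} {n : nat}.
Variable M : smooth_manifold R X n.
Variable g : riemannian_metric M.
Local Notation C := (smoothfun M).
Local Notation VF := (vfield M).

(** This bounds a current given by a functional on planes by one seminorm of order 0. *)
Lemma planes_seminorm p (phi : cochain M p) (A : set X) : is_form phi -> compact A ->
  exists (N : nat) (W : 'I_N -> 'I_p -> VF) (m : R), forall w, is_form w ->
    forall b, 0 <= b -> (forall k y, A y -> `|w (W k) y| <= b) ->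
    forall y V, A y -> oplane g phi y V -> `|w V y| <= m * b.
Proof.
move=> fphi cA; have [K [N [E [u [b0 [s [H1 b1 _]]]]]]] := compact_framed M cA.
have EV := frame_eval H1 b1.
have /choice [c Hc] (I : {ffun 'I_p -> 'I_K}) : exists c, 0 <= c /\
    forall y V, A y -> oplane g phi y V -> `|monom (encode u V y) I| <= c.
  have [c c0 Hc] := compact_bounded_fun (enc_planes_compact (g := g) cA EV fphi)
    (@monom_continuous _ _ _ _ I).
  by exists c; split=> // y V Ay oV; apply: (Hc (y, encode u V y)); split=> //; exists V.
exists #|{ffun 'I_p -> 'I_K}|, (fun k i => E ((enum_val k : {ffun 'I_p -> 'I_K}) i)), (\sum_I c I).
move=> w fw b b_ge0 Hb y V Ay oV; rewrite -(eval_formE EV V fw Ay) /eval_form mulr_suml.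
apply: le_trans (ler_norm_sum _ _ _) _; apply: ler_sum => I _.
rewrite normrM ler_pM//; first by have [_ H] := Hc I; exact: H.
by have := Hb (enum_rank I) y Ay; rewrite enum_rankK.
Qed.

(** The degree 0 case of the representation: a positive functional on the
    functions on a compact set is a measure. *)
Lemma compact_representation (K : set X) (La : (X -> R) -> R) : compact K ->
  (forall a F G, bdd K F -> bdd K G -> La (fun z => a * F z + G z) = a * La F + La G) ->
  (forall F, bdd K F -> (forall z, K z -> 0 <= F z) -> 0 <= La F) ->
  exists mu : {measure set (Borel X) -> \bar R}, mu (~` K) = 0%E /\
    forall f : C, ((La f)%:E = \int[mu]_y (f y)%:E)%E.
Proof.
move=> cK LaL La0; pose cst0 (f : C) : cochain M 0 := fun=> f.
have fcst f : is_form (cst0 f) by split=> [V i|V i]; case: i.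
pose V0 : 'I_0 -> VF := fun=> 0.
have pl y : K y -> planes g (cst0 1) K (y, V0).
  by move=> Ky; split=> //; split=> [k|]; [case: k|exact: sf1].
have bd (F : _ -> R) : bdd (planes g (cst0 1) K) F -> bdd K (fun y => F (y, V0)).
  by move=> [b Hb]; exists b => y Ky; apply: Hb; exact: pl.
have [a F G bF bG|F bF F0|mu [tau [[_ muK] mtau aetau Etau]]] :=
  @plane_representation _ _ _ _ M g (cst0 1) K (fcst 1) cK (fun F => La (fun y => F (y, V0))).
- by apply: LaL; exact: bd.
- by apply: La0 => [|y Ky]; [exact: bd|apply: F0; exact: pl].
exists mu; split=> // f; rewrite (Etau (cst0 f) (fcst f)); apply: ae_eq_integral => //.
- by apply/measurable_EFinP; exact: mtau.
- by apply/measurable_EFinP; apply: borel_continuous; exact: smooth_continuous.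
move: aetau; apply: (@filterS _ (almost_everywhere mu) _) => y [m [c [V [_ c1 _ Hc]]]] _ /=.
by rewrite (Hc _ (fcst f)) -mulr_suml c1 mul1r.
Qed.

Variables (p : nat) (phi : cochain M p.+1).
Hypotheses (cal : calibration g phi) (par : parallel g phi).

Lemma current_support_closed q (T : cochain M q -> R) : closed (current_support T).
Proof.
rewrite -[current_support T]setCK; apply: open_closedC.
rewrite openE => y /existsNP [U /not_implyP [oU /not_implyP [Uy nw]]].
apply: filterS (open_nbhs_nbhs (conj oU Uy)) => z Uz Tz.
by apply: nw; exact: Tz.
Qed.

Lemma form_off_support q (w : cochain M q) (B : set X) : form_support w `<=` B ->
  forall V y, ~ B y -> w V y = 0.
Proof.
move=> wB V y nB; apply/eqP; apply: contra_notT nB => wy.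
by apply: wB; apply: subset_closure; exists V.
Qed.

(** The order unit combines [h], strictly positive on the planes, with a constant
    negative enough to be strictly positive on [K] after the change of sign. *)
Theorem green_current_exists (K : set X) (x : X) : strictly_convex g phi ->
  compact K -> psh_hull g phi K x -> exists T, green_current g phi K x T.
Proof.
move=> sc cK Kx; have [h [hpos ch h1]] := exhaustion cal par sc.
have fphi : is_form phi by case: cal.
have [c0 [c01 hK hx]] : exists c0, [/\ 1 <= c0, forall y, K y -> h y <= c0 & h x <= c0].
  have [B B0 HB] := compact_bounded_fun cK (@smooth_continuous _ _ _ _ h).
  exists (B + h x); have := h1 x => hx1; split; [lra| |lra].
  by move=> y Ky; have := HB y Ky; rewrite ler_norml => /andP[]; lra.
pose A := [set y | h y <= c0 + 2]; have cA : compact A by exact: ch.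
pose Z := (X * ('I_p.+1 -> VF) + X)%type.
pose S : set Z := fun z => match z with inl z => planes g phi A z | inr y => K y end.
pose L (f : C) (z : Z) : R := match z with inl z => ddphi g phi f z.2 z.1 | inr y => - f y end.
have bddL f : bdd S (L f).
  have [b Hb] := bdd_form g fphi cA (dd_form cal par f).
  have [c cc Hc] := compact_bounded_fun cK (@smooth_continuous _ _ _ _ f).
  exists (Num.max b c) => -[z Sz|y Ky] /=; first by rewrite le_max (Hb z Sz).
  by rewrite normrN le_max (Hc y Ky) orbT.
have [K' [N [E [u [b [s [H1 b1 _]]]]]]] := compact_framed M cA.
have [d d0 Hd] := planes_positive cA (frame_eval H1 b1) fphi (dd_form cal par h)
  (fun y V _ oV => hpos y V oV).
have [di [di0 di1]] : exists di, 0 < di /\ 1 = di * d.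
  by exists d^-1; rewrite invr_gt0 mulVf ?gt_eqF.
pose e : C := di *: h + (- (di * c0 + 1)) *: (1 : C).
have eE y : e y = di * h y - (di * c0 + 1) by rewrite /e sfD !sfZ sf1 mulr1.
have e1 z : S z -> 1 <= L e z.
  case: z => [[y V] [Ay oV]|y Ky]; last rewrite -[L e _]/(- e y).
    rewrite -[L e _]/(ddphi g phi e V y) /e (dd_affine cal par) di1 ler_pM2l//.
    exact: Hd.
  rewrite eE; have : di * h y <= di * c0 by rewrite ler_pM2l// hK.
  by lra.
have LL a f f' z : [set: C] f -> [set: C] f' -> S z -> L (a *: f + f') z = a * L f z + L f' z.
  move=> _ _ _; case: z => [z|y]; first exact: (dd_lin cal par).
  change (- (a *: f + f') y = a * - f y + - f' y).
  by rewrite sfD sfZ opprD mulrN.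
have ellL a f f' : [set: C] f -> [set: C] f' -> - (a *: f + f') x = a * (- f x) + - f' x.
  by move=> _ _; rewrite sfD sfZ opprD mulrN.
have pos f : [set: C] f -> (forall z, S z -> 0 <= L f z) -> 0 <= - f x.
  move=> _ Lf; rewrite oppr_ge0.
  apply: (hull_functional cal par hpos ch h1 hK hx c01 Kx) => [y V Ay oV|y Ky].
    by apply: (Lf (inl (y, V))); split.
  by have := Lf (inr y) Ky; rewrite /= oppr_ge0.
have [La [LaL La0 LaE]] := positive_extension (P := [set: C]) Logic.I (fun a f f' _ _ => Logic.I)
  LL ellL (fun f _ => bddL f) pos (Logic.I : [set: C] e) e1.
pose ext1 (F : X * ('I_p.+1 -> VF) -> R) (z : Z) : R := match z with inl z => F z | inr _ => 0 end.
pose ext2 (F : X -> R) (z : Z) : R := match z with inl _ => 0 | inr y => F y end.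
have bext1 F : bdd (planes g phi A) F -> bdd S (ext1 F).
  move=> [c Hc]; exists `|c| => -[z Sz|y _] /=; last by rewrite normr0.
  exact: le_trans (Hc z Sz) (ler_norm c).
have bext2 F : bdd K F -> bdd S (ext2 F).
  move=> [c Hc]; exists `|c| => -[z _|y Ky] /=; first by rewrite normr0.
  exact: le_trans (Hc y Ky) (ler_norm c).
pose La1 F := La (ext1 F); pose La2 F := La (ext2 F).
have La1L a F G : bdd (planes g phi A) F -> bdd (planes g phi A) G ->
    La1 (fun z => a * F z + G z) = a * La1 F + La1 G.
  move=> bF bG; rewrite /La1 -LaL; [|exact: bext1..].
  by congr La; apply/funext => -[z|y] //=; rewrite mulr0 addr0.
have La2L a F G : bdd K F -> bdd K G -> La2 (fun z => a * F z + G z) = a * La2 F + La2 G.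
  move=> bF bG; rewrite /La2 -LaL; [|exact: bext2..].
  by congr La; apply/funext => -[z|y] //=; rewrite mulr0 addr0.
have La10 F : bdd (planes g phi A) F -> (forall z, planes g phi A z -> 0 <= F z) -> 0 <= La1 F.
  by move=> bF F0; apply: La0 => [|[z Sz|y _]] //=; [exact: bext1|exact: F0].
have La20 F : bdd K F -> (forall z, K z -> 0 <= F z) -> 0 <= La2 F.
  by move=> bF F0; apply: La0 => [|[z _|y Ky]] //=; [exact: bext2|exact: F0].
have bK (f : C) : bdd K f.
  have [c cc Hc] := compact_bounded_fun cK (@smooth_continuous _ _ _ _ f).
  by exists c.
have LaS f : La1 (fun z => ddphi g phi f z.2 z.1) = La2 f - f x.
  have bf : bdd (planes g phi A) (fun z => ddphi g phi f z.2 z.1).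
    exact: (bdd_form g fphi cA (dd_form cal par f)).
  have := LaE f Logic.I; have -> : L f = (fun z => (- 1) * ext2 f z + ext1 (fun z => ddphi g phi f z.2 z.1) z).
    by apply/funext => -[z|y] /=; rewrite ?mulr0 ?add0r ?addr0 ?mulN1r.
  by rewrite LaL ?mulN1r; [rewrite /La1 /La2; lra|exact: bext2|exact: bext1].
have [mu [tau [[mufin muA] mtau aetau Etau]]] := plane_representation fphi cA La1L La10.
have [nu [nuK Enu]] := compact_representation cK La2L La20.
pose T (w : cochain M p.+1) := La1 (fun z => w z.2 z.1).
have Tlin a v w : is_form v -> is_form w -> T (a *: v + w) = a * T v + T w.
  move=> fv fw; rewrite /T -La1L; [|exact: (bdd_form g fphi cA)..].
  by congr La1; apply/funext => z; rewrite -[LHS]/((a *: v z.2 + w z.2) z.1) sfD sfZ.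
have b1' : bdd (planes g phi A) (fun=> 1 : R) by exists 1 => z _; rewrite normr1.
have Tle w c : is_form w -> 0 <= c -> (forall y V, A y -> oplane g phi y V -> `|w V y| <= c) ->
    `|T w| <= c * La1 (fun=> 1).
  move=> fw c_ge0 Hc; have bw := bdd_form g fphi cA fw.
  have ge c' : 0 <= La1 (fun z => c' * 1 + w z.2 z.1) -> 0 <= c' * La1 (fun=> 1) + T w.
    by rewrite La1L.
  have le c' : 0 <= La1 (fun z => - 1 * w z.2 z.1 + (c' * 1 + 0 * w z.2 z.1)) -> T w <= c' * La1 (fun=> 1).
    have b0 : bdd (planes g phi A) (fun z => 0 * w z.2 z.1) by exists 0 => z _; rewrite mul0r normr0.
    have EE : La1 (fun z => 0 * w z.2 z.1) = 0.
      have := La1L (- 1) _ _ b0 b0; rewrite (_ : (fun z => _) = (fun z => 0 * w z.2 z.1)).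
        by move=> H2; lra.
      by apply/funext => z; lra.
    by rewrite La1L//; [rewrite La1L// EE -/(T w); lra|exact: bdd_lin].
  rewrite ler_norml; apply/andP; split.
    have : 0 <= c * La1 (fun=> 1) + T w; last by lra.
    apply: ge; apply: La10 => [|[y V] [Ay oV] /=]; first exact: bdd_lin.
    by have := Hc y V Ay oV; rewrite ler_norml => /andP[? ?]; lra.
  apply: le; apply: La10 => [|[y V] [Ay oV] /=].
    apply: bdd_lin => //; apply: bdd_lin => //.
    by exists 0 => z _; rewrite mul0r normr0.
  by have := Hc y V Ay oV; rewrite ler_norml => /andP[? ?]; lra.
have clA : closed A by apply: compact_closed => //; exact: (manifold_hausdorff M).
have [N1 [W [m1 HW]]] := planes_seminorm fphi cA.
have L1 : 0 <= La1 (fun=> 1) by apply: La10.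
have curT : is_current T.
  split=> [a v w [fv _] [fw _]|B cB]; first exact: Tlin.
  exists N1, (fun=> [::]), W, (Num.max m1 0 * La1 (fun=> 1)) => w fw wB c c_ge0 Hc.
  rewrite mulrAC; apply: Tle => //; first by rewrite mulr_ge0// le_max lexx orbT.
  move=> y V Ay oV; apply: (@le_trans _ _ (m1 * c)); last by rewrite ler_wpM2r// le_max lexx.
  apply: HW => // k z Az; have [Bz|nBz] := pselect (B z); first exact: (Hc k z Bz).
  by rewrite (form_off_support wB)// normr0.
exists T; split.
- split=> //; exists mu, tau; split=> //.
    move=> B cB; apply: le_lt_trans mufin.
    have mB : measurable (~` ~` B : set (Borel X)).
      apply: measurableC; apply: sub_sigma_algebra.
      by apply: closed_openC; apply: compact_closed => //; exact: (manifold_hausdorff M).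
    rewrite setCK in mB; apply: le_measure => //; apply/mem_set => //; exact: measurableT.
  by move=> w [fw _]; exact: Etau.
- apply: (subclosed_compact (@current_support_closed _ T) cA) => y Ty; apply: contrapT => nAy.
  have [w [[fw _] wU /eqP Tw]] := Ty (~` A) (closed_openC clA) nAy; apply: Tw.
  have : `|T w| <= 0 * La1 (fun=> 1).
    apply: Tle => // z V Az _; rewrite (form_off_support wU) ?normr0//.
  by rewrite mul0r normr_le0 => /eqP.
have nu1 : nu setT = 1%E.
  have := Enu 1; under eq_integral do rewrite sf1.
  rewrite integral_cst// mul1e => <-; congr (_%:E).
  have := LaS 1; rewrite sf1 => La21.
  have E0 : La1 (fun z => ddphi g phi 1 z.2 z.1) = T (ddphi g phi (1 *: (1 : C))) by rewrite scale1r.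
  have : `|T (ddphi g phi (1 *: (1 : C)))| <= 0 * La1 (fun=> 1).
    by apply: Tle => //[|y V _ _]; [exact: (dd_form cal par)|rewrite (dd_cst cal par) normr0].
  rewrite mul0r normr_le0 => /eqP; rewrite -E0 La21 => H.
  by apply/eqP; rewrite -subr_eq0 H.
pose P : probability (Borel X) R := mnormalize nu (\d_(x : Borel X)).
have PE B : measurable B -> P B = nu B.
  by move=> mB; rewrite /P /= /mnormalize nu1 /= onee_eq0 /=; rewrite invr1 mule1.
exists P.
  move=> y Py; apply: contrapT => nKy.
  have clK : closed K by apply: compact_closed => //; exact: (manifold_hausdorff M).
  have mKc : measurable (~` K : set (Borel X)) by apply: sub_sigma_algebra; exact: closed_openC.
  have : (0 < 0 :> \bar R)%E := eq_ind _ (fun t => (0 < t)%E)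
    (Py (~` K) (closed_openC clK) nKy) _ (etrans (PE _ mKc) nuK).
  by rewrite ltxx.
move=> f _; have mf : measurable_fun setT (fun y : Borel X => (f y)%:E).
  by apply/measurable_EFinP; apply: borel_continuous; exact: smooth_continuous.
rewrite integral_dirac// diracT mul1e.
rewrite (eq_measure_integral nu) => [|B mB _]; last exact: PE.
by rewrite -Enu -EFinB; congr (_%:E); exact: LaS.
Qed.

End green_exists.

(** * A point with a Green current lies in the hull *)

Lemma closure_least {X : topologicalType} (B F : set X) :
  closed F -> B `<=` F -> closure B `<=` F.
Proof. by move=> cF BF y /(closure_subset BF); exact: cF. Qed.

(** A countable basis reduces the set to countably many null basic open sets. *)
Lemma locally_null {R : realType} {X : ptopologicalType}
    (mu : {measure set (Borel X) -> \bar R}) (O : set X) : @second_countable X ->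
  (forall y, O y -> exists U : set X, [/\ open U, U y & mu U = 0%E]) ->
  mu.-negligible (O : set (Borel X)).
Proof.
move=> [B /countable_injP [i inj] [oB bB]] HO.
pose F (k : nat) : set (Borel X) := [set y | exists V : set X, [/\ B V, mu V = 0%E, i V = k & V y]].
have NF : mu.-negligible (\bigcup_k F k).
  apply: negligible_bigcup => k.
  have [[V [BV V0 iV]]|nV] := pselect (exists V : set X, [/\ B V, mu V = 0%E & i V = k]).
    exists V; split=> //; first by apply: sub_sigma_algebra; exact: oB.
    move=> y [V' [BV' _ iV' V'y]]; suff -> : V = V' by [].
    by apply: inj; [exact/mem_set|exact/mem_set|rewrite iV].
  exists set0; split=> // y [V [BV V0 iV _]].
  by exfalso; apply: nV; exists V.
apply: negligibleS NF => y Oy; have [U [oU Uy U0]] := HO y Oy.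
have [V [BV Vy VU]] := bB y U (open_nbhs_nbhs (conj oU Uy)).
exists (i V) => //; exists V; split=> //.
apply: (@subset_measure0 _ _ _ mu (V : set (Borel X)) (U : set (Borel X))) => //.
  by apply: sub_sigma_algebra; exact: oB.
exact: sub_sigma_algebra.
Qed.

Lemma ae_integral_ge0 d (T : measurableType d) (R : realType)
    (mu : {measure set T -> \bar R}) (G : T -> R) : measurable_fun setT G ->
  {ae mu, forall y, 0 <= G y} -> (0 <= \int[mu]_y (G y)%:E)%E.
Proof.
move=> mG G0; rewrite (ae_eq_integral (fun y => (`|G y|)%:E))//.
- by apply: integral_ge0 => y _; rewrite lee_fin.
- exact/measurable_EFinP.
- by apply/measurable_EFinP; exact: measurableT_comp.
by move: G0; apply: (@filterS _ (almost_everywhere mu) _) => y Gy _ /=; rewrite ger0_norm.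
Qed.

Lemma ae_integral_le0 d (T : measurableType d) (R : realType)
    (mu : {measure set T -> \bar R}) (G : T -> R) : measurable_fun setT G ->
  {ae mu, forall y, G y <= 0} -> (\int[mu]_y (G y)%:E <= 0)%E.
Proof.
move=> mG G0; rewrite (ae_eq_integral (fun y => - (`|G y|)%:E)%E)//.
- rewrite integral_ge0N => [|y _]; last by rewrite lee_fin.
  by rewrite leeNl oppe0; apply: integral_ge0 => y _; rewrite lee_fin.
- exact/measurable_EFinP.
- by apply: measurableT_comp => //; apply/measurable_EFinP; exact: measurableT_comp.
move: G0; apply: (@filterS _ (almost_everywhere mu) _) => y Gy _ /=.
by rewrite ler0_norm//= opprK.
Qed.

Section green_hull.
Context {R : realType} {X : ptopologicalType} {n p : nat}.
Variable M : smooth_manifold R X n.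
Variable g : riemannian_metric M.
Local Notation C := (smoothfun M).
Local Notation VF := (vfield M).
Variable phi : cochain M p.+1.
Hypotheses (cal : calibration g phi) (par : parallel g phi).

(** Off the support, [T] vanishes on the forms [b * phi] with [b] a bump function; as
    [phi] is 1 on the hull of the planes, these values are the integrals of [b]
    against the mass. *)
Lemma positive_mass_support (T : cochain M p.+1 -> R)
    (mu : {measure set (Borel X) -> \bar R}) (tau : Borel X -> cochain M p.+1 -> R) :
  (forall w, is_form w -> measurable_fun setT (tau^~ w)) ->
  {ae mu, forall y, plane_hull g phi y (tau y)} ->
  (forall w, test_form w -> (T w)%:E = (\int[mu]_y (tau y w)%:E)%E) ->
  mu.-negligible (~` current_support T : set (Borel X)).
Proof.
move=> mtau aetau ET; apply: locally_null; first exact: (manifold_second_countable M).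
move=> y /existsNP [U /not_implyP [oU /not_implyP [Uy nw]]].
have [b [N [F [oN Ny NF [FU cF] [b1 b0 bF]]]]] := sf_bump M oU Uy.
have fphi : is_form phi by case: cal.
pose w : cochain M p.+1 := fun V => b * phi V.
have clF : closed F by apply: compact_closed => //; exact: (manifold_hausdorff M).
have fw : is_form w.
  split=> [V i f V1 V2|V i j ij VV]; rewrite /w.
    by rewrite fphi.1 mulrDr mulrCA.
  by rewrite (fphi.2 _ _ _ ij VV) mulr0.
have wF : form_support w `<=` F.
  apply: closure_least => // z [V]; apply: contra_neqP => nFz.
  by rewrite sfM bF// mul0r.
have tw : test_form w by split=> //; apply: subclosed_compact cF wF; exact: closed_closure.
have Tw : T w = 0.
  apply: contrapT => /eqP Tw; apply: nw; exists w; split=> //.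
  exact: subset_trans wF FU.
exists N; split=> //; have mN : measurable (N : set (Borel X)) by exact: sub_sigma_algebra.
apply/eqP; rewrite eq_le measure_ge0 andbT.
have E : (\int[mu]_z (b z)%:E = 0)%E.
  rewrite -[RHS]/((0 : R)%:E) -Tw ET//; apply: ae_eq_integral => //.
  - by apply/measurable_EFinP; apply: borel_continuous; exact: smooth_continuous.
  - by apply/measurable_EFinP; exact: mtau.
  move: aetau; apply: (@filterS _ (almost_everywhere mu) _) => z [m [c [V [c0 c1 pV Hc]]]] _ /=.
  rewrite (Hc _ fw); under eq_bigr => k _ do rewrite /w sfM (pV k).2 mulr1.
  by rewrite -mulr_suml c1 mul1r.
rewrite -E -(setIT N) -integral_indic//; apply: ge0_le_integral => //.
- by apply/measurable_EFinP; exact: measurable_indic.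
- by apply/measurable_EFinP; apply: borel_continuous; exact: smooth_continuous.
move=> z _; rewrite lee_fin indicE; have [/set_mem Nz|_] := boolP (z \in N); last exact: b0.
by rewrite b1.
Qed.

(** Test the current with a cutoff of [f - a], where [a] bounds [f] on [K] and lies
    below [f x]: the equation of the Green current would equate a nonnegative and a
    negative number. *)
Theorem green_current_hull (K : set X) (x : X) (T : cochain M p.+1 -> R) :
  strictly_convex g phi -> compact K -> green_current g phi K x T -> psh_hull g phi K x.
Proof.
move=> sc cK [[_ [mu [tau [_ mtau aetau ET]]]] cT [P PK EP]] f pf.
have [h [_ ch _]] := exhaustion cal par sc.
have muT := positive_mass_support mtau aetau ET.
have PnK : P.-negligible (~` K : set (Borel X)).
  apply: locally_null; first exact: (manifold_second_countable M).
  move=> y nKy; have /existsNP [U /not_implyP [oU /not_implyP [Uy nU]]] : ~ measure_support P y.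
    by move=> /PK.
  exists U; split=> //; apply/eqP; rewrite eq_le measure_ge0 andbT leNgt; exact/negP.
have [c [hT hK hx]] : exists c, [/\ forall y, current_support T y -> h y <= c,
    forall y, K y -> h y <= c & h x <= c].
  have [B1 _ HB1] := compact_bounded_fun cT (@smooth_continuous _ _ _ _ h).
  have [B2 _ HB2] := compact_bounded_fun cK (@smooth_continuous _ _ _ _ h).
  exists (Num.max (Num.max B1 B2) (h x)); split=> [y Ty|y Ky|]; rewrite !le_max ?lexx ?orbT//.
    by rewrite (le_trans (ler_norm _) (HB1 y Ty)).
  by rewrite (le_trans (ler_norm _) (HB2 y Ky)) orbT.
have [eta [eta1 eta0]] := cutoff h (c + 1).
rewrite leNgt; apply/negP => Sfx.
have [a [fa afx]] : exists a, (forall y, K y -> f y <= a) /\ a < f x.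
  have [[y0 Ky0]|K0] := pselect (K !=set0); last first.
    exists (f x - 1); split; last by lra.
    by move=> y Ky; exfalso; apply: K0; exists y.
  move: Sfx; set S := ereal_sup _ => Sfx.
  have fS y : K y -> ((f y)%:E <= S)%E by move=> Ky; apply: ereal_sup_ubound; exists y.
  have Sfin : S \is a fin_num.
    by rewrite fin_real// (lt_le_trans (ltNyr (f y0)) (fS _ Ky0)) (lt_trans Sfx (ltry _)).
  exists (fine S); split=> [y Ky|]; first by rewrite -lee_fin fineK// fS.
  by rewrite -lte_fin fineK.
pose f' : C := 1 *: f + (- a) *: (1 : C).
have f'E y : f' y = f y - a by rewrite /f' sfD !sfZ sf1 mul1r mulr1.
have df' V y : ddphi g phi f' V y = ddphi g phi f V y.
  by rewrite (dd_affine cal par); exact: mul1r.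
pose F := eta * f'.
have Fnear y : h y <= c -> F y = f y - a.
  by move=> hy; rewrite /F sfM eta1 ?mul1r ?f'E//; lra.
have oh (D : set R) : open D -> open (h @^-1` D).
  by move=> oD; have /continuousP := @smooth_continuous _ _ _ _ h; apply.
have dFnear y V : h y <= c -> ddphi g phi F V y = ddphi g phi f V y.
  move=> hy; rewrite -df'; apply: (dd_loc cal par (U := h @^-1` `]-oo, c + 1[)).
  - exact/oh/interval_open.
  - by rewrite /= in_itv/=; lra.
  - move=> z hz; rewrite /F sfM eta1 ?mul1r//.
    by move: hz; rewrite /= in_itv/=; exact: ltW.
pose A := [set y | h y <= c + 1 + 1]; have cA : compact A by exact: ch.
have clA : closed A by apply: compact_closed => //; exact: (manifold_hausdorff M).
have FA y : ~ A y -> F y = 0.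
  by move=> /negP; rewrite -ltNge => hy; rewrite /F sfM eta0 ?mul0r// ltW.
have cF : compact (fun_support F).
  apply: (subclosed_compact (@closed_closure _ _) cA).
  apply: closure_least => // z.
  by apply: contra_neqP => /FA.
have fw := dd_form cal par F.
have wA V y : ~ A y -> ddphi g phi F V y = 0.
  move=> nA; rewrite -(dd_cst cal par 0 V y); apply: (dd_loc cal par (U := ~` A)) => //.
  - exact: closed_openC.
  - by move=> z /FA ->; rewrite sfZ mul0r.
have tw : test_form (ddphi g phi F).
  split=> //; apply: (subclosed_compact (@closed_closure _ _) cA).
  apply: closure_least => // z [V].
  by apply: contra_neqP => /wA.
have T0 : (0 <= (T (ddphi g phi F))%:E)%E.
  rewrite ET//; apply: ae_integral_ge0; first exact: mtau.
  have aT : {ae mu, forall y : Borel X, current_support T y} by [].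
  move: aT; apply: (@filterS2 _ (almost_everywhere mu) _ _ _ _ _ aetau) => y [m [cc [V [c0 c1 pV Hc]]]] Ty.
  rewrite (Hc _ fw); apply: sumr_ge0 => k _; rewrite mulr_ge0// dFnear ?hT//.
  by apply: pf; exact: pV.
have mF : measurable_fun setT (F : Borel X -> R) by apply: borel_continuous; exact: smooth_continuous.
have := EP F cF; rewrite /boundary_phi integral_dirac//; last exact/measurable_EFinP.
rewrite diracT mul1e Fnear// => EF.
have : (\int[P]_y (F y)%:E <= 0)%E.
  apply: ae_integral_le0 => //; have aK : {ae P, forall y : Borel X, K y} by [].
  move: aK; apply: (@filterS _ (almost_everywhere P) _) => y Ky.
  by rewrite Fnear ?hK// subr_le0 fa.
have := T0; rewrite EF sube_ge0 ?fin_numE// => h1 h2.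
by have := le_trans h1 h2; rewrite lee_fin subr_le0 leNgt afx.
Qed.

End green_hull.

Theorem theorem6p8 (R : realType) (X : ptopologicalType) (n p : nat)
    (M : smooth_manifold R X n) (g : riemannian_metric M)
    (phi : cochain M p.+1) (K : set X) (x : X) :
  ~ compact [set: X] -> connected [set: X] ->
  calibration g phi -> parallel g phi -> strictly_convex g phi ->
  compact K -> (~` K) x ->
  (exists T : cochain M p.+1 -> R, green_current g phi K x T) <->
  psh_hull g phi K x.
Proof.
move=> _ _ cal par sc cK _; split=> [[T]|Kx].
  exact: green_current_hull cal par K x T sc cK.
exact: green_current_exists.
Qed.
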